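(* Let $k\in\widetilde{\mathbb R}_{>0}$ be a positive infinite number, $K:=[-k,k]^n$, let $K\subseteq X\subseteq\widetilde{\mathbb R}^n$ and let $f\in{}^{\rho}\mathcal{GC}^{\infty}(X)$. Then for every point $y$ in the sharp interior $\mathring K$ of $K$ we have $$\lim_{h\to+\infty}\mathcal F_h^{-1}\big(\mathcal F_k(f)\big)(y)=\lim_{h\to+\infty}\mathcal F_h\big(\mathcal F_k^{-1}(f)\big)(y)=f(y),$$ where the limits are in the sharp topology, for $h\in\widetilde{\mathbb R}_{>0}$ infinite.
   Context: Fix a gauge $\rho=(\rho_\varepsilon)_{\varepsilon\in(0,1]}$: a net in $(0,1]$ with $\rho_\varepsilon\to0$ as $\varepsilon\to0^+$. ''For $\varepsilon$ small'' means for all $\varepsilon\in(0,\varepsilon_0]$, for some $\varepsilon_0$. A net $(x_\varepsilon)$ of reals is $\rho$-moderate if for some $N\in\mathbb N$, $|x_\varepsilon|\le\rho_\varepsilon^{-N}$ for $\varepsilon$ small; $(x_\varepsilon)\sim(y_\varepsilon)$ if for every $m\in\mathbb N$, $|x_\varepsilon-y_\varepsilon|\le\rho_\varepsilon^m$ for $\varepsilon$ small. $\widetilde{\mathbb R}$ is the quotient ring of moderate nets by $\sim$, with classes $[x_\varepsilon]$; $\widetilde{\mathbb C}:=\widetilde{\mathbb R}+i\widetilde{\mathbb R}$; $\mathrm d\rho:=[\rho_\varepsilon]$. Order: $[x_\varepsilon]\le[y_\varepsilon]$ iff there are representatives with $x_\varepsilon\le y_\varepsilon$ for all $\varepsilon$;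 $x<y$ means $x\le y$ and $y-x$ is invertible; $\widetilde{\mathbb R}_{>0}:=\{x\mid x>0\}$. On $\widetilde{\mathbb R}^n$, $|[x_\varepsilon]|:=[|x_\varepsilon|]$. $[a,b]:=\{x\in\widetilde{\mathbb R}\mid a\le x\le b\}$. The sharp topology on $\widetilde{\mathbb R}^n$ has as base the balls $B_r(c)=\{x\mid |x-c|<r\}$, $r\in\widetilde{\mathbb R}_{>0}$. $x$ is infinite if $|x|\ge r$ for all $r\in\mathbb R_{>0}$. Generalized smooth functions (GSF): for $X\subseteq\widetilde{\mathbb R}^n$ and $Y\subseteq\widetilde{\mathbb R}^d$ (or $Y\subseteq\widetilde{\mathbb C}$), $f\in{}^{\rho}\mathcal{GC}^\infty(X,Y)$ means that $f:X\to Y$ and there is a net of smooth functions $f_\varepsilon\in\mathcal C^\infty(\mathbb R^n,\mathbb R^d)$ (or complex valued) such that for all $[x_\varepsilon]\in X$: $f([x_\varepsilon])=[f_\varepsilon(x_\varepsilon)]$ and $(\partial^\alpha f_\varepsilon(x_\varepsilon))$ is $\rho$-moderate for all $\alpha\in\mathbb N^n$. ${}^{\rho}\mathcal{GC}^\infty(X):={}^{\rho}\mathcal{GC}^\infty(X,\widetilde{\mathbb C})$. For a box, $\int_{\prod_i[a_i,b_i]}f\,\mathrm dx:=\big[\int_{a_{1,\varepsilon}}^{b_{1,\varepsilon}}\mathrm dx_1\dots\int_{a_{n,\varepsilon}}^{b_{n,\varepsilon}}f_\varepsilon\,\mathrm dx_n\big]$ (independent of representatives). For an infinite $k\in\widetilde{\mathbb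 R}_{>0}$, $K=[-k,k]^n$ and $f\in{}^{\rho}\mathcal{GC}^\infty(K)$, the hyperfinite Fourier transform and its inverse are, for $\omega,x\in\widetilde{\mathbb R}^n$, $\mathcal F_k(f)(\omega):=\int_K f(x)e^{-ix\cdot\omega}\,\mathrm dx$ and $\mathcal F_k^{-1}(f)(x):=(2\pi)^{-n}\int_K f(\omega)e^{ix\cdot\omega}\,\mathrm d\omega$; both define elements of ${}^{\rho}\mathcal{GC}^\infty(\widetilde{\mathbb R}^n)$. If $f$ is defined on $X\supseteq K$, $\mathcal F_k(f)$ means $\mathcal F_k(f|_K)$ (and similarly for the inverse and for $h$ with $H=[-h,h]^n$). $\lim_{h\to+\infty}a(h)=l$ in the sharp topology means: $\forall q\in\mathbb N\,\exists\bar h\in\widetilde{\mathbb R}\,\forall h\in\widetilde{\mathbb R},\ h\ge\bar h:\ |a(h)-l|\le\mathrm d\rho^q$. *)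

(* Defs.v *)
From HB Require Import structures.
From mathcomp Require Import all_boot all_order all_algebra.
From mathcomp Require Import ring_quotient complex.
From mathcomp Require Import all_classical all_reals all_analysis.
From mathcomp Require Import ring lra.

Set Implicit Arguments.
Unset Strict Implicit.
Unset Printing Implicit Defensive.

Import Order.TTheory GRing.Theory Num.Theory.
Import numFieldNormedType.Exports.
Import ComplexField ComplexField.Normc.

Local Open Scope classical_set_scope.
Local Open Scope ring_scope.
Local Open Scope quotient_scope.

(* Nets indexed by (0, 1] are total functions of a real variable; their values
   outside (0, 1] never matter. "For e small" is the filter [0^'+]. *)
Record gauge (R : realType) := Gauge {
  gauge_fun :> R -> R ;
  gauge_itv : forall e : R, 0 < e <= 1 -> 0 < gauge_fun e <= 1 ;
  gauge_cvg : gauge_fun e @[e --> 0^'+] --> (0 : R) }.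

Section Nets.
Context {R : realType} (rho : gauge R).
Implicit Types (u v : R -> R).

Definition moderate u :=
  exists N : nat, \forall e \near 0^'+, `|u e| <= rho e ^- N.

Definition rho_negligible u :=
  forall m : nat, \forall e \near 0^'+, `|u e| <= rho e ^+ m.

Lemma near_gauge : \forall e \near 0^'+, 0 < rho e <= 1.
Proof.
near=> e; apply: gauge_itv; apply/andP; split => //.
by apply: ltW; near: e; exact: nbhs_right_lt.
Unshelve. all: by end_near. Qed.

Lemma near_gauge_lt (d : R) : 0 < d -> \forall e \near 0^'+, rho e < d.
Proof.
move=> d0; have := @gauge_cvg _ rho => /cvgr_lt /(_ _ d0).
by apply: filterS.
Qed.

Lemma gaugeV_le e (m p : nat) : 0 < rho e <= 1 -> (m <= p)%N ->
  rho e ^- m <= rho e ^- p.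
Proof.
move=> /andP[r0 r1] mp; rewrite lef_pV2 ?posrE ?exprn_gt0 //.
by apply: ler_wiXn2l => //; exact: ltW.
Qed.

Lemma moderate_cst (c : R) : moderate (fun=> c).
Proof.
have [N1 N2] : 0 < (`|c| + 1)^-1 /\ `|c| <= `|c| + 1.
  by rewrite invr_gt0; split; [exact: ltr_wpDl | rewrite lerDl].
exists 1%N; near=> e.
have re : 0 < rho e <= 1 by near: e; exact: near_gauge.
have rlt : rho e < (`|c| + 1)^-1 by near: e; exact: near_gauge_lt.
move: re => /andP[r0 _]; rewrite expr1; apply: (le_trans N2).
by rewrite -[leLHS]invrK lef_pV2 ?posrE // ltW.
Unshelve. all: by end_near. Qed.

Lemma negligible_moderate u : rho_negligible u -> moderate u.
Proof.
move=> hu; exists 0%N; near=> e.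
rewrite expr0 invr1.
by have -> : (1 : R) = rho e ^+ 0 by []; near: e; exact: hu.
Unshelve. all: by end_near. Qed.

Lemma moderateD u v : moderate u -> moderate v -> moderate (u + v).
Proof.
move=> [N hN] [M hM]; exists (N + M).+1; near=> e.
have re : 0 < rho e <= 1 by near: e; exact: near_gauge.
have rlt : rho e < 2^-1 by near: e; apply: near_gauge_lt.
have ue : `|u e| <= rho e ^- N by near: e.
have ve : `|v e| <= rho e ^- M by near: e.
have uN : `|u e| <= rho e ^- (N + M).
  by apply: (le_trans ue); apply: gaugeV_le => //; exact: leq_addr.
have vN : `|v e| <= rho e ^- (N + M).
  by apply: (le_trans ve); apply: gaugeV_le => //; exact: leq_addl.
apply: (le_trans (ler_normD _ _)); apply: (le_trans (lerD uN vN)).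
move: re => /andP[r0 r1]; rewrite exprS invfM -mulr2n -[leLHS]mulr_natl.
apply: ler_wpM2r; first by rewrite invr_ge0 exprn_ge0 // ltW.
by rewrite -[leLHS]invrK lef_pV2 ?posrE // ltW.
Unshelve. all: by end_near. Qed.

Lemma moderateN u : moderate u -> moderate (- u).
Proof.
by move=> [N hN]; exists N; move: hN; apply: filterS => e; rewrite /= normrN.
Qed.

Lemma moderateM u v : moderate u -> moderate v -> moderate (u * v).
Proof.
move=> [N hN] [M hM]; exists (N + M)%N; near=> e.
have ue : `|u e| <= rho e ^- N by near: e.
have ve : `|v e| <= rho e ^- M by near: e.
rewrite [(u * v) e]/(u e * v e) normrM exprD invfM.
exact: ler_pM.
Unshelve. all: by end_near. Qed.

Lemma rho_negligibleD u v :
  rho_negligible u -> rho_negligible v -> rho_negligible (u + v).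
Proof.
move=> hu hv m; near=> e.
have re : 0 < rho e <= 1 by near: e; exact: near_gauge.
have rlt : rho e < 2^-1 by near: e; apply: near_gauge_lt.
have ue : `|u e| <= rho e ^+ m.+1 by near: e; exact: hu.
have ve : `|v e| <= rho e ^+ m.+1 by near: e; exact: hv.
apply: (le_trans (ler_normD _ _)); apply: (le_trans (lerD ue ve)).
move: re => /andP[r0 r1]; rewrite exprS.
have : 0 <= rho e ^+ m by rewrite exprn_ge0 // ltW.
by nra.
Unshelve. all: by end_near. Qed.

Lemma rho_negligibleN u : rho_negligible u -> rho_negligible (- u).
Proof.
by move=> hu m; move: (hu m); apply: filterS => e; rewrite /= normrN.
Qed.

Lemma rho_negligibleM u v :
  moderate u -> rho_negligible v -> rho_negligible (u * v).
Proof.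
move=> [N hN] hv m; near=> e.
have /andP[r0 r1] : 0 < rho e <= 1 by near: e; exact: near_gauge.
have ue : `|u e| <= rho e ^- N by near: e.
have ve : `|v e| <= rho e ^+ (N + m) by near: e; exact: hv.
rewrite [(u * v) e]/(u e * v e) normrM.
have := ler_pM (normr_ge0 _) (normr_ge0 _) ue ve.
by rewrite exprD mulKf // expf_neq0 // gt_eqF.
Unshelve. all: by end_near. Qed.

Lemma rho_negligible0 : rho_negligible (0 : R -> R).
Proof.
move=> m; near=> e; rewrite [(0 : R -> R) e]/(0 : R) normr0.
have /andP[r0 _] : 0 < rho e <= 1 by near: e; exact: near_gauge.
by rewrite exprn_ge0 // ltW.
Unshelve. all: by end_near. Qed.

Lemma not_negligible1 : ~ rho_negligible (1 : R -> R).
Proof.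
move=> /(_ 1%N) h.
suff : \forall e \near (0 : R)^'+, False by move=> /filter_ex[].
near=> e.
have : rho e < 1 by near: e; apply: near_gauge_lt.
have : `|(1 : R -> R) e| <= rho e ^+ 1 by near: e.
by rewrite [(1 : R -> R) e]/(1 : R) normr1 expr1; lra.
Unshelve. all: by end_near. Qed.

Definition moderate_pred : pred (R -> R) := fun u => `[< moderate u >].

Lemma moderate_subring : subring_closed moderate_pred.
Proof.
split.
- by apply/asboolP; exact: moderate_cst.
- move=> u v /asboolP hu /asboolP hv; apply/asboolP.
  by apply: moderateD => //; exact: moderateN.
- by move=> u v /asboolP hu /asboolP hv; apply/asboolP; exact: moderateM.
Qed.

HB.instance Definition _ :=
  GRing.isSubringClosed.Build (R -> R) moderate_pred moderate_subring.

Record mnet := MNet { mnet_fun :> R -> R ; _ : mnet_fun \in moderate_pred }.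

HB.instance Definition _ := [isSub for mnet_fun].
HB.instance Definition _ := [Choice of mnet by <:].
HB.instance Definition _ := [SubChoice_isSubComNzRing of mnet by <:].

Definition negligible_pred : pred mnet :=
  fun x => `[< rho_negligible x >].

Lemma negligible_ideal : idealr_closed negligible_pred.
Proof.
split.
- by apply/asboolP; exact: rho_negligible0.
- by apply/asboolP; exact: not_negligible1.
- move=> a x y /asboolP hx /asboolP hy; apply/asboolP.
  apply: rho_negligibleD => //; apply: rho_negligibleM => //.
  by case: a => a /= /asboolP.
Qed.

HB.instance Definition _ :=
  isIdealr.Build mnet negligible_pred negligible_ideal.

Definition negligible_idealr : idealr mnet :=
  Idealr.clone mnet negligible_pred _.

Definition gR := {ideal_quot negligible_idealr}.

HB.instance Definition _ := GRing.ComNzRing.on gR.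
HB.instance Definition _ := isPointed.Build gR 0.

End Nets.

Section GenReals.
Context {R : realType} {rho : gauge R}.
Local Notation gR := (gR rho).
Local Notation moderate := (moderate rho).
Local Notation rho_negligible := (rho_negligible rho).
Implicit Types (u v : R -> R) (x y : gR).

(* The class [u_e]; junk value 0 if u is not moderate. *)
Definition gcls u : gR := \pi_gR (insubd (0 : mnet rho) u).

Definition grepr x : R -> R := repr x.

Definition represents x u := moderate u /\ gcls u = x.

Lemma grepr_moderate x : moderate (grepr x).
Proof. by rewrite /grepr; case: (repr x) => u /= /asboolP. Qed.

Lemma mnet_moderate u (hu : moderate u) : u \in moderate_pred rho.
Proof. exact/asboolP. Qed.

Lemma gcls_mnet u (hu : moderate u) :
  gcls u = \pi_gR (MNet (mnet_moderate hu)).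
Proof.
rewrite /gcls; congr (\pi_gR _); apply: val_inj.
by rewrite val_insubd (mnet_moderate hu).
Qed.

Lemma greprK x : gcls (grepr x) = x.
Proof.
rewrite -[RHS]reprK /gcls /grepr; congr (\pi_gR _); apply: val_inj.
by rewrite val_insubd; case: (repr x) => u /= ->.
Qed.

Lemma represents_grepr x : represents x (grepr x).
Proof. by split; [exact: grepr_moderate | exact: greprK]. Qed.

Lemma gcls_eqP u v : moderate u -> moderate v ->
  gcls u = gcls v <-> rho_negligible (u - v).
Proof.
move=> hu hv; rewrite (gcls_mnet hu) (gcls_mnet hv).
split=> [/eqP|h].
  by rewrite -Quotient.idealrBE => /asboolP.
by apply/eqP; rewrite -Quotient.idealrBE; apply/asboolP.
Qed.

Lemma gclsD u v : moderate u -> moderate v -> gcls (u + v) = gcls u + gcls v.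
Proof.
move=> hu hv; rewrite (gcls_mnet hu) (gcls_mnet hv).
rewrite (gcls_mnet (moderateD hu hv)) -rmorphD; congr (\pi_gR _).
exact: val_inj.
Qed.

Lemma gclsN u : moderate u -> gcls (- u) = - gcls u.
Proof.
move=> hu; rewrite (gcls_mnet hu) (gcls_mnet (moderateN hu)) -rmorphN.
by congr (\pi_gR _); exact: val_inj.
Qed.

Lemma gclsB u v : moderate u -> moderate v -> gcls (u - v) = gcls u - gcls v.
Proof. by move=> hu hv; rewrite gclsD ?gclsN //; exact: moderateN. Qed.

Lemma gclsM u v : moderate u -> moderate v -> gcls (u * v) = gcls u * gcls v.
Proof.
move=> hu hv; rewrite (gcls_mnet hu) (gcls_mnet hv).
rewrite (gcls_mnet (moderateM hu hv)) -rmorphM; congr (\pi_gR _).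
exact: val_inj.
Qed.

Lemma gcls1 : gcls (1 : R -> R) = 1.
Proof.
have h : moderate (1 : R -> R) by exact: moderate_cst.
rewrite (gcls_mnet h) -[RHS](rmorph1 (\pi_gR)); congr (\pi_gR _).
exact: val_inj.
Qed.

Lemma gcls0 : gcls (0 : R -> R) = 0.
Proof.
have h : moderate (0 : R -> R) by exact: moderate_cst.
rewrite (gcls_mnet h) -[RHS](rmorph0 (\pi_gR)); congr (\pi_gR _).
exact: val_inj.
Qed.

Definition ginvertible x := exists y, x * y = 1.

Definition gle x y := exists u v,
  [/\ represents x u, represents y v & forall e : R, 0 < e <= 1 -> u e <= v e].

(* This is not the strict order associated with gle. *)
Definition glt x y := gle x y /\ ginvertible (y - x).

Definition gabs x : gR := gcls (fun e => `|grepr x e|).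

Definition gcst (r : R) : gR := gcls (fun=> r).

Definition drho : gR := gcls rho.

Definition ginfinite x := forall r : R, 0 < r -> gle (gcst r) (gabs x).

Lemma moderate_rho m : moderate (fun e => rho e ^+ m).
Proof.
exists 0%N; near=> e.
have /andP[r0 r1] : 0 < rho e <= 1 by near: e; exact: near_gauge.
rewrite expr0 invr1 ger0_norm ?exprn_ge0 ?(ltW r0) //.
by rewrite exprn_ile1 // ltW.
Unshelve. all: by end_near. Qed.

Lemma gle_near u v : moderate u -> moderate v -> gle (gcls u) (gcls v) ->
  forall m, \forall e \near 0^'+, u e <= v e + rho e ^+ m.
Proof.
move=> hu hv [u' [v' [[hu' eu] [hv' ev] le]]] m.
have /gcls_eqP -/(_ hu' hu) nu := eu.
have /gcls_eqP -/(_ hv' hv) nv := ev.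
near=> e.
have /andP[r0 r1] : 0 < rho e <= 1 by near: e; exact: near_gauge.
have rlt : rho e < 2^-1 by near: e; apply: near_gauge_lt.
have : u' e <= v' e.
  apply: le; apply/andP; split => //.
  by apply: ltW; near: e; exact: nbhs_right_lt.
have : `|(u' - u) e| <= rho e ^+ m.+1 by near: e; exact: nu.
have : `|(v' - v) e| <= rho e ^+ m.+1 by near: e; exact: nv.
rewrite !fctE !ler_norml exprS.
have P0 : 0 <= rho e ^+ m by rewrite exprn_ge0 // ltW.
have : 2 * (rho e * rho e ^+ m) <= rho e ^+ m by nra.
move=> ? /andP[? ?] /andP[? ?] ?. lra.
Unshelve. all: by end_near. Qed.

Lemma gle_of_near u v : moderate u -> moderate v ->
  (\forall e \near 0^'+, u e <= v e) -> gle (gcls u) (gcls v).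
Proof.
move=> hu hv le; pose w : R -> R := fun e => Num.max (u e) (v e).
have nw : \forall e \near 0^'+, w e = v e.
  by move: le; apply: filterS => e h; rewrite /w max_r.
have hw : moderate w.
  case: hv => N hN; exists N; near=> e.
  by rewrite (near nw e) //; near: e.
exists u, w; split => //; last by move=> e _; rewrite /w le_max lexx.
split => //; apply/gcls_eqP => // m; near=> e.
rewrite !fctE (near nw e) // subrr normr0.
have /andP[r0 _] : 0 < rho e <= 1 by near: e; exact: near_gauge.
by rewrite exprn_ge0 // ltW.
Unshelve. all: by end_near. Qed.

Lemma gltP u v : moderate u -> moderate v ->
  glt (gcls u) (gcls v) <->
  exists m, \forall e \near 0^'+, rho e ^+ m <= v e - u e.
Proof.
move=> hu hv; split.
  move=> [le [z hz]].
  have [N hN] := grepr_moderate z.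
  have hvu : moderate (v - u) by exact: moderateD hv (moderateN hu).
  have hzm := grepr_moderate z.
  have hm : moderate ((v - u) * grepr z) by exact: moderateM.
  have : gcls ((v - u) * grepr z) = gcls 1.
    by rewrite gclsM // gclsB // greprK gcls1.
  move=> /gcls_eqP -/(_ hm (moderate_cst _ _)) ne.
  exists N.+1; near=> e.
  have /andP[r0 r1] : 0 < rho e <= 1 by near: e; exact: near_gauge.
  have rlt : rho e < 4^-1 by near: e; apply: near_gauge_lt.
  have zN : `|grepr z e| <= rho e ^- N by near: e.
  have le' : u e <= v e + rho e ^+ N.+1 by near: e; exact: gle_near.
  have : `|(v e - u e) * grepr z e - 1| <= rho e ^+ 1 by near: e; exact: ne.
  rewrite expr1 => /ler_normlP[+ _]; rewrite opprB => h1.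
  have h2 : 4^-1 * 3 <= (v e - u e) * grepr z e by lra.
  have h3 : 4^-1 * 3 <= `|v e - u e| * rho e ^- N.
    apply: (le_trans h2); apply: (le_trans (ler_norm _)); rewrite normrM.
    by apply: ler_wpM2l.
  have rN0 : 0 < rho e ^+ N by rewrite exprn_gt0.
  have h4 : 4^-1 * 3 * rho e ^+ N <= `|v e - u e| by rewrite -ler_pdivlMr.
  move: le' h4; rewrite exprS.
  by case: (ger0P (v e - u e)) => d0 le' h4; nra.
move=> [m hm]; split.
  apply: gle_of_near => //; near=> e.
  have /andP[r0 r1] : 0 < rho e <= 1 by near: e; exact: near_gauge.
  have : rho e ^+ m <= v e - u e by near: e.
  have : 0 < rho e ^+ m by rewrite exprn_gt0.
  by lra.
pose w : R -> R := fun e => (v e - u e)^-1.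
have hw : moderate w.
  exists m; near=> e.
  have /andP[r0 r1] : 0 < rho e <= 1 by near: e; exact: near_gauge.
  have h : rho e ^+ m <= v e - u e by near: e.
  have r0m : 0 < rho e ^+ m by rewrite exprn_gt0.
  have d0 : 0 < v e - u e by exact: lt_le_trans h.
  by rewrite /w normfV (gtr0_norm d0) lef_pV2 ?posrE.
have hvu : moderate (v - u) by exact: moderateD hv (moderateN hu).
exists (gcls w); rewrite -gclsB // -gclsM // -gcls1.
apply/gcls_eqP; [exact: moderateM|exact: moderate_cst|move=> p; near=> e].
have /andP[r0 r1] : 0 < rho e <= 1 by near: e; exact: near_gauge.
have h : rho e ^+ m <= v e - u e by near: e.
have r0m : 0 < rho e ^+ m by rewrite exprn_gt0.
have -> : ((v - u) * w - 1) e = (v e - u e) * (v e - u e)^-1 - 1 by [].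
rewrite divff ?subrr ?normr0.
  by rewrite exprn_ge0 // ltW.
by rewrite gt_eqF // (lt_le_trans _ h).
Unshelve. all: by end_near. Qed.

End GenReals.

(* Generalized complex numbers: R~ + iR~ *)
Section GenComplex.
Context {R : realType} (rho : gauge R).

Definition cmoderate (z : R -> R[i]) := moderate rho (fun e => normc (z e)).

Definition gC := (gR rho)[i].

HB.instance Definition _ := GRing.Zmodule.on gC.

Lemma gC_mul1 : left_id (1 +i* 0 : gC)%C (@mulc (gR rho)).
Proof. by move=> [a b] /=; rewrite !mul1r !mul0r subr0 addr0. Qed.

Lemma gC_mulDl : left_distributive (@mulc (gR rho)) (+%R : gC -> gC -> gC).
Proof.
move=> [a b] [c d] [e f] /=; congr Complex => /=; rewrite !mulrDl ?opprD.
  by rewrite -!addrA; congr (_ + _); rewrite addrCA.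
by rewrite -!addrA; congr (_ + _); rewrite addrCA.
Qed.

Lemma gC_one_neq0 : (1 +i* 0 : gC)%C != 0.
Proof. by apply/eqP => -[] /eqP; rewrite oner_eq0. Qed.

HB.instance Definition _ := GRing.Zmodule_isComNzRing.Build gC
  (@mulcA (gR rho)) (@mulcC (gR rho)) gC_mul1 gC_mulDl gC_one_neq0.

End GenComplex.

Section GenComplexTheory.
Context {R : realType} {rho : gauge R}.

Definition gC_of_gR (x : gR rho) : gC rho := (x +i* 0)%C.

Definition gccls (z : R -> R[i]) : gC rho :=
  (gcls (fun e => complex.Re (z e)) +i* gcls (fun e => complex.Im (z e)))%C.

Definition gcrepr (z : gC rho) (e : R) : R[i] :=
  (grepr (complex.Re z) e +i* grepr (complex.Im z) e)%C.

Definition gcabs (z : gC rho) : gR rho := gcls (fun e => normc (gcrepr z e)).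

Definition expi (t : R) : R[i] := (cos t +i* sin t)%C.

(* e^{it} for t in R~; only real t is needed, so no exponential net can fail
   to be moderate. *)
Definition gexpi (t : gR rho) : gC rho := gccls (fun e => expi (grepr t e)).

End GenComplexTheory.

Section GenVectors.
Context {R : realType} (rho : gauge R) (n : nat).

(* An alias of ['rV[gR rho]_n], so that the sharp topology does not compete
   with the entrywise one on matrices. *)
Definition gRn := 'rV[gR rho]_n.

HB.instance Definition _ := GRing.Zmodule.on gRn.
HB.instance Definition _ := isPointed.Build gRn 0.

End GenVectors.

Section SharpTopology.
Context {R : realType} {rho : gauge R} {n : nat}.
Local Notation gRn := (gRn rho n).
Implicit Types (x y c : gRn).

Definition grepr_vec x (e : R) : 'rV[R]_n := \row_i grepr (x 0 i) e.

Definition represents_vec x (u : R -> 'rV[R]_n) :=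
  forall i, represents (x 0 i) (fun e => u e 0 i).

Definition enorm (v : 'rV[R]_n) : R := Num.sqrt (\sum_i v 0 i ^+ 2).

Definition gnorm x : gR rho := gcls (fun e => enorm (grepr_vec x e)).

Definition gball c (r : gR rho) : set gRn := [set x | glt (gnorm (x - c)) r].

Lemma enorm_ge0 v : 0 <= enorm v. Proof. exact: sqrtr_ge0. Qed.

Lemma enorm_le_sum v : enorm v <= \sum_i `|v 0 i|.
Proof.
have S0 : 0 <= \sum_i `|v 0 i| by apply: sumr_ge0.
rewrite -(@ler_pXn2r _ 2) ?nnegrE ?enorm_ge0 // sqr_sqrtr; last first.
  by apply: sumr_ge0 => i _; exact: sqr_ge0.
rewrite expr2 mulr_suml; apply: ler_sum => i _.
rewrite -real_normK ?num_real // expr2; apply: ler_wpM2l => //.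
by rewrite (bigD1 i) //= lerDl; apply: sumr_ge0.
Qed.

Lemma cauchy_schwarz (v w : 'rV[R]_n) :
  (\sum_i v 0 i * w 0 i) ^+ 2 <= (\sum_i v 0 i ^+ 2) * (\sum_i w 0 i ^+ 2).
Proof.
set A := \sum_i v 0 i ^+ 2; set B := \sum_i w 0 i ^+ 2.
set P := \sum_i v 0 i * w 0 i.
have B0 : 0 <= B by apply: sumr_ge0 => i _; exact: sqr_ge0.
have key (a b : R) : 0 <= a ^+ 2 * A - 2 * a * b * P + b ^+ 2 * B.
  have -> : a ^+ 2 * A - 2 * a * b * P + b ^+ 2 * B =
      \sum_i (a * v 0 i - b * w 0 i) ^+ 2.
    rewrite /A /B /P !mulr_sumr -sumrB -big_split /=.
    by apply: eq_bigr => i _; ring.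
  by apply: sumr_ge0 => i _; exact: sqr_ge0.
have [B_gt0|] := ltP 0 B; last first.
  move=> B_le0; have BE : B = 0 by apply/eqP; rewrite eq_le B_le0 B0.
  suff -> : P = 0 by rewrite expr0n /= BE mulr0.
  rewrite /P big1 // => i _.
  have /eqP : w 0 i ^+ 2 = 0.
    move: BE => /eqP; rewrite psumr_eq0; last by move=> j _; exact: sqr_ge0.
    by move=> /allP /(_ i); rewrite mem_index_enum => /(_ isT) /eqP.
  by rewrite expf_eq0 /= => /eqP ->; rewrite mulr0.
have := key B P.
have -> : B ^+ 2 * A - 2 * B * P * P + P ^+ 2 * B = B * (A * B - P ^+ 2) by ring.
by rewrite pmulr_rge0 // subr_ge0.
Qed.

Lemma enorm_triangle v w : enorm (v + w) <= enorm v + enorm w.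
Proof.
have s0 (u : 'rV[R]_n) : 0 <= \sum_i u 0 i ^+ 2.
  by apply: sumr_ge0 => i _; exact: sqr_ge0.
rewrite -(@ler_pXn2r _ 2) ?nnegrE ?enorm_ge0 ?addr_ge0 ?enorm_ge0 //.
rewrite sqrrD !sqr_sqrtr //.
have -> : \sum_i (v + w) 0 i ^+ 2 = \sum_i v 0 i ^+ 2 +
    (\sum_i v 0 i * w 0 i) *+ 2 + \sum_i w 0 i ^+ 2.
  by rewrite -sumrMnl -!big_split /=; apply: eq_bigr => i _; rewrite mxE sqrrD.
rewrite lerD2r lerD2l lerMn2r /=.
apply: (le_trans (ler_norm _)); rewrite -sqrtrM // -sqrtr_sqr.
by apply: ler_wsqrtr; exact: cauchy_schwarz.
Qed.

Lemma enormN v : enorm (- v) = enorm v.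
Proof.
by congr (Num.sqrt _); apply: eq_bigr => i _; rewrite mxE sqrrN.
Qed.

Lemma enorm_dist v w : `|enorm v - enorm w| <= enorm (v - w).
Proof.
have h1 := enorm_triangle (v - w) w; have h2 := enorm_triangle (w - v) v.
rewrite -(enormN (w - v)) opprB in h2; rewrite !subrK in h1 h2.
by rewrite ler_norml; apply/andP; split; lra.
Qed.

Lemma negligible_sum (F : 'I_n -> R -> R) :
  (forall i, rho_negligible rho (F i)) ->
  rho_negligible rho (fun e => \sum_i F i e).
Proof.
move=> h; have -> : (fun e => \sum_i F i e) = \sum_i F i.
  by apply/funext => e; rewrite fct_sumE.
apply: (big_ind (rho_negligible rho)) => //; first exact: rho_negligible0.
exact: rho_negligibleD.
Qed.

Lemma moderate_sum (F : 'I_n -> R -> R) : (forall i, moderate rho (F i)) ->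
  moderate rho (fun e => \sum_i F i e).
Proof.
move=> h; have -> : (fun e => \sum_i F i e) = \sum_i F i.
  by apply/funext => e; rewrite fct_sumE.
apply: (big_ind (moderate rho)) => //; first exact: moderate_cst.
exact: moderateD.
Qed.

Lemma moderate_enorm (u : R -> 'rV[R]_n) :
  (forall i, moderate rho (fun e => u e 0 i)) ->
  moderate rho (fun e => enorm (u e)).
Proof.
move=> h; have [|N hN] := @moderate_sum (fun i e => `|u e 0 i|).
  move=> i; have [N hN] := h i; exists N; move: hN.
  by apply: filterS => e; rewrite normr_id.
exists N; move: hN; apply: filterS => e; apply: le_trans.
rewrite !ger0_norm ?enorm_ge0 ?enorm_le_sum //; exact: sumr_ge0.
Qed.

Lemma gcls_enorm_eq (u v : R -> 'rV[R]_n) :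
  (forall i, moderate rho (fun e => u e 0 i)) ->
  (forall i, rho_negligible rho (fun e => u e 0 i - v e 0 i)) ->
  (forall i, moderate rho (fun e => v e 0 i)) ->
  gcls (fun e => enorm (u e)) = gcls (fun e => enorm (v e)) :> gR rho.
Proof.
move=> hu huv hv; apply/gcls_eqP; [exact: moderate_enorm..|move=> m].
have : rho_negligible rho (fun e => \sum_i `|u e 0 i - v e 0 i|).
  apply: negligible_sum => i p; move: (huv i p).
  by apply: filterS => e; rewrite normr_id.
move=> /(_ m); apply: filterS => e; apply: le_trans.
apply: (le_trans (enorm_dist (u e) (v e))).
apply: (le_trans (enorm_le_sum _)); apply: (le_trans _ (ler_norm _)).
by apply: ler_sum => i _; rewrite !mxE.
Qed.

Lemma grepr_vecE x i : (fun e => grepr_vec x e 0 i) = grepr (x 0 i).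
Proof. by apply/funext => e; rewrite mxE. Qed.

Lemma grepr_vecBE x c i : (fun e => (grepr_vec x e - grepr_vec c e) 0 i) =
  grepr (x 0 i) - grepr (c 0 i).
Proof. by apply/funext => e; rewrite !mxE. Qed.

Lemma grepr_vecB_moderate x c i :
  moderate rho (fun e => (grepr_vec x e - grepr_vec c e) 0 i).
Proof.
rewrite grepr_vecBE.
exact: moderateD (grepr_moderate _) (moderateN (grepr_moderate _)).
Qed.

Lemma gnormBE x c : gnorm (x - c) =
  gcls (fun e => enorm (grepr_vec x e - grepr_vec c e)).
Proof.
apply: gcls_enorm_eq => i; [|move=> m|exact: grepr_vecB_moderate].
  by rewrite grepr_vecE; exact: grepr_moderate.
have h3 := grepr_moderate ((x - c) 0 i).
have h4 : moderate rho (grepr (x 0 i) - grepr (c 0 i)).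
  exact: moderateD (grepr_moderate _) (moderateN (grepr_moderate _)).
have := (gcls_eqP h3 h4).1.
rewrite gclsB; [|exact: grepr_moderate..].
rewrite !greprK !mxE => /(_ erefl) /(_ m).
by apply: filterS => e; rewrite !mxE.
Qed.

Lemma gballP c (r : gR rho) x : gball c r x <-> exists m, \forall e \near 0^'+,
  rho e ^+ m <= grepr r e - enorm (grepr_vec x e - grepr_vec c e).
Proof.
rewrite /gball /= gnormBE -{1}[r]greprK; apply: gltP; last exact: grepr_moderate.
by apply: moderate_enorm => i; exact: grepr_vecB_moderate.
Qed.

Definition gball_dom : set (gRn * gR rho) := [set p | glt 0 p.2].

Lemma drhoX_repr (m : nat) : forall p,
  \forall e \near 0^'+,
    `|grepr (gcls (fun e => rho e ^+ m) : gR rho) e - rho e ^+ m| <= rho e ^+ p.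
Proof.
move=> p; have h := @moderate_rho _ rho m.
exact: ((gcls_eqP (grepr_moderate _) h).1 (greprK _) p).
Qed.

Lemma drhoX_gt0 (m : nat) : glt 0 (gcls (fun e => rho e ^+ m) : gR rho).
Proof.
rewrite -gcls0; apply/gltP; [exact: moderate_cst|exact: moderate_rho|].
by exists m; near=> e; rewrite subr0.
Unshelve. all: by end_near. Qed.

Lemma gball_cover : \bigcup_(p in gball_dom) gball p.1 p.2 = setT.
Proof.
apply/seteqP; split => // x _.
exists (x, gcls (fun e => rho e ^+ 0)); first exact: drhoX_gt0.
apply/gballP; exists 1%N; near=> e.
have : `|grepr (gcls (fun e => rho e ^+ 0) : gR rho) e - rho e ^+ 0| <= rho e ^+ 1.
  by near: e; exact: drhoX_repr.
have rlt : rho e < 2^-1 by near: e; apply: near_gauge_lt.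
rewrite subrr /enorm big1; last by move=> i _; rewrite mxE expr0n.
by rewrite sqrtr0 subr0 expr0 expr1 ler_norml => /andP[? ?]; lra.
Unshelve. all: by end_near. Qed.

Lemma gball_join p q x : gball_dom p -> gball_dom q ->
  gball p.1 p.2 x -> gball q.1 q.2 x ->
  exists k, [/\ gball_dom k, gball k.1 k.2 x &
    gball k.1 k.2 `<=` gball p.1 p.2 `&` gball q.1 q.2].
Proof.
have shrink (c y : gRn) (r : gR rho) (m M : nat) : (m <= M)%N ->
    (\forall e \near 0^'+,
      rho e ^+ m <= grepr r e - enorm (grepr_vec x e - grepr_vec c e)) ->
    gball x (gcls (fun e => rho e ^+ M.+2)) y -> gball c r y.
  move=> mM hm /gballP[a ha]; apply/gballP; exists m.+1; near=> e.
  have /andP[r0 r1] : 0 < rho e <= 1 by near: e; exact: near_gauge.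
  have rlt : rho e < 2^-1 by near: e; apply: near_gauge_lt.
  have : rho e ^+ m <= grepr r e - enorm (grepr_vec x e - grepr_vec c e).
    by near: e.
  have : rho e ^+ a <= grepr (gcls (fun e => rho e ^+ M.+2) : gR rho) e -
      enorm (grepr_vec y e - grepr_vec x e) by near: e.
  have : `|grepr (gcls (fun e => rho e ^+ M.+2) : gR rho) e - rho e ^+ M.+2|
      <= rho e ^+ M.+2 by near: e; exact: drhoX_repr.
  rewrite ler_norml => /andP[_ h1] h2 h3.
  have := enorm_triangle (grepr_vec y e - grepr_vec x e)
    (grepr_vec x e - grepr_vec c e).
  rewrite addrA subrK => h4.
  have a0 : 0 < rho e ^+ a by rewrite exprn_gt0.
  have m0 : 0 < rho e ^+ m by rewrite exprn_gt0.
  have h5 : rho e ^+ M.+2 <= rho e ^+ m * rho e ^+ 2.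
    rewrite -exprD; apply: ler_wiXn2l => //; first exact: ltW.
    by rewrite addn2 !ltnS.
  rewrite exprS; rewrite expr2 in h5.
  have h6 : rho e * rho e ^+ m <= 2^-1 * rho e ^+ m by rewrite ler_pM2r // ltW.
  have h7 : rho e ^+ m * (rho e * rho e) <= 4^-1 * rho e ^+ m by nra.
  by lra.
move=> p0 q0 /gballP[m hm] /gballP[m' hm'].
exists (x, gcls (fun e => rho e ^+ (m + m').+2)); split => /=.
- exact: drhoX_gt0.
- apply/gballP; exists (m + m').+3; near=> e.
  have /andP[r0 r1] : 0 < rho e <= 1 by near: e; exact: near_gauge.
  have rlt : rho e < 2^-1 by near: e; apply: near_gauge_lt.
  have : `|grepr (gcls (fun e => rho e ^+ (m + m').+2) : gR rho) e -
      rho e ^+ (m + m').+2| <= rho e ^+ (m + m').+3.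
    by near: e; exact: drhoX_repr.
  rewrite subrr /enorm big1; last by move=> i _; rewrite mxE expr0n.
  rewrite sqrtr0 subr0 ler_norml [in _ ^+ (m + m').+3]exprS => /andP[h _].
  have : 0 < rho e ^+ (m + m').+2 by rewrite exprn_gt0.
  have : rho e ^+ (m + m').+3 = rho e * rho e ^+ (m + m').+2 by rewrite exprS.
  by nra.
- move=> y hy; split.
  + by apply: shrink hm hy; exact: leq_addr.
  + by apply: shrink hm' hy; exact: leq_addl.
Unshelve. all: by end_near. Qed.

HB.instance Definition _ := isBaseTopological.Build gRn gball_cover gball_join.

End SharpTopology.

Section SmoothMaps.
Context {R : realType} {n : nat}.
Implicit Types (g : 'rV[R]_n -> R) (f : 'rV[R]_n -> R[i]).

Definition partial (i : 'I_n) g : 'rV[R]_n -> R := 'D_(delta_mx 0 i) g.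

Definition mpartial (alpha : 'I_n -> nat) g : 'rV[R]_n -> R :=
  foldr (fun i => iter (alpha i) (partial i)) g (enum 'I_n).

Definition smooth g := forall s : seq 'I_n,
  let h := foldr partial g s in
  continuous h /\ forall i x, derivable h x (delta_mx 0 i).

Definition csmooth f :=
  smooth (fun x => complex.Re (f x)) /\ smooth (fun x => complex.Im (f x)).

Definition cmpartial (alpha : 'I_n -> nat) f : 'rV[R]_n -> R[i] := fun x =>
  (mpartial alpha (fun t => complex.Re (f t)) x +i*
   mpartial alpha (fun t => complex.Im (f t)) x)%C.

End SmoothMaps.

Section IteratedIntegral.
Context {R : realType}.

Definition oint (a b : R) (g : R -> R) : R :=
  if a <= b then \int[lebesgue_measure]_(t in `[a, b]) g t
  else - \int[lebesgue_measure]_(t in `[b, a]) g t.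

(* \int_{a_1}^{b_1} dx_1 ... \int_{a_n}^{b_n} g dx_n *)
Fixpoint boxint (n : nat) :
    'rV[R]_n -> 'rV[R]_n -> ('rV[R]_n -> R) -> R :=
  match n with
  | 0 => fun _ _ g => g 0
  | m.+1 => fun (a b : 'rV[R]_(1 + m)) g =>
      oint (a 0 0) (b 0 0) (fun t =>
        boxint (rsubmx a) (rsubmx b)
          (fun x : 'rV[R]_m => g (row_mx (const_mx t : 'rV[R]_1) x)))
  end.

Definition cboxint (n : nat) (a b : 'rV[R]_n) (f : 'rV[R]_n -> R[i]) : R[i] :=
  (boxint a b (fun x => complex.Re (f x)) +i*
   boxint a b (fun x => complex.Im (f x)))%C.

End IteratedIntegral.

Section GSF.
Context {R : realType} {rho : gauge R} {n : nat}.
Local Notation gR := (gR rho).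
Local Notation gC := (gC rho).
Local Notation gRn := (gRn rho n).

(* The net fe of smooth functions defines f on X. Functions on a subset X are
   total functions whose values outside X are irrelevant. *)
Definition gsf_net (X : set gRn) (f : gRn -> gC)
    (fe : R -> 'rV[R]_n -> R[i]) :=
  (forall e : R, 0 < e <= 1 -> csmooth (fe e)) /\
  forall (x : gRn) (u : R -> 'rV[R]_n), X x -> represents_vec x u ->
    f x = gccls (fun e => fe e (u e)) /\
    forall alpha : 'I_n -> nat,
      cmoderate rho (fun e => cmpartial alpha (fe e) (u e)).

Definition gsf (X : set gRn) (f : gRn -> gC) := exists fe, gsf_net X f fe.

Definition gbox (a b : gRn) : set gRn :=
  [set x | forall i, gle (a 0 i) (x 0 i) /\ gle (x 0 i) (b 0 i)].

(* The integral over a box of a GSF f, computed on one choice of representing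
   nets for f, a and b; on a GSF it does not depend on this choice, and it is
   the junk value 0 if f is not a GSF on the box. *)
Definition gint (a b : gRn) (f : gRn -> gC) : gC :=
  let fe := xget (fun _ _ => 0) [set fe | gsf_net (gbox a b) f fe] in
  gccls (fun e => cboxint (grepr_vec a e) (grepr_vec b e) (fe e)).

Definition gcube (k : gR) : set gRn :=
  gbox (const_mx (- k)) (const_mx k).

Definition gdot (x y : gRn) : gR := \sum_i x 0 i * y 0 i.

Definition fourier (k : gR) (f : gRn -> gC) (w : gRn) : gC :=
  gint (const_mx (- k)) (const_mx k) (fun x => f x * gexpi (- gdot x w)).

Definition fourier_inv (k : gR) (f : gRn -> gC) (x : gRn) : gC :=
  gC_of_gR (gcst ((2 * pi) ^- n)) *
  gint (const_mx (- k)) (const_mx k) (fun w => f w * gexpi (gdot x w)).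

End GSF.

(* Sharp limit as h -> +oo, with h restricted to D. *)
Definition sharp_lim_pinfty {R : realType} {rho : gauge R}
    (D : set (gR rho)) (a : gR rho -> gC rho) (l : gC rho) :=
  forall q : nat, exists hbar : gR rho, forall h : gR rho,
    D h -> gle hbar h -> gle (gcabs (a h - l)) (drho ^+ q).

Definition positive_infinite {R : realType} {rho : gauge R} : set (gR rho) :=
  [set h | glt 0 h /\ ginfinite h].

(* Main.v *)
(** For fixed [e], Fubini turns the inverse transform over [-h, h]^n of the transform
over [-k, k]^n into the integral of [f] against the product of the Dirichlet kernels
[sin (h t_i) / (pi t_i)], [t = x - y]. In one variable, integrating by parts against
the primitive of the kernel, which is within [1 / (h t)] of [1 / 2], bounds the
difference with [f y] by a constant times [tau + 1 / (h tau) + 1 / (h d)] for every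
[tau <= d], where [d] is the distance of [y] to the boundary and the constant depends
on [k] and on the size and Lipschitz constant of [f]; [n] variables are handled one
at a time. All these data are moderate, because the maximum over the cube of a
derivative of [f_e] is attained at a net of points that represents a point of [K].
Hence a power [h >= drho ^- P], with [P] depending only on [k], [f], [y] and [q],
makes the error at most [drho ^+ q]. The same maximum argument shows that the
integral of a generalized smooth function does not depend on the net chosen for it. *)

Require Import Defs.
From HB Require Import structures.
From mathcomp Require Import all_boot all_order all_algebra.
From mathcomp Require Import complex.
From mathcomp Require Import all_classical all_reals all_analysis.
From mathcomp Require Import ring lra.

Set Implicit Arguments.
Unset Strict Implicit.
Unset Printing Implicit Defensive.

Import Order.TTheory GRing.Theory Num.Theory.
Import numFieldNormedType.Exports.
Import ComplexField ComplexField.Normc.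

Local Open Scope classical_set_scope.
Local Open Scope ring_scope.

(** The hypothesis on [f] speaks only of nets that represent points of [K]: it gives no bound
    uniform over a cube for the functions of the net, and says nothing of their size off [K]. Hence
    every cube of integration has endpoints representing [- k] and [k], and minima and maxima of
    representatives produce a cube of the same kind around several given ones. A second obstacle is
    that [gint] integrates a net chosen abstractly. The inner transform must first be shown to be a
    generalized smooth function with an explicit net; only then can the outer integral be computed
    on that net, for one [e] at a time, where the classical inversion formula lives. At that level
    both compositions are treated at once through a sign [sg], and real and imaginary parts through
    a phase [c]: cosine and sine are [cos (t + c)] with [c = 0] and [c = - pi / 2], a partial
    derivative adds [pi / 2] to the phase, and the sine part of the double integral disappears
    because its phase makes a factor [cos c] vanish. *)

Section ContinuousArithmetic.
Context {R : realType} {T : topologicalType}.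
Implicit Types f g : T -> R.

Lemma contD f g : continuous f -> continuous g -> continuous (fun t => f t + g t).
Proof. by move=> cf cg x; exact: (continuousD (cf x) (cg x)). Qed.

Lemma contB f g : continuous f -> continuous g -> continuous (fun t => f t - g t).
Proof. by move=> cf cg x; exact: (continuousB (cf x) (cg x)). Qed.

Lemma contM f g : continuous f -> continuous g -> continuous (fun t => f t * g t).
Proof. by move=> cf cg x; exact: (continuousM (cf x) (cg x)). Qed.

Lemma contN f : continuous f -> continuous (fun t => - f t).
Proof. by move=> cf x; exact: (continuousN (cf x)). Qed.

Lemma contV f : (forall t, f t != 0) -> continuous f -> continuous (fun t => (f t)^-1).
Proof. by move=> f0 cf x; exact: (cvgV (f0 x) (cf x)). Qed.

Lemma cont_cst (c : R) : continuous (fun _ : T => c).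
Proof. exact: cst_continuous. Qed.

Lemma contZ (c : R) f : continuous f -> continuous (fun t => c * f t).
Proof. by move=> cf; apply: contM => //; exact: cont_cst. Qed.

Lemma cont_sum (I : Type) (r : seq I) (P : pred I) (F : I -> T -> R) :
  (forall i, continuous (F i)) -> continuous (fun t => \sum_(i <- r | P i) F i t).
Proof.
move=> cF; have -> : (fun t => \sum_(i <- r | P i) F i t) = \sum_(i <- r | P i) F i.
  by apply/funext => t; rewrite fct_sumE.
by apply: (big_ind (fun h : T -> R => continuous h)) => //; [exact: cont_cst|exact: contD].
Qed.

Lemma cont_prod (I : Type) (r : seq I) (P : pred I) (F : I -> T -> R) :
  (forall i, continuous (F i)) -> continuous (fun t => \prod_(i <- r | P i) F i t).
Proof.
move=> cF; have -> : (fun t => \prod_(i <- r | P i) F i t) = \prod_(i <- r | P i) F i.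
  by apply/funext => t; rewrite fct_prodE.
by apply: (big_ind (fun h : T -> R => continuous h)) => //; [exact: cont_cst|exact: contM].
Qed.

End ContinuousArithmetic.

(** * Continuity of compositions, pairs and slices *)

Section ContinuousMaps.
Context {R : realType}.
Implicit Types T U V : topologicalType.

Lemma cont_comp T U V (f : T -> U) (g : U -> V) :
  continuous f -> continuous g -> continuous (fun t => g (f t)).
Proof. by move=> cf cg t; apply: continuous_comp; [exact: cf|exact: cg]. Qed.

Lemma cont_pair T U V (f : T -> U) (g : T -> V) :
  continuous f -> continuous g -> continuous (fun t => (f t, g t)).
Proof. by move=> cf cg t; apply: cvg_pair; [exact: cf|exact: cg]. Qed.

Lemma cont_id T : continuous (fun t : T => t).
Proof. by move=> t; exact: cvg_id. Qed.

Lemma cont_fst T U : continuous (fun p : T * U => p.1).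
Proof. by move=> p; exact: cvg_fst. Qed.

Lemma cont_snd T U : continuous (fun p : T * U => p.2).
Proof. by move=> p; exact: cvg_snd. Qed.

Lemma cont_slice T U (Phi : T -> U -> R) t :
  continuous (fun p : T * U => Phi p.1 p.2) -> continuous (Phi t).
Proof.
move=> cPhi; apply: (@cont_comp _ _ _ (fun u => (t, u)) _ _ cPhi).
by apply: cont_pair; [exact: cst_continuous|exact: cont_id].
Qed.

Lemma cont_flip T U (Phi : T -> U -> R) :
  continuous (fun p : T * U => Phi p.1 p.2) ->
  continuous (fun p : U * T => Phi p.2 p.1).
Proof.
move=> cPhi; apply: (@cont_comp _ _ _ (fun p : U * T => (p.2, p.1)) _ _ cPhi).
by move=> p; apply: cvg_pair; [exact: cvg_snd|exact: cvg_fst].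
Qed.

End ContinuousMaps.

(** * Integrals of continuous functions on the line *)

Section OrientedIntegral.
Context {R : realType}.
Implicit Types (a b c x : R) (f g F : R -> R).
Local Notation mu := (@lebesgue_measure R).

Lemma continuous_integrable f a b : continuous f ->
  mu.-integrable `[a, b] (EFin \o f).
Proof.
move=> cf; apply: continuous_compact_integrable; first exact: segment_compact.
exact: continuous_subspaceT.
Qed.

Lemma is_derive_continuous F f : (forall x, is_derive x 1 F (f x)) ->
  continuous F.
Proof.
move=> dF x; have := dF x => -[dFx _].
by apply: differentiable_continuous; apply/derivable1_diffP.
Qed.

(** Together with [primitive_ex], this turns the identities on oriented integrals of continuous
    functions into algebra on differences of primitives, whatever the order of the endpoints. *)
Lemma oint_FTC F f a b : continuous f ->
  (forall x, is_derive x 1 F (f x)) -> oint a b f = F b - F a.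
Proof.
move=> cf dF; have cF := is_derive_continuous dF.
have lt_case u v : u < v -> \int[mu]_(t in `[u, v]) f t = F v - F u.
  move=> uv; rewrite /Rintegral (@continuous_FTC2 _ f F) //.
  - exact: continuous_subspaceT.
  - split => [x _|//|//]; first by have [] := dF x.
    + by apply: cvg_at_right_filter; exact: cF.
    + by apply: cvg_at_left_filter; exact: cF.
  - by move=> x _; rewrite derive1E; have [_ ->] := dF x.
rewrite /oint; case: (ltgtP a b) => [ab|ba|->].
- exact: lt_case.
- by rewrite lt_case // opprB.
- by rewrite set_itv1 Rintegral_set1 subrr.
Qed.

Lemma primitive_ex f : continuous f ->
  exists F, forall x, is_derive x 1 F (f x).
Proof.
move=> cf; exists (fun x => oint 0 x f) => x.
(* [c] lies to the left of both [0] and [x]: near [x] the oriented integral from [0] is then the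
   difference of two integrals from [c], of which only the first varies. *)
pose c := Num.min 0 x - 1.
have c0 : c < 0 by rewrite /c ltrBlDr add0r gt_min ltr01.
have cx : c < x by rewrite /c ltrBlDr gt_min ltrDl ltr01 orbT.
have cut u v : c <= u -> u <= v -> \int[mu]_(t in `[u, v]) f t =
    \int[mu]_(t in `[c, v]) f t - \int[mu]_(t in `[c, u]) f t.
  move=> cu uv; rewrite Rintegral_itvB ?bnd_simp //; last exact: continuous_integrable.
  rewrite Rintegral_itv_obnd_cbnd //.
  apply: integrableS (continuous_integrable u v cf) => //.
  by apply: subset_itvr; rewrite bnd_simp.
pose G z := \int[mu]_(t in `[c, z]) f t - \int[mu]_(t in `[c, 0]) f t.
apply: (@near_eq_is_derive _ _ _ G).
  near=> z; have cz : c < z by near: z; exact: lt_nbhsr.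
  rewrite /G /oint; case: (leP 0 z) => [z0|/ltW z0].
    by rewrite (cut 0 z) // ltW.
  by rewrite (cut z 0) ?opprB // ltW.
have xx1 : x < x + 1 by rewrite ltrDl.
have [d1 d2] := continuous_FTC1_closed xx1 (continuous_integrable c (x + 1) cf)
  cx (cf x).
have dI : is_derive x 1 (fun z => \int[mu]_(t in `[c, z]) f t) (f x).
  by rewrite derive1E in d2; exact: DeriveDef d1 d2.
by have := is_deriveB dI (is_derive_cst (\int[mu]_(t in `[c, 0]) f t) x 1);
  rewrite subr0.
Unshelve. all: by end_near. Qed.

Lemma oint_primitive f a : continuous f ->
  forall x, is_derive x 1 (oint a ^~ f) (f x).
Proof.
move=> cf; have [F dF] := primitive_ex cf => x.
have -> : oint a ^~ f = fun z => F z - F a.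
  by apply/funext => z; exact: oint_FTC.
by apply: is_derive_eq; rewrite subr0.
Qed.

Lemma ointxx f a : oint a a f = 0.
Proof. by rewrite /oint lexx set_itv1 Rintegral_set1. Qed.

Lemma ointD f g a b : continuous f -> continuous g ->
  oint a b (fun t => f t + g t) = oint a b f + oint a b g.
Proof.
move=> cf cg; have [F dF] := primitive_ex cf; have [G dG] := primitive_ex cg.
rewrite (oint_FTC a b cf dF) (oint_FTC a b cg dG).
rewrite (@oint_FTC (fun x => F x + G x)); first by ring.
exact: contD.
Qed.

Lemma ointZ f a b c : continuous f ->
  oint a b (fun t => c * f t) = c * oint a b f.
Proof.
move=> cf; have [F dF] := primitive_ex cf.
rewrite (oint_FTC a b cf dF) (@oint_FTC (fun x => c * F x)); first by ring.
exact: contZ.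
Qed.

Lemma ointB f g a b : continuous f -> continuous g ->
  oint a b (fun t => f t - g t) = oint a b f - oint a b g.
Proof.
move=> cf cg; have [F dF] := primitive_ex cf; have [G dG] := primitive_ex cg.
rewrite (oint_FTC a b cf dF) (oint_FTC a b cg dG).
rewrite (@oint_FTC (fun x => F x - G x)); first by ring.
exact: contB.
Qed.

Lemma oint_cat f a b c : continuous f -> oint a b f + oint b c f = oint a c f.
Proof.
move=> cf; have [F dF] := primitive_ex cf.
by rewrite !(oint_FTC _ _ cf dF); ring.
Qed.

Lemma oint_swap f a b : oint b a f = - oint a b f.
Proof.
rewrite /oint; case: (ltgtP a b) => [//|//|->]; first by rewrite opprK.
by rewrite set_itv1 Rintegral_set1 oppr0.
Qed.

Lemma oint_cst a b c : oint a b (fun=> c) = c * (b - a).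
Proof.
have dF x : is_derive x 1 (fun z : R => c * z) c.
  by have := is_deriveZ c (is_derive_id x 1); rewrite /GRing.scale /= mulr1.
by rewrite (oint_FTC _ _ _ dF) ?mulrBr //; exact: cst_continuous.
Qed.

Lemma eq_oint f g a b : a <= b -> (forall t, a <= t <= b -> f t = g t) ->
  oint a b f = oint a b g.
Proof.
move=> ab fg; rewrite /oint ab; apply: eq_Rintegral => t.
by rewrite inE /= in_itv /=; exact: fg.
Qed.

Lemma le_oint f g a b : a <= b -> continuous f -> continuous g ->
  (forall t, a <= t <= b -> f t <= g t) -> oint a b f <= oint a b g.
Proof.
move=> ab cf cg fg; rewrite /oint ab; apply: le_Rintegral => //.
- exact: continuous_integrable.
- exact: continuous_integrable.
Qed.

Lemma oint_norm_le f g a b : a <= b -> continuous f -> continuous g ->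
  (forall t, a <= t <= b -> `|f t| <= g t) -> `|oint a b f| <= oint a b g.
Proof.
move=> ab cf cg fg; rewrite ler_norml; apply/andP; split; last first.
  by apply: le_oint => // t /fg; apply: le_trans; exact: ler_norm.
have -> : - oint a b g = oint a b (fun t => - 1 * g t).
  by rewrite ointZ // mulN1r.
apply: le_oint => //.
  exact: contZ.
by move=> t /fg; rewrite ler_norml mulN1r => /andP[].
Qed.

Lemma oint_bound f a b M : a <= b -> continuous f ->
  (forall t, a <= t <= b -> `|f t| <= M) -> `|oint a b f| <= M * (b - a).
Proof.
move=> ab cf fM; rewrite -(oint_cst a b M); apply: oint_norm_le => //.
exact: cst_continuous.
Qed.

Lemma oint_bound_abs f a b lo hi M : continuous f ->
  lo <= a <= hi -> lo <= b <= hi ->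
  (forall t, lo <= t <= hi -> `|f t| <= M) -> `|oint a b f| <= M * `|b - a|.
Proof.
move=> cf /andP[la ah] /andP[lb bh] fM; have [ab|ba] := leP a b.
  rewrite [`|b - a|]ger0_norm ?subr_ge0 //; apply: oint_bound => // t /andP[t1 t2].
  by apply: fM; rewrite (le_trans la t1) (le_trans t2 bh).
rewrite oint_swap normrN distrC [`|a - b|]ger0_norm ?subr_ge0 ?(ltW ba) //.
apply: oint_bound => //; first exact: ltW.
move=> t /andP[t1 t2].
by apply: fM; rewrite (le_trans lb t1) (le_trans t2 ah).
Qed.

Lemma oint_parts (f g df dg : R -> R) a b : continuous df -> continuous dg ->
  (forall x, is_derive x 1 f (df x)) -> (forall x, is_derive x 1 g (dg x)) ->
  oint a b (fun t => f t * dg t) =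
  f b * g b - f a * g a - oint a b (fun t => df t * g t).
Proof.
move=> cdf cdg hf hg.
have cf := is_derive_continuous hf; have cg := is_derive_continuous hg.
have c1 : continuous (fun t => f t * dg t).
  exact: contM.
have c2 : continuous (fun t => df t * g t).
  exact: contM.
apply/eqP; rewrite eq_sym subr_eq -ointD //; apply/eqP.
have dfg x : is_derive x 1 (fun x => f x * g x) (f x * dg x + df x * g x).
  by have := is_deriveM (hf x) (hg x); rewrite /GRing.scale /= (mulrC (g x)).
by rewrite (oint_FTC _ _ _ dfg) //; exact: contD.
Qed.

End OrientedIntegral.

(** * Integrals depending on a parameter *)

Section ParametricIntegral.
Context {R : realType}.

(** The tube lemma: by compactness of [K] one neighbourhood of [t0] serves all [u]. Near each [u],
    both values are compared with [Phi t0 u], hence the halves of [e]. *)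
Lemma unif_near (T U : topologicalType) (Phi : T -> U -> R) (K : set U) (t0 : T) :
  compact K -> continuous (fun p : T * U => Phi p.1 p.2) ->
  forall e, 0 < e -> \forall t \near t0, forall u, K u -> `|Phi t u - Phi t0 u| <= e.
Proof.
move=> cK cPhi e e0.
have := (compact_near_coveringP K).1 cK T (nbhs t0)
  (fun t u => `|Phi t u - Phi t0 u| <= e) _.
apply => u Ku.
have e2 : 0 < e / 2 by rewrite divr_gt0.
have /cvgrPdist_lt/(_ _ e2) [[A B] /= [nA nB] AB] := cPhi (t0, u).
exists (B, A) => //= -[u' t'] /= [Bu At].
have h1 := AB (t', u') (conj At Bu).
have h2 := AB (t0, u') (conj (nbhs_singleton nA) Bu).
rewrite /= in h1 h2; rewrite ler_norml.
by move: h1 h2; rewrite !ltr_norml => /andP[? ?] /andP[? ?]; apply/andP; split; lra.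
Qed.

Lemma cont_oint (T : topologicalType) (Phi : T -> R -> R) a b :
  continuous (fun p : T * R => Phi p.1 p.2) ->
  continuous (fun t => oint a b (Phi t)).
Proof.
move=> cPhi; wlog ab : a b / a <= b.
  move=> H; have [/H//|/ltW ba] := leP a b.
  have -> : (fun t => oint a b (Phi t)) = (fun t => - oint b a (Phi t)).
    by apply/funext => t; rewrite oint_swap.
  by apply: contN; exact: H.
have cP t : continuous (Phi t).
  exact: cont_slice.
move=> t0; apply/cvgrPdist_le => e e0.
(* The added [1] keeps the divisor positive when [a = b]. *)
have e1 : 0 < e / (b - a + 1) by rewrite divr_gt0 // ltr_wpDl // subr_ge0.
have := unif_near t0 (@segment_compact _ a b) cPhi e1.
apply: filterS => t ht; rewrite -ointB //.
apply: le_trans (oint_bound ab _ (M := e / (b - a + 1)) _) _.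
- exact: contB.
- by move=> s sab; rewrite distrC; apply: ht; rewrite /= in_itv.
- have ? : b - a + 1 != 0 by rewrite gt_eqF // ltr_wpDl // subr_ge0.
  by rewrite mulrAC ler_pdivrMr ?ltr_wpDl ?subr_ge0 // ler_pM2l // lerDl.
Qed.

Lemma is_derive_quotient (f : R -> R) (x d : R) :
  (forall e, 0 < e -> \forall h \near 0^', `|h^-1 * (f (h + x) - f x) - d| <= e) ->
  is_derive x 1 f d.
Proof.
move=> H.
have c : (fun h => h^-1 *: ((f \o shift x) (h *: 1) - f x)) @ 0^' --> d.
  apply/cvgrPdist_le => e /H; apply: filterS => h.
  by rewrite /GRing.scale /= mulr1 distrC.
by apply: DeriveDef; [apply/cvg_ex; exists d|exact: cvg_lim].
Qed.

(* [L] stands for an integral over the compact set [K]. *)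
Lemma derive_functional (U : topologicalType) (K : set U) (L : (U -> R) -> R) (C : R)
    (Phi dPhi : R -> U -> R) :
  compact K -> 0 <= C ->
  (forall f g : U -> R, continuous f -> continuous g -> L (fun u => f u - g u) = L f - L g) ->
  (forall (c : R) (f : U -> R), continuous f -> L (fun u => c * f u) = c * L f) ->
  (forall (f : U -> R) M, continuous f -> (forall u, K u -> `|f u| <= M) -> `|L f| <= C * M) ->
  (forall t, continuous (Phi t)) ->
  continuous (fun p : R * U => dPhi p.1 p.2) ->
  (forall (t : R) u, is_derive t 1 (Phi ^~ u) (dPhi t u)) ->
  forall t : R, is_derive t 1 (fun t => L (Phi t)) (L (dPhi t)).
Proof.
move=> cK C0 LB LZ LM cPhi cd hd t0; apply: is_derive_quotient => e e0.
have e1 : 0 < e / (C + 1) by rewrite divr_gt0 // ltr_wpDl.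
have [r /= r0 hr] := unif_near t0 cK cd e1.
have cdt t : continuous (dPhi t) by exact: cont_slice.
near=> h.
have h0 : h != 0 by near: h; exact: nbhs_dnbhs_neq.
have hr' : `|h| < r by near: h; apply: dnbhs0_lt.
rewrite -LB // -LZ; last exact: contB.
rewrite -LB //; last by apply: contZ; exact: contB.
apply: le_trans (LM _ (e / (C + 1)) _ _) _.
- by apply: contB => //; apply: contZ; exact: contB.
- move=> u Ku.
  have cPu : continuous (Phi ^~ u) by exact: is_derive_continuous (hd ^~ u).
  (* The mean value theorem replaces the increment of [Phi] by [dPhi xi u * h] with [xi] within [r]
     of [t0], where [dPhi] is close to its value at [t0] uniformly in [u]. *)
  have [xi xi1 ->] : exists2 xi, `|t0 - xi| < r &
      Phi (h + t0) u - Phi t0 u = dPhi xi u * h.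
    have [h1|h1] := ltP 0 h.
      have th : t0 < h + t0 by rewrite ltrDr.
      have [xi + ->] := MVT th (fun x _ => hd x u) (continuous_subspaceT cPu).
      rewrite in_itv /= => /andP[? ?]; exists xi; last by congr (_ * _); ring.
      by move: hr'; rewrite !ltr_norml => /andP[? ?]; apply/andP; split; lra.
    have h2 : h < 0 by rewrite lt_neqAle h0.
    have th : h + t0 < t0 by rewrite gtrDr.
    have [xi + hxi] := MVT th (fun x _ => hd x u) (continuous_subspaceT cPu).
    rewrite in_itv /= => /andP[? ?]; exists xi.
      by move: hr'; rewrite !ltr_norml => /andP[? ?]; apply/andP; split; lra.
    by rewrite -opprB hxi; ring.
  rewrite mulrCA mulVf // mulr1; exact: (hr xi).
- by rewrite mulrCA ler_piMr ?(ltW e0) // ler_pdivrMr ?mul1r ?lerDl // ltr_wpDl.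
Unshelve. all: by end_near. Qed.

(** With [b] replaced by a variable [x], the right-hand side has derivative [oint c d (Phi x)] by
    differentiation under the integral and vanishes at [x = a]; the fundamental theorem then gives
    the left-hand side. *)
Lemma oint_Fubini (Phi : R -> R -> R) a b c d :
  continuous (fun p : R * R => Phi p.1 p.2) ->
  oint a b (fun t => oint c d (Phi t)) = oint c d (fun s => oint a b (Phi ^~ s)).
Proof.
move=> cPhi; wlog cd : c d / c <= d.
  move=> H; have [/H//|/ltW dc] := leP c d.
  rewrite (oint_swap _ d c) -H // -mulN1r -ointZ; last exact: cont_oint.
  by congr (oint a b _); apply/funext => t; rewrite mulN1r -oint_swap.
have cPhis : continuous (fun p : R * R => Phi p.2 p.1).
  exact: cont_flip.
have cs s : continuous (Phi ^~ s).
  exact: (@cont_slice _ _ _ (fun s t => Phi t s)).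
pose F x := oint c d (fun s => oint a x (Phi ^~ s)).
have dF : forall x : R, is_derive x 1 F (oint c d (Phi x)).
  apply: (@derive_functional _ `[c, d] (oint c d) (d - c)
     (fun x s => oint a x (Phi ^~ s)) Phi) => //.
  - exact: segment_compact.
  - by rewrite subr_ge0.
  - by move=> *; exact: ointB.
  - by move=> *; exact: ointZ.
  - move=> f M cf fM; by rewrite mulrC; apply: oint_bound.
  - by move=> t; apply: (@cont_oint _ (fun s t => Phi t s)).
  - by move=> x s; exact: oint_primitive.
rewrite (oint_FTC _ _ _ dF); last exact: cont_oint.
rewrite /F [X in _ - X](_ : _ = 0) ?subr0 //.
under eq_fun do rewrite ointxx.
by rewrite oint_cst mul0r.
Qed.

End ParametricIntegral.

(** * Iterated integrals over cubes *)

Section Cubes.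
Context {R : realType}.

Lemma cont_app2 (Z T U : topologicalType) (Phi : T -> U -> R) (f : Z -> T) (g : Z -> U) :
  continuous (fun p : T * U => Phi p.1 p.2) -> continuous f -> continuous g ->
  continuous (fun z => Phi (f z) (g z)).
Proof.
move=> cP cf cg.
apply: (@cont_comp _ _ _ (fun z => (f z, g z)) (fun p => Phi p.1 p.2)) => //.
exact: cont_pair.
Qed.

Lemma cont_mx (T : topologicalType) m n (f : T -> 'M[R]_(m, n)) :
  (forall i j, continuous (fun t => f t i j)) -> continuous f.
Proof.
move=> cf t; apply/cvg_ballP => e e0.
have : \forall s \near t, forall i j, ball (f t i j) e (f s i j).
  apply: filter_forall => i; apply: filter_forall => j.
  by have /cvg_ballP/(_ _ e0) := cf i j t.
by apply: filterS => s h; split.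
Qed.

Lemma cont_coord n (i : 'I_n) : continuous (fun x : 'rV[R]_n => x 0 i).
Proof. exact: coord_continuous. Qed.

(** The row that [boxint] builds at each level, typed with length [n.+1] in place of [1 + n] so that
    [ord0] and [lift ord0] index it. *)
Definition vcons n (t : R) (x : 'rV[R]_n) : 'rV[R]_n.+1 :=
  row_mx (const_mx t : 'rV_1) x.

Definition vtail n (x : 'rV[R]_n.+1) : 'rV[R]_n := \row_i x 0 (lift ord0 i).

Lemma vcons0 n t (x : 'rV[R]_n) : vcons t x 0 ord0 = t.
Proof.
have := row_mxEl (const_mx t : 'rV_1) x 0 ord0; rewrite [RHS]mxE; apply: etrans.
by rewrite /vcons; congr (row_mx _ _ _ _); exact: val_inj.
Qed.

Lemma vconsS n t (x : 'rV[R]_n) i : vcons t x 0 (lift ord0 i) = x 0 i.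
Proof.
have := row_mxEr (const_mx t : 'rV_1) x 0 i; apply: etrans.
by rewrite /vcons; congr (row_mx _ _ _ _); exact: val_inj.
Qed.

Lemma vcons_tail n (x : 'rV[R]_n.+1) : vcons (x 0 ord0) (vtail x) = x.
Proof.
apply/rowP => i; have [j ->|->] := unliftP ord0 i; last by rewrite vcons0.
by rewrite vconsS mxE.
Qed.

Lemma cont_vcons (T : topologicalType) n (f : T -> R) (g : T -> 'rV[R]_n) :
  continuous f -> continuous g -> continuous (fun t => vcons (f t) (g t)).
Proof.
move=> cf cg; apply: cont_mx => i j; rewrite (ord1 i).
have [k ->|->] := unliftP ord0 j.
  under eq_fun do rewrite vconsS.
  exact: (@cont_comp _ _ _ g (fun x => x 0 k) cg (@cont_coord _ k)).
by under eq_fun do rewrite vcons0.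
Qed.

Definition cube n (a b : R) : set 'rV[R]_n := [set x | forall i, a <= x 0 i <= b].

Lemma compact_cube n (a b : R) : compact (@cube n a b).
Proof.
apply: (@rV_compact _ n (fun=> `[a, b]%classic)) => _.
exact: segment_compact.
Qed.

Lemma cube_vcons n (a b t : R) (x : 'rV[R]_n) : a <= t <= b -> cube a b x ->
  cube a b (vcons t x).
Proof.
move=> tab xab i; have [j ->|->] := unliftP ord0 i; first by rewrite vconsS.
by rewrite vcons0.
Qed.

Definition cint n (a b : R) (g : 'rV[R]_n -> R) : R :=
  boxint (const_mx a) (const_mx b) g.

Lemma cintS n (a b : R) (g : 'rV[R]_n.+1 -> R) :
  cint a b g = oint a b (fun t => cint a b (fun x => g (vcons t x))).
Proof. by rewrite /cint /= !mxE !rsubmx_const. Qed.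

Lemma cont_slices n (T : topologicalType) (Phi : T -> 'rV[R]_n.+1 -> R) :
  continuous (fun p : T * 'rV[R]_n.+1 => Phi p.1 p.2) ->
  continuous (fun p : (T * R) * 'rV[R]_n => Phi p.1.1 (vcons p.1.2 p.2)).
Proof.
move=> cP; apply: cont_app2 => //.
  exact: (cont_comp (@cont_fst _ _) (@cont_fst _ _)).
apply: cont_vcons; last exact: cont_snd.
exact: (cont_comp (@cont_fst _ _) (@cont_snd _ _)).
Qed.

(** The parameter space is arbitrary because the induction moves the first coordinate of the cube
    into it, passing from [T] to [T * R]. *)
Lemma cont_cint n (T : topologicalType) (Phi : T -> 'rV[R]_n -> R) (a b : R) :
  continuous (fun p : T * 'rV[R]_n => Phi p.1 p.2) ->
  continuous (fun t => cint a b (Phi t)).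
Proof.
elim: n T Phi => [|n IH] T Phi cP.
  by apply: cont_app2 => //; [exact: cont_id|exact: cst_continuous].
under eq_fun do rewrite cintS.
apply: (@cont_oint R T (fun t s => cint a b (fun x => Phi t (vcons s x)))).
apply: (IH (T * R)%type (fun p x => Phi p.1 (vcons p.2 x))).
exact: cont_slices.
Qed.

Lemma cont_cons2 n (g : 'rV[R]_n.+1 -> R) : continuous g ->
  continuous (fun p : R * 'rV[R]_n => g (vcons p.1 p.2)).
Proof.
move=> cg; apply: cont_comp cg; apply: cont_vcons.
  exact: cont_fst.
exact: cont_snd.
Qed.

Lemma cont_cons n (g : 'rV[R]_n.+1 -> R) t : continuous g ->
  continuous (fun x => g (vcons t x)).
Proof.
by move=> cg; apply: (@cont_slice _ _ _ (fun t x => g (vcons t x))); exact: cont_cons2.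
Qed.

Lemma cont_cint_cons n (g : 'rV[R]_n.+1 -> R) (a b : R) : continuous g ->
  continuous (fun t => cint a b (fun x => g (vcons t x))).
Proof. by move=> cg; apply: cont_cint; exact: cont_cons2. Qed.

Lemma cintB n (a b : R) (f g : 'rV[R]_n -> R) : continuous f -> continuous g ->
  cint a b (fun x => f x - g x) = cint a b f - cint a b g.
Proof.
elim: n f g => [//|n IH] f g cf cg; rewrite !cintS.
rewrite -ointB; do ?exact: cont_cint_cons.
by congr (oint a b _); apply/funext => t; apply: IH; exact: cont_cons.
Qed.

Lemma cintD n (a b : R) (f g : 'rV[R]_n -> R) : continuous f -> continuous g ->
  cint a b (fun x => f x + g x) = cint a b f + cint a b g.
Proof.
elim: n f g => [//|n IH] f g cf cg; rewrite !cintS.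
rewrite -ointD; do ?exact: cont_cint_cons.
by congr (oint a b _); apply/funext => t; apply: IH; exact: cont_cons.
Qed.

Lemma cintZ n (a b c : R) (f : 'rV[R]_n -> R) : continuous f ->
  cint a b (fun x => c * f x) = c * cint a b f.
Proof.
elim: n f => [//|n IH] f cf; rewrite !cintS.
rewrite -ointZ; do ?exact: cont_cint_cons.
by congr (oint a b _); apply/funext => t; apply: IH; exact: cont_cons.
Qed.

Lemma cintZr n (a b c : R) (f : 'rV[R]_n -> R) : continuous f ->
  cint a b (fun x => f x * c) = cint a b f * c.
Proof. by move=> cf; rewrite mulrC -cintZ //; under eq_fun do rewrite mulrC. Qed.

Lemma cint_bound n (a b M : R) (f : 'rV[R]_n -> R) : a <= b -> continuous f ->
  (forall x, cube a b x -> `|f x| <= M) -> `|cint a b f| <= (b - a) ^+ n * M.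
Proof.
move=> ab; elim: n f => [|n IH] f cf fM.
  by rewrite expr0 mul1r; apply: fM => -[].
rewrite cintS exprSr mulrAC; apply: oint_bound => //; first exact: cont_cint_cons.
move=> t tab; apply: IH; first exact: cont_cons.
by move=> x xab; apply: fM; exact: cube_vcons.
Qed.

Lemma oint_cint n (Phi : R -> 'rV[R]_n -> R) (a b c d : R) :
  continuous (fun p : R * 'rV[R]_n => Phi p.1 p.2) ->
  oint a b (fun t => cint c d (Phi t)) = cint c d (fun x => oint a b (Phi ^~ x)).
Proof.
elim: n Phi => [//|n IH] Phi cP; rewrite cintS.
under eq_fun do rewrite cintS.
have cS := cont_slices cP.
rewrite (@oint_Fubini R (fun t s => cint c d (fun x => Phi t (vcons s x)))).
  congr (oint c d _); apply/funext => s.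
  rewrite (IH (fun t x => Phi t (vcons s x))) //.
  apply: cont_app2 => //; first exact: cont_fst.
  apply: cont_vcons; first exact: cst_continuous.
  exact: cont_snd.
exact: (@cont_cint n (R * R)%type (fun p x => Phi p.1 (vcons p.2 x))).
Qed.

(** The coordinates of the first cube are moved past the second one at a time, by [oint_cint]. *)
Lemma cint_Fubini m n (Phi : 'rV[R]_m -> 'rV[R]_n -> R) (a b c d : R) :
  continuous (fun p : 'rV[R]_m * 'rV[R]_n => Phi p.1 p.2) ->
  cint a b (fun w => cint c d (Phi w)) = cint c d (fun x => cint a b (Phi ^~ x)).
Proof.
elim: m Phi => [//|m IH] Phi cP; rewrite cintS.
have cS t : continuous (fun p : 'rV[R]_m * 'rV[R]_n => Phi (vcons t p.1) p.2).
  apply: cont_app2 => //; last exact: cont_snd.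
  apply: cont_vcons; first exact: cst_continuous.
  exact: cont_fst.
under eq_fun do rewrite (IH _ (cS _)).
rewrite (@oint_cint n (fun t x => cint a b (fun w => Phi (vcons t w) x))) //.
  by congr (cint c d _); apply/funext => x; rewrite cintS.
apply: (@cont_cint m (R * 'rV[R]_n)%type (fun p w => Phi (vcons p.1 w) p.2)).
apply: cont_app2 => //.
  apply: cont_vcons; last exact: cont_snd.
  exact: (cont_comp (@cont_fst _ _) (@cont_fst _ _)).
exact: (cont_comp (@cont_fst _ _) (@cont_snd _ _)).
Qed.

Lemma derive_cint n (Phi dPhi : R -> 'rV[R]_n -> R) (a b : R) : a <= b ->
  (forall t, continuous (Phi t)) ->
  continuous (fun p : R * 'rV[R]_n => dPhi p.1 p.2) ->
  (forall (t : R) x, is_derive t 1 (Phi ^~ x) (dPhi t x)) ->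
  forall t : R, is_derive t 1 (fun t => cint a b (Phi t)) (cint a b (dPhi t)).
Proof.
move=> ab cP cdP dP.
apply: (@derive_functional _ _ (cube a b) (cint a b) ((b - a) ^+ n) Phi) => //.
- exact: compact_cube.
- by rewrite exprn_ge0 // subr_ge0.
- by move=> *; exact: cintB.
- by move=> *; exact: cintZ.
- by move=> *; exact: cint_bound.
Qed.

(** In each of the [n] coordinates, two slabs of width at most [d] account for the change of
    endpoints. The base [1 + (hi - lo)] is at least [1], so its powers increase with [n] and one
    power bounds the contributions of all levels. *)
Lemma cint_box_change n (a b a' b' lo hi d M : R) (f : 'rV[R]_n -> R) :
  lo <= a -> a <= b -> b <= hi -> lo <= a' -> a' <= b' -> b' <= hi ->
  `|a - a'| <= d -> `|b - b'| <= d -> 0 <= M -> continuous f ->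
  (forall x, cube lo hi x -> `|f x| <= M) ->
  `|cint a b f - cint a' b' f| <= n%:R * (2 * d) * (1 + (hi - lo)) ^+ n * M.
Proof.
move=> la ab bh la' ab' bh' ad bd M0.
have d0 : 0 <= d by apply: le_trans ad.
have lh : lo <= hi by rewrite (le_trans la) // (le_trans ab).
have L1 : 1 <= 1 + (hi - lo) by rewrite lerDl subr_ge0.
have L0 : 0 <= 1 + (hi - lo) by apply: le_trans L1.
elim: n f => [|n IH] f cf fM; first by rewrite subrr normr0 !mul0r.
have fs t : lo <= t <= hi -> forall x, cube lo hi x -> `|f (vcons t x)| <= M.
  by move=> tl x xl; apply: fM; exact: cube_vcons.
have c1 := @cont_cint_cons n f a b cf; have c2 := @cont_cint_cons n f a' b' cf.
rewrite !cintS; set F := fun t => cint a b _; set G := fun t => cint a' b' _.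
(* The two gaps between the endpoints, plus the change of the inner integrals over the common
   interval from [a'] to [b']. *)
have -> : oint a b F - oint a' b' G =
    oint a a' F - oint b b' F + oint a' b' (fun t => F t - G t).
  rewrite ointB //; have := oint_cat a a' b c1; have := oint_cat a' b b' c1.
  by rewrite -/F => k1 k2; lra.
have FM t : lo <= t <= hi -> `|F t| <= (1 + (hi - lo)) ^+ n * M.
  move=> tl; apply: le_trans (@cint_bound n a b M (fun x => f (vcons t x)) ab _ _) _.
    exact: cont_cons.
    move=> x xab; apply: fs => // i; have /andP[h1 h2] := xab i.
    by rewrite (le_trans la h1) (le_trans h2 bh).
  apply: ler_wpM2r => //; apply: lerXn2r; rewrite ?nnegrE ?subr_ge0 //.
  by apply: le_trans (lerB bh la) _; rewrite lerDr.
have e1 : `|oint a a' F| <= (1 + (hi - lo)) ^+ n * M * d.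
  apply: le_trans (oint_bound_abs (lo := lo) (hi := hi) c1 _ _ FM) _.
  - by rewrite la (le_trans ab bh).
  - by rewrite la' (le_trans ab' bh').
  - by rewrite distrC; apply: ler_wpM2l => //; rewrite mulr_ge0 // exprn_ge0.
have e2 : `|oint b b' F| <= (1 + (hi - lo)) ^+ n * M * d.
  apply: le_trans (oint_bound_abs (lo := lo) (hi := hi) c1 _ _ FM) _.
  - by rewrite bh (le_trans la ab).
  - by rewrite bh' (le_trans la' ab').
  - by rewrite distrC; apply: ler_wpM2l => //; rewrite mulr_ge0 // exprn_ge0.
have e3 : `|oint a' b' (fun t => F t - G t)| <=
    n%:R * (2 * d) * (1 + (hi - lo)) ^+ n * M * (1 + (hi - lo)).
  apply: le_trans (oint_bound (M := n%:R * (2 * d) * (1 + (hi - lo)) ^+ n * M) ab' _ _) _.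
  - exact: contB.
  - move=> t /andP[t1 t2]; apply: IH; first exact: cont_cons.
    by apply: fs; rewrite (le_trans la' t1) (le_trans t2 bh').
  - apply: ler_wpM2l; first by rewrite !mulr_ge0 // exprn_ge0.
    by apply: le_trans (lerB bh' la') _; rewrite lerDr.
apply: le_trans (ler_normD _ _) _; apply: le_trans (lerD (ler_normB _ _) e3) _.
apply: le_trans (lerD (lerD e1 e2) (lexx _)) _.
set L := 1 + (hi - lo) in L0 L1 *.
have Ln : L ^+ n <= L ^+ n.+1 by rewrite exprS ler_peMl // exprn_ge0.
have h : L ^+ n * (M * d) <= L ^+ n.+1 * (M * d) by rewrite ler_wpM2r // mulr_ge0.
rewrite -[n.+1%:R]/(1 + n)%:R natrD.
have -> : (1 + n%:R) * (2 * d) * L ^+ n.+1 * M =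
   2 * (L ^+ n.+1 * (M * d)) + n%:R * (2 * d) * L ^+ n * M * L by rewrite exprS; ring.
rewrite lerD2r; lra.
Qed.

End Cubes.

(** * The Dirichlet kernel *)

Section DirichletKernel.
Context {R : realType}.
Implicit Types (a b c h s t x : R).

Lemma is_derive_affine (F f : R -> R) a c :
  (forall x : R, is_derive x 1 F (f x)) ->
  forall x : R, is_derive x 1 (fun t => F (t * a + c)) (f (x * a + c) * a).
Proof.
move=> dF x.
have d : is_derive x 1 (fun t : R => t * a + c) a.
  have := is_deriveD (is_deriveM (is_derive_id x 1) (is_derive_cst a x 1))
    (is_derive_cst c x 1).
  by rewrite /GRing.scale /= !mulr0 mulr1 add0r addr0.
exact: (@is_derive1_comp _ F (fun t => t * a + c) x _ _ (dF _) d).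
Qed.

Lemma cont_affine (T : topologicalType) (f : R -> R) (g : T -> R) a c :
  continuous f -> continuous g -> continuous (fun z : T => f (g z * a + c)).
Proof.
move=> cf cg; apply: (@cont_comp _ _ _ (fun z => g z * a + c)) => //.
by apply: contD; [apply: contM => //|]; exact: cont_cst.
Qed.

(** The Dirichlet kernel without its factor [1 / pi]; [h] is its limit at [0]. *)
Definition Dk h t := if t == 0 then h else sin (h * t) / t.

(** The phase [c] carries the contribution of the other coordinates when a cube is integrated one
    variable at a time. *)
Lemma cos_oint h t c :
  oint (- h) h (fun w => cos (w * t + c)) = 2 * Dk h t * cos c.
Proof.
rewrite /Dk; case: eqVneq => [->|t0].
  by under eq_fun do rewrite mulr0 add0r; rewrite oint_cst; ring.
have d : forall x : R, is_derive x 1 (fun w => t^-1 * sin (w * t + c)) (cos (x * t + c)).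
  move=> x; have := is_deriveZ t^-1 (is_derive_affine t c (@is_derive_sin R) x).
  by rewrite /GRing.scale /= mulrCA mulVf // mulr1.
rewrite (oint_FTC _ _ _ d); last first.
  by apply: cont_affine; [exact: continuous_cos|exact: cont_id].
by rewrite mulNr (addrC (- _)) !(sinD, sinB) sinN cosN; field.
Qed.

(** The kernel is half the integral of [cos (w * t)] over [w] in [[-h, h]], also at [t = 0], and
    this integral depends continuously on its parameter. *)
Lemma continuous_Dk h : continuous (Dk h).
Proof.
have -> : Dk h = (fun t => 2^-1 * oint (- h) h (fun w => cos (w * t))).
  apply/funext => t; under eq_fun do rewrite -[_ * t]addr0.
  by rewrite cos_oint cos0; field.
apply: contZ; apply: (@cont_oint _ _ (fun t w => cos (w * t))).
apply: cont_comp (@continuous_cos R).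
by apply: contM; [exact: cont_snd|exact: cont_fst].
Qed.

Lemma DkN h t : Dk h (- t) = Dk h t.
Proof.
rewrite /Dk oppr_eq0; case: eqVneq => // _.
by rewrite mulrN sinN invrN mulrNN.
Qed.

Lemma sin_le_id x : 0 <= x -> `|sin x| <= x.
Proof.
move=> x0.
have [|c _] := @MVT_segment R (@sin R) (@cos R) 0 x x0 (fun x _ => is_derive_sin x).
  by apply: continuous_subspaceT; exact: continuous_sin.
rewrite sin0 !subr0 => ->; rewrite normrM (ger0_norm x0) ler_piMl //.
by rewrite ler_norml cos_geN1 cos_le1.
Qed.

Lemma Dk_le h t : 0 <= h -> 0 <= t -> `|Dk h t| <= h.
Proof.
move=> h0 t0; rewrite /Dk; case: eqVneq => [_|tn0]; first by rewrite ger0_norm.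
have tp : 0 < t by rewrite lt_neqAle eq_sym tn0.
rewrite normrM normfV (gtr0_norm tp) ler_pdivrMr //.
by apply: sin_le_id; rewrite mulr_ge0.
Qed.

Lemma sin_exp_oint h t S :
  oint 0 S (fun s => sin (h * t) * expR (- (s * t))) = Dk h t * (1 - expR (- (S * t))).
Proof.
rewrite /Dk; case: eqVneq => [->|t0].
  under eq_fun do rewrite !mulr0 sin0 mul0r.
  by rewrite oint_cst mulr0 oppr0 expR0 subrr mulr0 mul0r.
have d : forall x : R, is_derive x 1
    (fun s => - (sin (h * t) / t) * expR (s * - t + 0)) (sin (h * t) * expR (- (x * t))).
  move=> x; have := is_deriveZ (- (sin (h * t) / t))
    (is_derive_affine (- t) 0 (@is_derive_expR R) x).
  rewrite /GRing.scale /= addr0 !mulrN; congr (is_derive _ _ _ _).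
  by field.
rewrite (oint_FTC _ _ _ d); first by rewrite mul0r !addr0 expR0 mulrN; ring.
apply: contZ; under eq_fun do rewrite -mulrN -[_ * - t]addr0.
by apply: cont_affine; [exact: continuous_expR|exact: cont_id].
Qed.

Lemma sin_exp_oint_time h s B : 0 < h ->
  oint 0 B (fun t => sin (h * t) * expR (- (s * t))) =
  (h ^+ 2 + s ^+ 2)^-1 * (h - expR (- (s * B)) * (h * cos (h * B) + s * sin (h * B))).
Proof.
move=> h0; have hs : h ^+ 2 + s ^+ 2 != 0.
  by rewrite gt_eqF // ltr_wpDr ?sqr_ge0 // exprn_gt0.
(* The primitive that two integrations by parts give. *)
have d : forall x : R, is_derive x 1
    (fun t => - (h ^+ 2 + s ^+ 2)^-1 *
       (expR (t * - s + 0) * (h * cos (t * h + 0) + s * sin (t * h + 0))))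
    (sin (h * x) * expR (- (s * x))).
  move=> x; have := is_deriveZ (- (h ^+ 2 + s ^+ 2)^-1)
    (is_deriveM (is_derive_affine (- s) 0 (@is_derive_expR R) x)
      (is_deriveD (is_deriveZ h (is_derive_affine h 0 (@is_derive_cos R) x))
        (is_deriveZ s (is_derive_affine h 0 (@is_derive_sin R) x)))).
  rewrite !fctE /= /GRing.scale /= !addr0 !mulrN !(mulrC x); congr (is_derive _ _ _ _).
  by field.
rewrite (oint_FTC _ _ _ d).
  rewrite !mul0r !addr0 expR0 cos0 sin0 mulrN !(mulrC B); field.
  exact: hs.
apply: contM.
  apply: (@cont_comp _ _ _ (fun t => h * t)); last exact: continuous_sin.
  by apply: contZ; exact: cont_id.
apply: (@cont_comp _ _ _ (fun t => - (s * t))); last exact: continuous_expR.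
by apply: contN; apply: contZ; exact: cont_id.
Qed.

Lemma atan_oint h S : 0 < h ->
  oint 0 S (fun s => h / (h ^+ 2 + s ^+ 2)) = atan (S / h).
Proof.
move=> h0.
have hs s : h ^+ 2 + s ^+ 2 != 0.
  by rewrite gt_eqF // ltr_wpDr ?sqr_ge0 // exprn_gt0.
have d : forall x : R, is_derive x 1 (fun s => atan (s * h^-1 + 0)) (h / (h ^+ 2 + x ^+ 2)).
  move=> x; have := is_derive_affine h^-1 0 (@is_derive1_atan R) x.
  congr (is_derive _ _ _ _); rewrite addr0; field.
  by rewrite hs gt_eqF.
rewrite (oint_FTC _ _ _ d) ?mul0r ?addr0 ?atan0 ?subr0 //.
apply: contZ; apply: contV => //.
by apply: contD; [exact: cont_cst|exact: exprn_continuous].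
Qed.

Lemma exp_oint c S : 0 < c -> oint 0 S (fun s => expR (- (s * c))) = (1 - expR (- (S * c))) / c.
Proof.
move=> c0.
have d : forall x : R, is_derive x 1 (fun s => - c^-1 * expR (s * - c + 0)) (expR (- (x * c))).
  move=> x; have := is_deriveZ (- c^-1) (is_derive_affine (- c) 0 (@is_derive_expR R) x).
  rewrite /GRing.scale /= addr0 !mulrN; congr (is_derive _ _ _ _).
  by field; rewrite gt_eqF.
rewrite (oint_FTC _ _ _ d); first by rewrite mul0r !addr0 expR0 mulrN; ring.
under eq_fun do rewrite -mulrN -[_ * - c]addr0.
by apply: cont_affine; [exact: continuous_expR|exact: cont_id].
Qed.

(* Laplace transform: [1 / t] is the integral of [expR (- s * t)] over [s > 0]. *)
Lemma Dk_atan h B S : 0 < h -> 0 < B -> 0 < S ->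
  `|oint 0 B (Dk h) - atan (S / h)| <= 2 / (h * B) + h / S.
Proof.
move=> h0 B0 S0.
have cexp c : continuous (fun t => expR (- (c * t))).
  apply: (@cont_comp _ _ _ (fun t => - (c * t))); last exact: continuous_expR.
  by apply: contN; apply: contZ; exact: cont_id.
have cexp' c : continuous (fun t => expR (- (t * c))).
  apply: (@cont_comp _ _ _ (fun t => - (t * c))); last exact: continuous_expR.
  by apply: contN; apply: contM; [exact: cont_id|exact: cont_cst].
have hs s : 0 < h ^+ 2 + s ^+ 2 by rewrite ltr_wpDr ?sqr_ge0 // exprn_gt0.
have cV : continuous (fun s => (h ^+ 2 + s ^+ 2)^-1).
  apply: contV => [s|]; first by rewrite gt_eqF.
  by apply: contD; [exact: cont_cst|exact: exprn_continuous].
(* The double integral of [sin (h * t) * expR (- (s * t))] over [[0, B]] and [[0, S]]; both inner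
   integrals are elementary. *)
have F : oint 0 B (fun t => Dk h t * (1 - expR (- (S * t)))) =
    oint 0 S (fun s => (h ^+ 2 + s ^+ 2)^-1 *
      (h - expR (- (s * B)) * (h * cos (h * B) + s * sin (h * B)))).
  under eq_fun do rewrite -sin_exp_oint.
  rewrite (@oint_Fubini _ (fun t s => sin (h * t) * expR (- (s * t)))).
    by congr (oint _ _ _); apply/funext => s; rewrite sin_exp_oint_time.
  apply: contM.
    apply: (@cont_comp _ _ _ (fun p : R * R => h * p.1)); last exact: continuous_sin.
    by apply: contZ; exact: cont_fst.
  apply: (@cont_comp _ _ _ (fun p : R * R => - (p.2 * p.1))); last exact: continuous_expR.
  by apply: contN; apply: contM; [exact: cont_snd|exact: cont_fst].
have cDk := @continuous_Dk h.
have e1 : `|oint 0 B (fun t => Dk h t * expR (- (S * t)))| <= h / S.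
  apply: le_trans (oint_norm_le (g := fun t => h * expR (- (t * S))) (ltW B0) _ _ _) _.
  - exact: contM.
  - exact: contZ.
  - move=> t /andP[t0 _]; rewrite normrM (ger0_norm (expR_ge0 _)) (mulrC t).
    by apply: ler_wpM2r; [exact: expR_ge0|exact: Dk_le (ltW h0) t0].
  - rewrite ointZ //.
    rewrite exp_oint // ler_pM2l // ler_piMl ?invr_ge0 ?(ltW S0) //.
pose r s := (h ^+ 2 + s ^+ 2)^-1 * (expR (- (s * B)) * (h * cos (h * B) + s * sin (h * B))).
have clin : continuous (fun s => h * cos (h * B) + s * sin (h * B)).
  by apply: contD; [exact: cont_cst|apply: contM; [exact: cont_id|exact: cont_cst]].
have cr : continuous r by apply: contM => //; exact: contM.
(* The factor of the exponential in [r] is at most [(h + s) / (h ^ 2 + s ^ 2)], which is at most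
   [2 / h] since [h * (h + s) <= 2 * (h ^ 2 + s ^ 2)]. *)
have e2 : `|oint 0 S r| <= 2 / (h * B).
  apply: le_trans (oint_norm_le (g := fun s => (2 / h) * expR (- (s * B))) (ltW S0) cr _ _) _.
  - exact: contZ.
  - move=> s /andP[s0 _].
    rewrite /r !normrM (ger0_norm (expR_ge0 _)) mulrCA mulrC.
    apply: ler_wpM2r; first exact: expR_ge0.
    rewrite normfV (gtr0_norm (hs s)) mulrC ler_pdivrMr //.
    have a1 : `|h * cos (h * B) + s * sin (h * B)| <= h + s.
      apply: le_trans (ler_normD _ _) _; apply: lerD; rewrite normrM.
        by rewrite gtr0_norm // ler_piMr ?(ltW h0) // ler_norml cos_geN1 cos_le1.
      by rewrite ger0_norm // ler_piMr // ler_norml sin_geN1 sin_le1.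
    apply: le_trans a1 _.
    rewrite -(ler_pM2l h0) [X in _ <= X](_ : _ = 2 * (h ^+ 2 + s ^+ 2)); last first.
      by field; rewrite gt_eqF.
    by nra.
  - rewrite ointZ // exp_oint // mulrA ler_pdivrMr // [X in _ <= X](_ : _ = 2 / h); last first.
      by field; rewrite !gt_eqF.
    by rewrite ler_piMr ?gerBl ?expR_ge0 // divr_ge0 // ltW.
have -> : oint 0 B (Dk h) - atan (S / h) =
    oint 0 B (fun t => Dk h t * expR (- (S * t))) - oint 0 S r.
  have -> : oint 0 B (Dk h) = oint 0 B (fun t => Dk h t * (1 - expR (- (S * t)))) +
      oint 0 B (fun t => Dk h t * expR (- (S * t))).
    rewrite -ointD.
    - by congr (oint _ _ _); apply/funext => t; ring.
    - by apply: contM => //; apply: contB => //; exact: cont_cst.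
    - exact: contM.
  have -> : atan (S / h) = oint 0 B (fun t => Dk h t * (1 - expR (- (S * t)))) + oint 0 S r.
    rewrite F -ointD // -?atan_oint //.
      by congr (oint _ _ _); apply/funext => s; rewrite /r; ring.
    by apply: contM => //; apply: contB; [exact: cont_cst|exact: contM].
  by ring.
by apply: le_trans (ler_normB _ _) _; rewrite addrC lerD.
Qed.

Lemma Dk_oint_lim h B : 0 < h -> 0 < B -> `|oint 0 B (Dk h) - pi / 2| <= 2 / (h * B).
Proof.
move=> h0 B0; apply/ler_addgt0Pr => e e0.
have e2 : 0 < e / 2 by rewrite divr_gt0.
have /cvgrPdist_le/(_ _ e2)[M [Mr HM]] := @cvgy_atan R.
(* [Dk_atan] is used with [S = x * h], so that [h / S = 1 / x]. This is at most [e / 2], and [x > M]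
   brings [atan x] within [e / 2] of [pi / 2]. *)
pose x := Num.max (M + 1) (2 / e).
have x0 : 0 < x by rewrite /x lt_max (divr_gt0 _ e0) // orbT.
have Mx : M < x by rewrite /x lt_max ltrDl ltr01.
have := @Dk_atan h B (x * h) h0 B0 (mulr_gt0 x0 h0).
have := HM x Mx; rewrite mulfK ?gt_eqF //= => h1 h2.
have h3 : h / (x * h) <= e / 2.
  rewrite invfM mulrCA divff ?gt_eqF // mulr1.
  by rewrite -[e / 2]invrK lef_pV2 ?posrE ?invr_gt0 // invf_div /x le_max lexx orbT.
have := ler_distD (atan x) (oint 0 B (Dk h)) (pi / 2).
by rewrite [`|atan x - _|]distrC; move: h1 h2 h3; lra.
Qed.

End DirichletKernel.

(** * Pointwise inversion in one variable *)

Section DirichletInversion.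
Context {R : realType}.
Implicit Types (a b c h s t x : R).

(** The primitive of [pi^-1 * Dk h] that vanishes at [+oo]. Its value [- 1 / 2] at [0] produces the
    term [phi 0 / 2] on integrating by parts. *)
Definition Dk_excess h t := pi^-1 * oint 0 t (Dk h) - 2^-1.

Lemma piV_le : (pi : R)^-1 <= 2^-1.
Proof. by rewrite lef_pV2 ?posrE ?pi_gt0 // pi_ge2. Qed.

Lemma pi_neq0 : (pi : R) != 0. Proof. by rewrite gt_eqF // pi_gt0. Qed.

Lemma piV_gt0 : 0 < (pi : R)^-1. Proof. by rewrite invr_gt0 pi_gt0. Qed.

Lemma Dk_excess_decay h t : 0 < h -> 0 < t -> `|Dk_excess h t| <= (h * t)^-1.
Proof.
move=> h0 t0; have -> : Dk_excess h t = pi^-1 * (oint 0 t (Dk h) - pi / 2).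
  by rewrite /Dk_excess mulrBr mulrA mulVf ?mul1r // pi_neq0.
rewrite normrM (gtr0_norm piV_gt0).
have := Dk_oint_lim h0 t0; have p0 := piV_gt0; have p2 := piV_le.
move=> e; apply: le_trans (ler_pM (ltW p0) (normr_ge0 _) p2 e) _.
by rewrite mulrA mulVf // mul1r.
Qed.

(** For [h * t <= 1] the kernel is at most [h], so its integral is at most [1]; for [h * t > 1] the
    decay bound is below [1]. *)
Lemma Dk_excess_le h t : 0 < h -> 0 <= t -> `|Dk_excess h t| <= 2.
Proof.
move=> h0 t0; have [ht|ht] := leP (h * t) 1.
  have : `|oint 0 t (Dk h)| <= h * (t - 0).
    apply: oint_bound => //; first exact: continuous_Dk.
    by move=> x /andP[x0 _]; exact: Dk_le (ltW h0) x0.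
  rewrite subr0 => e; have p0 := piV_gt0; have p2 := piV_le.
  have e' := ler_pM (ltW p0) (normr_ge0 _) p2 (le_trans e ht).
  have -> : Dk_excess h t = pi^-1 * oint 0 t (Dk h) - 2^-1 by [].
  apply: le_trans (ler_normB _ _) _.
  by rewrite normrM (gtr0_norm p0) (@gtr0_norm _ (2^-1)) ?invr_gt0 //; lra.
have t1 : 0 < t.
  by rewrite lt_neqAle t0 andbT; apply: contraTN ht => /eqP <-; rewrite mulr0 -leNgt.
apply: le_trans (Dk_excess_decay h0 t1) _.
by have : (h * t)^-1 < 1; [rewrite invf_lt1 // mulr_gt0|lra].
Qed.

Lemma cont_Dk_excess h : continuous (Dk_excess h).
Proof.
apply: contB; last exact: cont_cst.
apply: contZ; apply: is_derive_continuous.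
by apply: oint_primitive; exact: continuous_Dk.
Qed.

(** The boundary term at [B] gives [M / (h * B)]. The remaining integral is cut at [tau]: the excess
    of the primitive is at most [2] before [tau] and at most [1 / (h * tau)] after it. *)
Lemma half_inversion_C1 (phi dphi : R -> R) h B M L tau :
  0 < h -> 0 < tau -> tau <= B -> continuous dphi ->
  (forall x : R, is_derive x 1 phi (dphi x)) ->
  `|phi B| <= M -> (forall t, `|dphi t| <= L) ->
  `|pi^-1 * oint 0 B (fun t => phi t * Dk h t) - phi 0 / 2| <=
  M / (h * B) + L * (2 * tau + B / (h * tau)).
Proof.
move=> h0 t0 tB cd d phiM dL.
have B0 : 0 < B by exact: lt_le_trans tB.
have L0 : 0 <= L by exact: le_trans (normr_ge0 _) (dL 0).
have cD := @continuous_Dk R h; have cphi := is_derive_continuous d.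
have dk : forall x : R, is_derive x 1 (Dk_excess h) (pi^-1 * Dk h x).
  move=> x; have := is_deriveB (is_deriveZ pi^-1 (oint_primitive 0 cD x))
    (is_derive_cst (2^-1 : R) x 1).
  by rewrite subr0.
have cD' : continuous (fun t => pi^-1 * Dk h t) by exact: contZ.
have := oint_parts 0 B cd cD' d dk.
have -> : oint 0 B (fun t => phi t * (pi^-1 * Dk h t)) =
    pi^-1 * oint 0 B (fun t => phi t * Dk h t).
  rewrite -ointZ; last exact: contM.
  by congr (oint _ _ _); apply/funext => t; rewrite mulrCA.
move=> ->; set r := oint 0 B _.
rewrite {2}/Dk_excess ointxx mulr0 sub0r.
have -> : phi B * Dk_excess h B - phi 0 * - 2^-1 - r - phi 0 / 2 =
  phi B * Dk_excess h B - r by ring.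
apply: le_trans (ler_normB _ _) _; apply: lerD.
  by rewrite normrM; apply: ler_pM => //; exact: Dk_excess_decay.
have cr : continuous (fun t => dphi t * Dk_excess h t).
  by apply: contM => //; exact: cont_Dk_excess.
rewrite /r -(oint_cat 0 tau B cr); apply: le_trans (ler_normD _ _) _.
rewrite mulrDr; apply: lerD.
  apply: le_trans (oint_bound (M := L * 2) (ltW t0) cr _) _; last by rewrite subr0 mulrA.
  by move=> t /andP[u _]; rewrite normrM; apply: ler_pM => //; exact: Dk_excess_le.
apply: le_trans (oint_bound (M := L / (h * tau)) tB cr _) _.
  move=> t /andP[u _]; rewrite normrM; apply: ler_pM => //.
  apply: le_trans (Dk_excess_decay h0 (lt_le_trans t0 u)) _.
  have ht : 0 < h * tau by rewrite mulr_gt0.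
  have htt : h * tau <= h * t by rewrite ler_pM2l.
  by rewrite lef_pV2 ?posrE // (lt_le_trans ht).
rewrite -mulrA; apply: ler_wpM2l => //; rewrite mulrC.
by apply: ler_wpM2r; [rewrite invr_ge0 mulr_ge0 // ltW|rewrite gerBl ltW].
Qed.

(* The mean of [phi] over [x, x + r] replaces a Lipschitz [phi] by a C^1 function. *)
Lemma half_inversion (phi : R -> R) h B M L tau :
  0 < h -> 0 < tau -> tau <= B -> continuous phi ->
  (forall x, `|phi x| <= M) -> (forall x z, `|phi x - phi z| <= L * `|x - z|) ->
  `|pi^-1 * oint 0 B (fun t => phi t * Dk h t) - phi 0 / 2| <=
  M / (h * B) + L * (2 * tau + B / (h * tau)).
Proof.
move=> h0 t0 tB cphi phiM phiL.
have B0 : 0 < B by exact: lt_le_trans tB.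
have L0 : 0 <= L.
  by have := phiL 1 0; rewrite subr0 normr1 mulr1; apply: le_trans.
have cD := @continuous_Dk R h; have [P dP] := primitive_ex cphi.
set c := L * (pi^-1 * (h * B) + 1).
have c0 : 0 <= c.
  by rewrite mulr_ge0 // addr_ge0 // !mulr_ge0 // ?ltW // piV_gt0.
(* [c * r] bounds the two errors of replacing [phi] by its mean over a length [r], in the integral
   and at [0]. It may depend on [h] and [B], since [r] tends to [0] while they are fixed. *)
suff H r : 0 < r -> `|pi^-1 * oint 0 B (fun t => phi t * Dk h t) - phi 0 / 2| <=
    M / (h * B) + L * (2 * tau + B / (h * tau)) + c * r.
  apply/ler_addgt0Pr => e e0; apply: le_trans (H (e / (c + 1)) _) _.
    by rewrite divr_gt0 // ltr_wpDl.
  rewrite lerD2l mulrCA ler_piMr ?(ltW e0) // ler_pdivrMr ?mul1r ?lerDl //.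
  by rewrite ltr_wpDl.
move=> r0; pose phir x := r^-1 * oint x (x + r) phi.
have phirE x : phir x = r^-1 * (P (x + r) - P x) by rewrite /phir (oint_FTC _ _ cphi dP).
pose dphir x := r^-1 * (phi (x + r) - phi x).
have dr : forall x : R, is_derive x 1 phir (dphir x).
  move=> x; have -> : phir = fun x => r^-1 * (P (x * 1 + r) - P x).
    by apply/funext => z; rewrite phirE mulr1.
  have := is_deriveZ r^-1 (is_deriveB (is_derive_affine 1 r dP x) (dP x)).
  by rewrite /GRing.scale /= !mulr1.
have cdr : continuous dphir.
  apply: contZ; apply: contB => //.
  apply: (@cont_comp _ _ _ (fun x => x + r)) => //.
  by apply: contD; [exact: cont_id|exact: cont_cst].
have rle x : x <= x + r by rewrite lerDl ltW.
have phirM x : `|phir x| <= M.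
  rewrite /phir normrM normfV (gtr0_norm r0) mulrC ler_pdivrMr //.
  by apply: le_trans (oint_bound (M := M) (rle x) cphi _) _; rewrite // addrAC subrr add0r.
have dphirL x : `|dphir x| <= L.
  rewrite /dphir normrM normfV (gtr0_norm r0) mulrC ler_pdivrMr //.
  by apply: le_trans (phiL _ _) _; rewrite addrAC subrr add0r gtr0_norm.
have near_phi x : `|phi x - phir x| <= L * r.
  have -> : phi x - phir x = r^-1 * oint x (x + r) (fun t => phi x - phi t).
    rewrite ointB //; last exact: cont_cst.
    rewrite oint_cst mulrBr (addrAC x) subrr add0r mulrCA mulVf ?mulr1 //.
    by rewrite gt_eqF.
  rewrite normrM normfV (gtr0_norm r0) mulrC ler_pdivrMr //.
  apply: le_trans (oint_bound (M := L * r) (rle x) _ _) _.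
  - by apply: contB => //; exact: cont_cst.
  - move=> t /andP[u v]; apply: le_trans (phiL _ _) _.
    by rewrite ler_wpM2l // distrC ger0_norm ?subr_ge0 // lerBlDl.
  - by rewrite addrAC subrr add0r.
have := half_inversion_C1 h0 t0 tB cdr dr (phirM B) dphirL.
have cphir := is_derive_continuous dr.
have e1 : `|oint 0 B (fun t => phi t * Dk h t) - oint 0 B (fun t => phir t * Dk h t)| <=
    L * r * h * B.
  rewrite -ointB; [|exact: contM..].
  have -> : (fun t => phi t * Dk h t - phir t * Dk h t) =
      (fun t => (phi t - phir t) * Dk h t).
    by apply/funext => t; rewrite mulrBl.
  apply: le_trans (oint_bound (M := L * r * h) (ltW B0) _ _) _.
  - by apply: contM => //; exact: contB.
  - move=> t /andP[u _]; rewrite normrM; apply: ler_pM => //.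
    exact: Dk_le (ltW h0) u.
  - by rewrite subr0.
have e2 := near_phi 0.
move: e1; set I := oint 0 B _; set J := oint 0 B _ => e1 e3.
have p0 := piV_gt0.
have e4 := ler_wpM2l (ltW p0) e1.
rewrite -[X in X * `|_|](gtr0_norm p0) -normrM in e4.
have -> : pi^-1 * I - phi 0 / 2 =
  (pi^-1 * J - phir 0 / 2) + (pi^-1 * (I - J)) - (phi 0 - phir 0) / 2 by ring.
apply: le_trans (ler_normB _ _) _; rewrite [X in _ + X]normrM.
rewrite [`|2^-1|]gtr0_norm ?invr_gt0 //.
apply: le_trans (lerD (ler_normD _ _) (lexx _)) _.
have -> : c * r = pi^-1 * (L * r * h * B) + L * r by rewrite /c; ring.
have := normr_ge0 (phi 0 - phir 0); lra.
Qed.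

(** For [a <= b], the nearest-point projection onto [[a, b]]. Composition with it extends a function
    from [[a, b]] to the line with the same bound and the same Lipschitz constant, as
    [half_inversion] asks for both globally. *)
Definition clamp a b x := Num.max a (Num.min x b).

Lemma clamp_id a b x : a <= x <= b -> clamp a b x = x.
Proof. by move=> /andP[ax xb]; rewrite /clamp (min_idPl xb) (max_idPr ax). Qed.

Lemma clamp_itv a b x : a <= b -> a <= clamp a b x <= b.
Proof.
by move=> ab; rewrite /clamp le_max lexx /= ge_max ab ge_min lexx orbT.
Qed.

Lemma clamp_lip a b x z : a <= b -> `|clamp a b x - clamp a b z| <= `|x - z|.
Proof.
move=> ab; rewrite /clamp /Num.max /Num.min.
have := ler_norm (x - z); have := ler_norm (z - x); rewrite (distrC z).
by move=> ? ?; have [?|?] := ltP x b; have [?|?] := ltP z b; have [?|?] := ltP a x;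
  have [?|?] := ltP a z; have [?|?] := ltP a b; rewrite ler_norml; apply/andP; split; lra.
Qed.

(** The integral is cut at [y]; the left half is reflected, the kernel being even, and each half
    contributes [phi y / 2]. *)
Lemma inversion_1d (phi : R -> R) h a b y M L d Lam tau :
  0 < h -> 0 < tau -> tau <= d -> a + d <= y -> y + d <= b -> b - a <= Lam ->
  continuous phi ->
  (forall x, a <= x <= b -> `|phi x| <= M) ->
  (forall x z, a <= x <= b -> a <= z <= b -> `|phi x - phi z| <= L * `|x - z|) ->
  `|pi^-1 * oint a b (fun x => phi x * Dk h (x - y)) - phi y| <=
  2 * (M / (h * d) + L * (2 * tau + Lam / (h * tau))).
Proof.
move=> h0 t0 td ady ydb baL cphi phiM phiL.
have d0 : 0 < d by exact: lt_le_trans td.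
have ab : a <= b by lra.
have ay : a <= y <= b by apply/andP; split; lra.
have M0 : 0 <= M by exact: le_trans (normr_ge0 _) (phiM y ay).
have L0 : 0 <= L.
  have := phiL (y + d) y; rewrite (addrAC y) subrr add0r [`|d|]gtr0_norm //.
  move=> /(_ _ ay) H; have : 0 <= L * d.
    by apply: le_trans (normr_ge0 _) (H _); apply/andP; split; lra.
  by rewrite pmulr_lge0.
have cD := @continuous_Dk R h.
pose psi x := phi (clamp a b x).
have psiL x z : `|psi x - psi z| <= L * `|x - z|.
  apply: le_trans (phiL _ _ (clamp_itv _ ab) (clamp_itv _ ab)) _.
  by apply: ler_wpM2l => //; exact: clamp_lip.
have psiM x : `|psi x| <= M by apply: phiM; exact: clamp_itv.
have cpsi : continuous psi.
  move=> x; apply/cvgrPdist_le => e e0.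
  have e1 : 0 < e / (L + 1) by rewrite divr_gt0 // ltr_wpDl.
  near=> z; apply: le_trans (psiL _ _) _.
  have xz : `|x - z| <= e / (L + 1).
    by near: z; apply: (@cvgr_dist_le _ _ _ _ _ id) e1; exact: cvg_id.
  apply: le_trans (ler_wpM2l L0 xz) _.
  by rewrite mulrCA ler_piMr ?(ltW e0) // ler_pdivrMr ?mul1r ?lerDl // ltr_wpDl.
have psi_y : psi y = phi y by rewrite /psi clamp_id.
have csh (u v : R) : continuous (fun t => u * t + v).
  by apply: contD; [apply: contZ; exact: cont_id|exact: cont_cst].
(* [sg] is [1] to the right of [y] and [- 1] to its left, and [B] is the distance of [y] to that
   end. Bounding [B] below by [d] and above by [Lam] gives both halves the same error. *)
have half (sg : R) B : 0 < B -> d <= B -> B <= Lam -> `|sg| <= 1 ->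
    `|pi^-1 * oint 0 B (fun t => psi (sg * t + y) * Dk h t) - phi y / 2| <=
    M / (h * d) + L * (2 * tau + Lam / (h * tau)).
  move=> B0 dB BL sg1.
  have := @half_inversion (fun t => psi (sg * t + y)) h B M L tau h0 t0 (le_trans td dB).
  rewrite mulr0 add0r psi_y => H; apply: le_trans (H _ _ _) _.
  - by apply: (@cont_comp _ _ _ (fun t => sg * t + y)).
  - by move=> x; exact: psiM.
  - move=> x z; apply: le_trans (psiL _ _) _; apply: ler_wpM2l => //.
    have -> : sg * x + y - (sg * z + y) = sg * (x - z) by ring.
    by rewrite normrM ler_piMl.
  - have ht : 0 < h * tau by rewrite mulr_gt0.
    have hd : 0 < h * d by rewrite mulr_gt0.
    have hdB : h * d <= h * B by rewrite ler_pM2l.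
    apply: lerD.
      by apply: ler_wpM2l => //; rewrite lef_pV2 ?posrE // (lt_le_trans hd).
    by apply: ler_wpM2l => //; rewrite lerD2l ler_pM2r // invr_gt0.
have csub : continuous (fun x => phi x * Dk h (x - y)).
  apply: contM => //; apply: (@cont_comp _ _ _ (fun x => x - y)) => //.
  by apply: contB; [exact: cont_id|exact: cont_cst].
pose g x := psi x * Dk h (x - y).
have cg : continuous g.
  apply: contM => //; apply: (@cont_comp _ _ _ (fun x => x - y)) => //.
  by apply: contB; [exact: cont_id|exact: cont_cst].
have -> : oint a b (fun x => phi x * Dk h (x - y)) = oint a b g.
  by apply: eq_oint => // x xab; rewrite /g /psi clamp_id.
have [P dP] := primitive_ex cg.
have e1 : oint y b g = oint 0 (b - y) (fun t => psi (1 * t + y) * Dk h t).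
  have dQ : forall x : R, is_derive x 1 (fun t => P (t * 1 + y)) (psi (1 * x + y) * Dk h x).
    move=> x; have := is_derive_affine 1 y dP x.
    by rewrite /g !mulr1 addrK mul1r.
  rewrite (oint_FTC _ _ cg dP) (oint_FTC _ _ _ dQ) ?mulr1 ?subrK ?mul0r ?add0r //.
  by apply: contM => //; apply: (@cont_comp _ _ _ (fun t => 1 * t + y)).
have e2 : oint a y g = oint 0 (y - a) (fun t => psi (- 1 * t + y) * Dk h t).
  have dQ : forall x : R, is_derive x 1 (fun t => - 1 * P (t * - 1 + y))
      (psi (- 1 * x + y) * Dk h x).
    move=> x; have := is_deriveZ (- 1) (is_derive_affine (- 1) y dP x).
    by rewrite /GRing.scale /= /g !mulrN1 !mulN1r opprK addrK DkN.
  rewrite (oint_FTC _ _ cg dP) (oint_FTC _ _ _ dQ).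
    by rewrite !mulN1r !mulrN1 opprB subrK oppr0 add0r opprK addrC.
  by apply: contM => //; apply: (@cont_comp _ _ _ (fun t => - 1 * t + y)).
have hb : `|pi^-1 * oint y b g - phi y / 2| <= M / (h * d) + L * (2 * tau + Lam / (h * tau)).
  by rewrite e1; apply: half; rewrite ?normr1 //; lra.
have ha : `|pi^-1 * oint a y g - phi y / 2| <= M / (h * d) + L * (2 * tau + Lam / (h * tau)).
  by rewrite e2; apply: half; rewrite ?normrN1 //; lra.
rewrite -(oint_cat a y b cg) mulrDr; move: ha hb.
move: (pi^-1 * oint a y g) (pi^-1 * oint y b g) => u v ha hb.
have -> : u + v - phi y = (u - phi y / 2) + (v - phi y / 2) by field.
by apply: le_trans (ler_normD _ _) _; rewrite mulr_natl mulr2n lerD.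
Unshelve. all: by end_near. Qed.

End DirichletInversion.

(** * Iterated partial derivatives *)

Section Smooth.
Context {R : realType}.

(** Both sides are limits of the same difference quotient. *)
Lemma is_derive_line (V : normedModType R) (f : V -> R) (v x : V) (t d : R) :
  is_derive t 1 (fun t : R => f (t *: v + x)) d <-> is_derive (t *: v + x) v f d.
Proof.
have E : (fun h : R => h^-1 *: (((fun t : R => f (t *: v + x)) \o shift t) (h *: 1) -
    f (t *: v + x))) =
    (fun h => h^-1 *: ((f \o shift (t *: v + x)) (h *: v) - f (t *: v + x))).
  apply/funext => h; rewrite /= /shift; congr (_ *: (f _ - _)).
  have -> : h *: (1 : R) = h by exact: mulr1.
  by rewrite scalerDl addrA.
split=> -[].
  by rewrite /derivable /derive E => ? ?; exact: DeriveDef.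
by rewrite /derivable /derive -E => ? ?; exact: DeriveDef.
Qed.

Context (n : nat).
Implicit Types (f g h : 'rV[R]_n -> R) (x w : 'rV[R]_n) (i : 'I_n) (s : seq 'I_n).

Definition pderivable h := forall i x, derivable h x (delta_mx 0 i).

Lemma pderivable_line h i x t : pderivable h ->
  is_derive (t : R) 1 (fun t : R => h (t *: delta_mx 0 i + x))
    (partial i h (t *: delta_mx 0 i + x)).
Proof. by move=> dh; apply/is_derive_line; apply: DeriveDef => //; exact: dh. Qed.

Lemma partial_line h i (d : 'rV[R]_n -> R) :
  (forall x, is_derive (0 : R) 1 (fun t : R => h (t *: delta_mx 0 i + x)) (d x)) ->
  (forall x, derivable h x (delta_mx 0 i)) /\ partial i h = d.
Proof.
move=> H; have D x : is_derive x (delta_mx 0 i) h (d x).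
  by have := H x; rewrite is_derive_line scale0r add0r.
split=> [x|]; first by have [] := D x.
by apply/funext => x; have [_ <-] := D x.
Qed.

Lemma smooth_cont h s : smooth h -> continuous (foldr partial h s).
Proof. by move=> /(_ s)[]. Qed.

Lemma smooth_pderivable h s : smooth h -> pderivable (foldr partial h s).
Proof. by move=> /(_ s)[]. Qed.

Lemma partialB f g i : pderivable f -> pderivable g ->
  partial i (fun x => f x - g x) = fun x => partial i f x - partial i g x.
Proof. by move=> df dg; apply/funext => x; exact: (deriveB (df i x) (dg i x)). Qed.

Lemma pderivableB f g : pderivable f -> pderivable g -> pderivable (fun x => f x - g x).
Proof. by move=> df dg i x; exact: (derivableB (df i x) (dg i x)). Qed.

Lemma partialM f g i : pderivable f -> pderivable g ->
  partial i (fun x => f x * g x) = fun x => partial i f x * g x + f x * partial i g x.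
Proof.
move=> df dg; apply/funext => x; rewrite /partial (deriveM (df i x) (dg i x)).
by rewrite addrC /GRing.scale /= (mulrC (g x)).
Qed.

Lemma pderivableM f g : pderivable f -> pderivable g -> pderivable (fun x => f x * g x).
Proof. by move=> df dg i x; exact: (derivableM (df i x) (dg i x)). Qed.

Lemma partial_sum (I : Type) (l : seq I) (F : I -> 'rV[R]_n -> R) :
  (forall j, pderivable (F j)) ->
  pderivable (fun x => \sum_(j <- l) F j x) /\
  forall i, partial i (fun x => \sum_(j <- l) F j x) =
    fun x => \sum_(j <- l) partial i (F j) x.
Proof.
move=> dF; elim: l => [|j l [IH1 IH2]].
  have E : (fun x : 'rV[R]_n => \sum_(j <- [::]) F j x) = cst 0.
    by apply/funext => x; rewrite big_nil.
  rewrite E; split; first by move=> i x; exact: derivable_cst.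
  by move=> i; apply/funext => x; rewrite big_nil /partial derive_cst.
have E : (fun x : 'rV[R]_n => \sum_(j <- j :: l) F j x) =
    (fun x => F j x + \sum_(j <- l) F j x).
  by apply/funext => x; rewrite big_cons.
rewrite E; split.
  by move=> i x; exact: (derivableD (dF j i x) (IH1 i x)).
move=> i; apply/funext => x; rewrite big_cons.
have -> : \sum_(j0 <- l) partial i (F j0) x = partial i (fun x => \sum_(j <- l) F j x) x.
  by rewrite IH2.
exact: (deriveD (dF j i x) (IH1 i x)).
Qed.

Lemma foldr_partialB f g s : smooth f -> smooth g ->
  foldr partial (fun x => f x - g x) s =
  fun x => foldr partial f s x - foldr partial g s x.
Proof.
move=> sf sg; elim: s => [//|i s IH] /=.
by rewrite IH partialB //; exact: smooth_pderivable.
Qed.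

Lemma smoothB f g : smooth f -> smooth g -> smooth (fun x => f x - g x).
Proof.
move=> sf sg s /=; rewrite foldr_partialB //; split.
  by apply: contB; exact: smooth_cont.
by apply: pderivableB; exact: smooth_pderivable.
Qed.

(** The ways to distribute the derivatives of [s] over two factors, with repetitions, so that the
    Leibniz formula is a plain sum without binomial coefficients. *)
Fixpoint splits (T : Type) (s : seq T) : seq (seq T * seq T) :=
  if s is i :: s' then
    [seq (i :: p.1, p.2) | p <- splits s'] ++ [seq (p.1, i :: p.2) | p <- splits s']
  else [:: ([::], [::])].

(** Keeps the derivatives of both factors among the lists for which [smooth_net] grants
    moderateness. *)
Lemma splits_subseq (T : eqType) (s : seq T) p : p \in splits s ->
  subseq p.1 s /\ subseq p.2 s.
Proof.
elim: s p => [|i s IH] p; first by rewrite inE => /eqP ->.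
have up t : subseq t s -> subseq t (i :: s).
  by move=> ts; apply: subseq_trans ts _; exact: subseq_cons.
rewrite mem_cat => /orP[] /mapP[q /IH[h1 h2] ->]; split => //; try exact: up.
  by rewrite /= eqxx.
by rewrite /= eqxx.
Qed.

Lemma foldr_partialM f g s : smooth f -> smooth g ->
  foldr partial (fun x => f x * g x) s =
  fun x => \sum_(p <- splits s) foldr partial f p.1 x * foldr partial g p.2 x.
Proof.
move=> sf sg; elim: s => [|i s IH] /=.
  by apply/funext => x; rewrite big_seq1.
rewrite IH; have [_ ->] := @partial_sum _ (splits s)
  (fun p x => foldr partial f p.1 x * foldr partial g p.2 x)
  (fun p => pderivableM (smooth_pderivable sf) (smooth_pderivable sg)).
apply/funext => x; rewrite big_cat !big_map /= -big_split /=.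
apply: eq_bigr => p _; rewrite partialM //; exact: smooth_pderivable.
Qed.

Lemma smoothM f g : smooth f -> smooth g -> smooth (fun x => f x * g x).
Proof.
move=> sf sg s /=; rewrite foldr_partialM //; split.
  by apply: cont_sum => p; apply: contM; exact: smooth_cont.
have [+ _] := @partial_sum _ (splits s)
  (fun p x => foldr partial f p.1 x * foldr partial g p.2 x)
  (fun p => pderivableM (smooth_pderivable sf) (smooth_pderivable sg)).
by [].
Qed.

Lemma foldr_partial_cst (c : R) s : foldr partial (fun _ : 'rV[R]_n => c) s =
  fun=> if s is [::] then c else 0.
Proof.
elim: s => [//|i s /= ->]; apply/funext => x.
exact: (derive_cst (if s is [::] then c else 0)).
Qed.

Lemma smooth_cst (c : R) : smooth (fun _ : 'rV[R]_n => c).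
Proof.
move=> s /=; rewrite foldr_partial_cst; split; first exact: cont_cst.
by move=> i x; exact: derivable_cst.
Qed.

Definition dotv x w : R := \sum_i x 0 i * w 0 i.

Lemma dotvC x w : dotv x w = dotv w x.
Proof. by apply: eq_bigr => i _; rewrite mulrC. Qed.

Lemma dotv_line (t : R) i x w : dotv (t *: delta_mx 0 i + x) w = t * w 0 i + dotv x w.
Proof.
rewrite /dotv (eq_bigr (fun j => t * (delta_mx 0 i : 'rV_n) 0 j * w 0 j + x 0 j * w 0 j)).
  rewrite big_split /=; congr (_ + _); rewrite (bigD1 i) //= big1.
    by rewrite mxE !eqxx mulr1 addr0.
  by move=> j ji; rewrite mxE eqxx /= (negbTE ji) mulr0 mul0r.
by move=> j _; rewrite 2!mxE mulrDl.
Qed.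

Lemma cont_dotv (T : topologicalType) (u v : T -> 'rV[R]_n) :
  continuous u -> continuous v -> continuous (fun z => dotv (u z) (v z)).
Proof.
move=> cu cv; apply: cont_sum => i; apply: contM.
  exact: (@cont_comp _ _ _ u (fun x => x 0 i) cu (@cont_coord _ _ i)).
exact: (@cont_comp _ _ _ v (fun x => x 0 i) cv (@cont_coord _ _ i)).
Qed.

Lemma cont_cos_dotv (T : topologicalType) (u v : T -> 'rV[R]_n) (c : R) :
  continuous u -> continuous v -> continuous (fun z => cos (dotv (u z) (v z) + c)).
Proof.
move=> cu cv; apply: (@cont_comp _ _ _ (fun z => dotv (u z) (v z) + c)).
  by apply: contD; [exact: cont_dotv|exact: cont_cst].
exact: continuous_cos.
Qed.

(** Written as a phase shift, the derivative keeps the functions [k * cos (dotv x w + c)] closed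
    under all partial derivatives. *)
Lemma is_derive_cos_line (k e t : R) :
  is_derive t 1 (fun t : R => cos (t * k + e)) (k * cos (t * k + e + pi / 2)).
Proof.
have d : is_derive t 1 (fun t : R => t * k + e) k.
  have := is_deriveD (is_deriveM (is_derive_id t 1) (is_derive_cst k t 1))
    (is_derive_cst e t 1).
  by rewrite /GRing.scale /= !mulr0 mulr1 add0r addr0.
have := @is_derive1_comp _ (@cos R) (fun t => t * k + e) t _ _ (is_derive_cos _) d.
by rewrite cosDpihalf mulrC mulrN -mulNr mulNr -mulrN.
Qed.

Lemma partial_cos w (c k : R) i :
  pderivable (fun x => k * cos (dotv x w + c)) /\
  partial i (fun x => k * cos (dotv x w + c)) =
  fun x => k * w 0 i * cos (dotv x w + c + pi / 2).
Proof.
have H j x : is_derive (0 : R) 1 (fun t : R => k * cos (dotv (t *: delta_mx 0 j + x) w + c))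
    (k * w 0 j * cos (dotv x w + c + pi / 2)).
  have -> : (fun t : R => k * cos (dotv (t *: delta_mx 0 j + x) w + c)) =
     (fun t : R => k * cos (t * w 0 j + (dotv x w + c))).
    by apply/funext => t; rewrite dotv_line addrA.
  have := is_deriveZ k (is_derive_cos_line (w 0 j) (dotv x w + c) 0).
  by rewrite mul0r add0r /GRing.scale /= mulrA.
split=> [j x|]; first by have [] := @partial_line (fun x => k * cos (dotv x w + c)) _ _ (H j).
by have [] := @partial_line (fun x => k * cos (dotv x w + c)) _ _ (H i).
Qed.

Lemma foldr_partial_cos w (c : R) s :
  foldr partial (fun x => cos (dotv x w + c)) s =
  fun x => (\prod_(i <- s) w 0 i) * cos (dotv x w + (c + (pi / 2) *+ size s)).
Proof.
elim: s => [|i s IH].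
  by apply/funext => x; rewrite big_nil mul1r addr0.
rewrite [LHS]/= IH; have [_ ->] := partial_cos w (c + (pi / 2) *+ size s) (\prod_(i <- s) w 0 i) i.
apply/funext => x; rewrite big_cons (mulrC (w 0 i)); congr (_ * cos _).
by rewrite /= (mulrSr (pi / 2)) !addrA.
Qed.

Lemma smooth_cos w (c : R) : smooth (fun x => cos (dotv x w + c)).
Proof.
move=> s /=; rewrite foldr_partial_cos; split.
  apply: contZ; apply: cont_cos_dotv; first exact: cont_id.
  exact: cst_continuous.
set k := \prod_(i <- s) _; set e := c + _; move=> i.
by have [+ _] := partial_cos w e k i; exact.
Qed.

Lemma partial_cos_cint (q : 'rV[R]_n -> R) (a b c : R) i : a <= b -> continuous q ->
  pderivable (fun w => cint a b (fun x => q x * cos (dotv w x + c))) /\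
  partial i (fun w => cint a b (fun x => q x * cos (dotv w x + c))) =
  fun w => cint a b (fun x => q x * x 0 i * cos (dotv w x + (c + pi / 2))).
Proof.
move=> ab cq.
have H j w : is_derive (0 : R) 1
    (fun t : R => cint a b (fun x => q x * cos (dotv (t *: delta_mx 0 j + w) x + c)))
    (cint a b (fun x => q x * x 0 j * cos (dotv w x + (c + pi / 2)))).
  have := @derive_cint R n (fun t x => q x * cos (t * x 0 j + (dotv w x + c)))
    (fun t x => q x * x 0 j * cos (t * x 0 j + (dotv w x + c) + pi / 2)) a b ab _ _ _ 0.
  have -> : (fun t : R => cint a b (fun x => q x * cos (t * x 0 j + (dotv w x + c)))) =
    (fun t : R => cint a b (fun x => q x * cos (dotv (t *: delta_mx 0 j + w) x + c))).
    apply/funext => t; congr (cint _ _ _); apply/funext => x.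
    by rewrite dotv_line addrA.
  have -> : (fun x : 'rV[R]_n => q x * x 0 j * cos (0 * x 0 j + (dotv w x + c) + pi / 2)) =
    (fun x => q x * x 0 j * cos (dotv w x + (c + pi / 2))).
    by apply/funext => x; rewrite mul0r add0r addrA.
  apply.
  - move=> t; apply: contM => //.
    apply: (@cont_comp _ _ _ (fun x : 'rV[R]_n => t * x 0 j + (dotv w x + c)));
      last exact: continuous_cos.
    apply: contD; first by apply: contZ; exact: cont_coord.
    apply: contD; last exact: cont_cst.
    by apply: cont_dotv; [exact: cst_continuous|exact: cont_id].
  - have c2 := @cont_snd R 'rV[R]_n.
    apply: contM.
      apply: (@cont_comp _ _ _ _ (fun x : 'rV[R]_n => q x * x 0 j) c2).
      by apply: contM => //; exact: cont_coord.
    apply: (@cont_comp _ _ _ (fun p : R * 'rV[R]_n => p.1 * p.2 0 j + (dotv w p.2 + c) + pi / 2));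
      last exact: continuous_cos.
    apply: contD; last exact: cont_cst.
    apply: contD.
      apply: contM; first exact: cont_fst.
      exact: (@cont_comp _ _ _ _ (fun x : 'rV[R]_n => x 0 j) c2 (@cont_coord _ _ j)).
    apply: contD; last exact: cont_cst.
    by apply: cont_dotv; [exact: cst_continuous|exact: c2].
  - move=> t x; have := is_deriveZ (q x) (is_derive_cos_line (x 0 j) (dotv w x + c) t).
    by rewrite /GRing.scale /= mulrA.
pose F w := cint a b (fun x => q x * cos (dotv w x + c)).
split=> [j x|]; first by have [] := @partial_line F _ _ (H j).
by have [] := @partial_line F _ _ (H i).
Qed.

(** Each derivative under the integral multiplies [q] on the right by a coordinate and shifts the
    phase. [foldr] applies the last index first, hence the reversed list. *)
Lemma foldr_partial_cos_cint (q : 'rV[R]_n -> R) (a b c : R) s : a <= b -> continuous q ->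
  foldr partial (fun w => cint a b (fun x => q x * cos (dotv w x + c))) s =
  fun w => cint a b (fun x => q x * (\prod_(i <- rev s) x 0 i) *
    cos (dotv w x + (c + (pi / 2) *+ size s))).
Proof.
move=> ab cq; elim: s => [|i s IH].
  apply/funext => w; congr (cint _ _ _); apply/funext => x.
  by rewrite big_nil mulr1 addr0.
rewrite [LHS]/= IH.
have [|_ ->] := @partial_cos_cint (fun x => q x * (\prod_(i <- rev s) x 0 i)) a b
    (c + (pi / 2) *+ size s) i ab.
  by apply: contM => //; apply: cont_prod => j; exact: cont_coord.
apply/funext => w; congr (cint _ _ _); apply/funext => x.
by rewrite rev_cons big_rcons /= (mulrSr (pi / 2)) !mulrA !addrA.
Qed.

Lemma smooth_cos_cint (q : 'rV[R]_n -> R) (a b c : R) : a <= b -> continuous q ->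
  smooth (fun w => cint a b (fun x => q x * cos (dotv w x + c))).
Proof.
move=> ab cq s /=; rewrite foldr_partial_cos_cint //.
have cp : continuous (fun x : 'rV[R]_n => q x * (\prod_(i <- rev s) x 0 i)).
  by apply: contM => //; apply: cont_prod => j; exact: cont_coord.
split; last first.
  by move=> i; have [+ _] := partial_cos_cint (c + (pi / 2) *+ size s) i ab cp; exact.
apply: (@cont_cint _ _ _ (fun w x => q x * (\prod_(i <- rev s) x 0 i) *
    cos (dotv w x + (c + (pi / 2) *+ size s)))).
apply: contM; first exact: (cont_comp (@cont_snd _ _) cp).
by apply: cont_cos_dotv; [exact: cont_fst|exact: cont_snd].
Qed.

End Smooth.

(** * Inversion on a cube *)

Section BoxInversion.
Context {R : realType}.

(* Mixed difference quotients instead of mixed derivatives: after integrating out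
   some of the variables they are still bounded by linearity alone, without
   differentiating under the integral sign. *)
Fixpoint mixed_lip n (a b M : R) : ('rV[R]_n -> R) -> Prop :=
  match n with
  | 0 => fun g => `|g 0| <= M
  | m.+1 => fun g =>
      (forall t, a <= t <= b -> mixed_lip a b M (fun x : 'rV[R]_m => g (vcons t x))) /\
      (forall t s, a <= t <= b -> a <= s <= b ->
        mixed_lip a b (M * `|t - s|) (fun x : 'rV[R]_m => g (vcons t x) - g (vcons s x)))
  end.

Lemma mixed_lip_bound n a b M (g : 'rV[R]_n -> R) x :
  mixed_lip a b M g -> cube a b x -> `|g x| <= M.
Proof.
elim: n g x => [|n IH] g x; first by rewrite (thinmx0 x).
move=> [h _] hx; rewrite -(vcons_tail x); apply: (IH _ _ (h _ (hx ord0))).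
by move=> i; rewrite mxE; exact: hx.
Qed.

Definition Dk_box n h (y x : 'rV[R]_n) := \prod_i (pi^-1 * Dk h (x 0 i - y 0 i)).

Lemma cont_Dk_box n h (y : 'rV[R]_n) : continuous (Dk_box h y).
Proof.
apply: cont_prod => i; apply: contZ.
apply: (@cont_comp _ _ _ (fun x : 'rV[R]_n => x 0 i - y 0 i)); last exact: continuous_Dk.
by apply: contB; [exact: cont_coord|exact: cont_cst].
Qed.

Lemma Dk_box_cons n h (y : 'rV[R]_n.+1) t x :
  Dk_box h y (vcons t x) = pi^-1 * Dk h (t - y 0 ord0) * Dk_box h (vtail y) x.
Proof.
rewrite /Dk_box big_ord_recl vcons0; congr (_ * _); apply: eq_bigr => i _.
by rewrite vconsS mxE.
Qed.

(** Let [psi t] be the integral over all variables but the first. The induction hypothesis on slices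
    and on their differences bounds [psi] and its Lipschitz constant by [(1 + eta) ^+ n * M], so the
    first variable adds an error [eta * (1 + eta) ^+ n * M] to the error [((1 + eta) ^+ n - 1) * M]
    of the slice through [y]; the sum telescopes to the exponent [n.+1]. *)
Lemma box_inversion n (g : 'rV[R]_n -> R) h a b (y : 'rV[R]_n) M d Lam tau :
  0 < h -> 0 < tau -> tau <= d -> b - a <= Lam ->
  (forall i, a + d <= y 0 i /\ y 0 i + d <= b) ->
  continuous g -> mixed_lip a b M g ->
  `|cint a b (fun x => g x * Dk_box h y x) - g y| <=
  ((1 + 2 * ((h * d)^-1 + (2 * tau + Lam / (h * tau)))) ^+ n - 1) * M.
Proof.
move=> h0 t0 td baL; have d0 : 0 < d by exact: lt_le_trans td.
elim: n g y M => [|n IH] g y M hy cg gM.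
  rewrite (thinmx0 y) /cint /= /Dk_box big_ord0 mulr1 subrr normr0.
  by rewrite expr0 subrr mul0r.
have [hy0 hyb0] := hy ord0; have ab : a <= b by lra.
have y0 : a <= y 0 ord0 <= b by apply/andP; split; lra.
have hyt i : a + d <= vtail y 0 i /\ vtail y 0 i + d <= b by rewrite mxE; exact: hy.
have yab : cube a b y by move=> i; have [? ?] := hy i; apply/andP; split; lra.
have ytab : cube a b (vtail y) by move=> i; rewrite mxE; exact: yab.
have M0 : 0 <= M by exact: le_trans (normr_ge0 _) (mixed_lip_bound gM yab).
have Lam0 : 0 <= Lam by lra.
set eta := 2 * ((h * d)^-1 + (2 * tau + Lam / (h * tau))) in IH *.
have eta0 : 0 <= eta.
  by rewrite mulr_ge0 // !addr_ge0 // ?invr_ge0 ?divr_ge0 ?mulr_ge0 // ltW.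
have [gM1 gM2] := gM.
have cK := @cont_Dk_box n h (vtail y).
pose psi t := cint a b (fun x => g (vcons t x) * Dk_box h (vtail y) x).
have cpsi : continuous psi.
  apply: (@cont_cint _ _ _ (fun t x => g (vcons t x) * Dk_box h (vtail y) x)).
  by apply: contM; [exact: cont_cons2|exact: (cont_comp (@cont_snd _ _) cK)].
have E : cint a b (fun x => g x * Dk_box h y x) =
    pi^-1 * oint a b (fun t => psi t * Dk h (t - y 0 ord0)).
  rewrite cintS -ointZ; last first.
    apply: contM => //; apply: (@cont_comp _ _ _ (fun t => t - y 0 ord0)).
      by apply: contB; [exact: cont_id|exact: cont_cst].
    exact: continuous_Dk.
  congr (oint _ _ _); apply/funext => t; rewrite mulrCA /psi -cintZr.
    congr (cint _ _ _); apply/funext => x; rewrite Dk_box_cons; ring.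
  by apply: contM => //; exact: cont_cons.
have psi_err t (ht : a <= t <= b) : `|psi t - g (vcons t (vtail y))| <= ((1 + eta) ^+ n - 1) * M.
  by apply: (IH (fun x => g (vcons t x))); [|exact: cont_cons|exact: gM1].
have psiM t : a <= t <= b -> `|psi t| <= (1 + eta) ^+ n * M.
  move=> ht; have e1 := psi_err t ht.
  have e2 := mixed_lip_bound (gM1 t ht) ytab.
  have := ler_normD (psi t - g (vcons t (vtail y))) (g (vcons t (vtail y))).
  by rewrite subrK; move: e1 e2; lra.
(* By linearity the increment of [psi] is the integral of a difference of two slices, to which the
   induction hypothesis applies with the constant [M * |t - s|]. *)
have psiL t s : a <= t <= b -> a <= s <= b ->
    `|psi t - psi s| <= (1 + eta) ^+ n * M * `|t - s|.
  move=> ht hs; have gts := gM2 t s ht hs.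
  have cts : continuous (fun x => g (vcons t x) - g (vcons s x)).
    by apply: contB; exact: cont_cons.
  have := IH _ _ _ hyt cts gts.
  have -> : cint a b (fun x => (g (vcons t x) - g (vcons s x)) * Dk_box h (vtail y) x) =
      psi t - psi s.
    rewrite -cintB; [|by apply: contM => //; exact: cont_cons..].
    by congr (cint _ _ _); apply/funext => x; rewrite mulrBl.
  have e2 := mixed_lip_bound gts ytab => e1.
  have := ler_normD (psi t - psi s - (g (vcons t (vtail y)) - g (vcons s (vtail y))))
    (g (vcons t (vtail y)) - g (vcons s (vtail y))).
  by rewrite subrK; move: e1 e2; lra.
have := inversion_1d h0 t0 td hy0 hyb0 baL cpsi psiM psiL.
rewrite E; set I := pi^-1 * _ => e1.
have e2 := psi_err _ y0; rewrite vcons_tail in e2.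
have := ler_normD (I - psi (y 0 ord0)) (psi (y 0 ord0) - g y); rewrite addrA subrK => e3.
apply: le_trans e3 _; apply: le_trans (lerD e1 e2) _.
by rewrite exprS le_eqVlt; apply/orP; left; apply/eqP; rewrite /eta; ring.
Qed.

(** The difference quotients of the slice in direction [i] are those of [h] in direction
    [lift ord0 i]. *)
Lemma partial_slice n (h : 'rV[R]_n.+1 -> R) t i :
  partial i (fun x => h (vcons t x)) = (fun x => partial (lift ord0 i) h (vcons t x)) /\
  forall x, derivable h (vcons t x) (delta_mx 0 (lift ord0 i)) ->
    derivable (fun x => h (vcons t x)) x (delta_mx 0 i).
Proof.
have E x : (fun k : R => k^-1 *: (((fun x => h (vcons t x)) \o shift x) (k *: delta_mx 0 i) -
      h (vcons t x))) =
    (fun k => k^-1 *: ((h \o shift (vcons t x)) (k *: delta_mx 0 (lift ord0 i)) - h (vcons t x))).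
  apply/funext => k; rewrite /= /shift; congr (_ *: (h _ - _)).
  apply/rowP => j; have [l ->|->] := unliftP ord0 j.
    rewrite vconsS [LHS]mxE [RHS]mxE vconsS; congr (_ + _).
    by rewrite !mxE (inj_eq lift_inj).
  by rewrite vcons0 [RHS]mxE vcons0 !mxE mulr0 add0r.
split; first by apply/funext => x; rewrite /partial /derive E.
by move=> x; rewrite /derivable E.
Qed.

Lemma foldr_partial_slice n (h : 'rV[R]_n.+1 -> R) t (s : seq 'I_n) :
  foldr partial (fun x => h (vcons t x)) s =
  fun x => foldr partial h (map (lift ord0) s) (vcons t x).
Proof.
elim: s => [//|i s IH] /=; rewrite IH.
exact: (partial_slice (foldr partial h [seq lift ord0 i | i <- s]) t i).1.
Qed.

Lemma smooth_slice n (h : 'rV[R]_n.+1 -> R) t : smooth h ->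
  smooth (fun x => h (vcons t x)).
Proof.
move=> sh s /=; rewrite foldr_partial_slice; split.
  by apply: cont_cons; exact: smooth_cont.
move=> i x; apply: (partial_slice (foldr partial h (map (lift ord0) s)) t i).2.
exact: smooth_pderivable.
Qed.

Lemma vcons_line n (h : 'rV[R]_n.+1 -> R) x (t : R) : pderivable h ->
  is_derive t 1 (fun t => h (vcons t x)) (partial ord0 h (vcons t x)).
Proof.
move=> dh; have E z : vcons z x = z *: delta_mx 0 ord0 + vcons 0 x.
  apply/rowP => j; have [l ->|->] := unliftP ord0 j.
    by rewrite [RHS]mxE !vconsS !mxE mulr0 add0r.
  by rewrite [RHS]mxE !vcons0 !mxE mulr1 addr0.
rewrite E (_ : (fun t => h (vcons t x)) = fun t => h (t *: delta_mx 0 ord0 + vcons 0 x)).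
  exact: pderivable_line.
by apply/funext => z; rewrite E.
Qed.

(** The mean value theorem turns each difference into a partial derivative. Every variable is
    differenced at most once, in increasing order, hence the subsequences of [enum 'I_n]. *)
Lemma mixed_lip_deriv n a b M (g : 'rV[R]_n -> R) : smooth g ->
  (forall s x, subseq s (enum 'I_n) -> cube a b x -> `|foldr partial g s x| <= M) ->
  mixed_lip a b M g.
Proof.
elim: n M g => [|n IH] M g sg gM /=.
  by apply: (gM [::] 0); [exact: sub0seq|case].
have sub s : subseq s (enum 'I_n) -> subseq (ord0 :: map (lift ord0) s) (enum 'I_n.+1).
  by move=> hs; rewrite enum_ordSl /= map_subseq.
have sub' s : subseq s (enum 'I_n) -> subseq (map (lift ord0) s) (enum 'I_n.+1).
  by move=> /sub; apply: subseq_trans; exact: subseq_cons.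
split=> [t ht|t s].
  apply: IH; first exact: smooth_slice.
  move=> s x hs hx; rewrite foldr_partial_slice; apply: gM; first exact: sub'.
  exact: cube_vcons.
wlog st : s t / s <= t.
  move=> H ht hs; have [st|/ltW ts] := leP s t; first exact: H.
  have := H _ _ ts hs ht; rewrite (distrC s) => {H}.
  (* Mixed Lipschitz bounds do not change with the sign of the function, so exchanging [s] and [t]
     is harmless. *)
  suff opp m (f : 'rV[R]_m -> R) (N : R) (f' : 'rV[R]_m -> R) :
      (forall x, f' x = - f x) -> mixed_lip a b N f -> mixed_lip a b N f'.
    by apply: opp => x; rewrite opprB.
  elim: m f f' N => [|m IHm] f f' N ff' /=; first by rewrite ff' normrN.
  move=> [h1 h2]; split=> [z hz|z z' hz hz'].
    by apply: IHm (h1 z hz) => x; exact: ff'.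
  by apply: IHm (h2 z z' hz hz') => x; rewrite !ff' opprB opprK addrC.
move=> /andP[at_ tb] /andP[as_ sb].
apply: IH; first by apply: smoothB; exact: smooth_slice.
move=> l x hl hx; rewrite foldr_partialB; [|exact: smooth_slice..].
rewrite !foldr_partial_slice.
set h := foldr partial g _.
have dh : pderivable h by exact: smooth_pderivable.
have [] := @MVT_segment R (fun t => h (vcons t x)) (fun t => partial ord0 h (vcons t x)) s t st.
- by move=> z _; exact: vcons_line.
- apply: continuous_subspaceT; apply: is_derive_continuous => z; exact: vcons_line.
move=> z; rewrite in_itv /= => /andP[sz zt] ->.
rewrite normrM; apply: ler_wpM2r => //.
apply: (gM (ord0 :: map (lift ord0) l)); first exact: sub.
by apply: cube_vcons => //; rewrite (le_trans as_ sz) (le_trans zt tb).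
Qed.

Lemma cos_cint n h (t : 'rV[R]_n) c :
  cint (- h) h (fun w => cos (dotv w t + c)) = (\prod_i (2 * Dk h (t 0 i))) * cos c.
Proof.
elim: n t c => [|n IH] t c.
  by rewrite /cint /= /dotv !big_ord0 add0r mul1r.
rewrite cintS; transitivity (oint (- h) h (fun w =>
    (\prod_i (2 * Dk h (vtail t 0 i))) * cos (w * t 0 ord0 + c))).
  congr (oint _ _ _); apply/funext => w; rewrite -IH; congr (cint _ _ _).
  apply/funext => x; rewrite /dotv big_ord_recl vcons0; congr cos.
  rewrite addrAC addrC; congr (_ + _); apply: eq_bigr => i _.
  by rewrite vconsS mxE.
rewrite ointZ; last by apply: cont_affine; [exact: continuous_cos|exact: cont_id].
rewrite cos_oint big_ord_recl mulrA (mulrC (\prod_i _)); congr (_ * _ * _).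
by apply: eq_bigr => i _; rewrite mxE.
Qed.

End BoxInversion.

(** * Truncated Fourier transforms *)

Section ComplexFourier.
Context {R : realType} {n : nat}.
Implicit Types (g : 'rV[R]_n -> R[i]) (q : 'rV[R]_n -> R) (x y w : 'rV[R]_n).

Lemma Re_mul (z w : R[i]) :
  complex.Re (z * w) = complex.Re z * complex.Re w - complex.Im z * complex.Im w.
Proof. by case: z w => [a b] [c d]. Qed.

Lemma Im_mul (z w : R[i]) :
  complex.Im (z * w) = complex.Re z * complex.Im w + complex.Im z * complex.Re w.
Proof. by case: z w => [a b] [c d]. Qed.

(** For [sg = -1] the truncated transform, for [sg = 1] its inverse without the factor
    [(2 * pi) ^- n]. *)
Definition box_fourier (sg a b : R) g w : R[i] :=
  cboxint (const_mx a) (const_mx b) (fun x => g x * expi (sg * dotv x w)).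

Lemma cos_sg (sg t : R) : sg = 1 \/ sg = -1 -> cos (sg * t) = cos t.
Proof. by case=> ->; rewrite ?mul1r // mulN1r cosN. Qed.

Lemma sin_sg (sg t : R) : sg = 1 \/ sg = -1 -> sin (sg * t) = sg * cos (t + - (pi / 2)).
Proof. by rewrite cosBpihalf; case=> ->; rewrite ?mul1r // !mulN1r sinN. Qed.

Definition continuous_c g :=
  continuous (fun x => complex.Re (g x)) /\ continuous (fun x => complex.Im (g x)).

Lemma cont_q_cos1 q w (c : R) : continuous q ->
  continuous (fun x => q x * cos (dotv w x + c)).
Proof.
move=> cq; apply: contM => //; apply: cont_cos_dotv; last exact: cont_id.
exact: cst_continuous.
Qed.

Lemma Re_box_fourier sg a b g w : sg = 1 \/ sg = -1 -> continuous_c g ->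
  complex.Re (box_fourier sg a b g w) =
  cint a b (fun x => complex.Re (g x) * cos (dotv w x + 0)) -
  sg * cint a b (fun x => complex.Im (g x) * cos (dotv w x + - (pi / 2))).
Proof.
move=> hs [cR cI]; rewrite /= -/(cint _ _ _) -cintZ; last exact: cont_q_cos1.
rewrite -cintB; [|exact: cont_q_cos1|by apply: contZ; exact: cont_q_cos1].
congr (cint _ _ _); apply/funext => x; rewrite Re_mul /= cos_sg // sin_sg //.
by rewrite dotvC addr0 mulrCA.
Qed.

Lemma Im_box_fourier sg a b g w : sg = 1 \/ sg = -1 -> continuous_c g ->
  complex.Im (box_fourier sg a b g w) =
  cint a b (fun x => complex.Im (g x) * cos (dotv w x + 0)) +
  sg * cint a b (fun x => complex.Re (g x) * cos (dotv w x + - (pi / 2))).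
Proof.
move=> hs [cR cI]; rewrite /= -/(cint _ _ _) -cintZ; last exact: cont_q_cos1.
rewrite -cintD; [|exact: cont_q_cos1|by apply: contZ; exact: cont_q_cos1].
congr (cint _ _ _); apply/funext => x; rewrite Im_mul /= cos_sg // sin_sg //.
by rewrite dotvC addr0 mulrCA addrC.
Qed.

Lemma dotvBr w x y : dotv w (x - y) = dotv w x - dotv w y.
Proof.
by rewrite /dotv -sumrB; apply: eq_bigr => i _; rewrite !mxE mulrBr.
Qed.

Lemma cont_subv y : continuous (fun x : 'rV[R]_n => x - y).
Proof.
apply: cont_mx => i j; rewrite (ord1 i).
have -> : (fun x : 'rV[R]_n => (x - y) 0 j) = (fun x => x 0 j - y 0 j).
  by apply/funext => x; rewrite !mxE.
by apply: contB; [exact: cont_coord|exact: cont_cst].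
Qed.

(** After the exchange of integrals, [w] is integrated out by [cos_cint] into a product of kernels,
    each [2 * Dk] being [2 * pi] times a normalized one. The phase survives only as [cos c], which
    is [1] for cosines and [0] for sines. *)
Lemma cint_cint_cos q (a b h c : R) y : continuous q ->
  cint (- h) h (fun w => cint a b (fun x => q x * cos (dotv w (x - y) + c))) =
  (2 * pi) ^+ n * cint a b (fun x => q x * Dk_box h y x) * cos c.
Proof.
move=> cq; have cxy : continuous (fun x : 'rV[R]_n => x - y).
  exact: cont_subv.
rewrite (@cint_Fubini R n n (fun w x => q x * cos (dotv w (x - y) + c))); last first.
  apply: contM; first exact: (cont_comp (@cont_snd _ _) cq).
  by apply: cont_cos_dotv; [exact: cont_fst|exact: (cont_comp (@cont_snd _ _) cxy)].
rewrite -cintZ; last by apply: contM => //; exact: cont_Dk_box.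
rewrite -cintZr; last by apply: contZ; apply: contM => //; exact: cont_Dk_box.
congr (cint _ _ _); apply/funext => x; rewrite cintZ; last first.
  apply: cont_cos_dotv; [exact: cont_id|exact: cst_continuous].
rewrite cos_cint !mulrA; congr (_ * _); rewrite mulrAC mulrC; congr (_ * _).
have -> : (2 * pi : R) ^+ n = \prod_(i < n) (2 * pi) by rewrite prodr_const card_ord.
rewrite /Dk_box -big_split /=.
apply: eq_bigr => i _; rewrite !mxE mulrA -(mulrA 2) divff ?mulr1 //.
exact: pi_neq0.
Qed.

(** The addition formulas merge the products of trigonometric functions of [dotv w x] and [dotv w y]
    into a cosine and a sine of [dotv w (x - y)]; the sine, odd in [w], integrates to [0] over the
    symmetric cube. *)
Lemma box_fourier_inversion sg (a b h : R) g y : sg = 1 \/ sg = -1 -> continuous_c g ->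
  cboxint (const_mx (- h)) (const_mx h)
    (fun w => box_fourier sg a b g w * expi (- sg * dotv w y)) =
  ((2 * pi) ^+ n * cint a b (fun x => complex.Re (g x) * Dk_box h y x) +i*
   ((2 * pi) ^+ n * cint a b (fun x => complex.Im (g x) * Dk_box h y x)))%C.
Proof.
move=> hs cg; have [cR cI] := cg.
have hs' : - sg = 1 \/ - sg = -1 by case: hs => ->; [right|left; rewrite opprK].
have sg2 : sg * sg = 1 by case: hs => ->; rewrite ?mulr1 // mulrNN mulr1.
have cc q w c : continuous q -> continuous (fun x => q x * cos (dotv w (x - y) + c)).
  move=> cq; apply: contM => //; apply: cont_cos_dotv; first exact: cst_continuous.
  exact: cont_subv.
have cci q c : continuous q ->
    continuous (fun w => cint a b (fun x => q x * cos (dotv w (x - y) + c))).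
  move=> cq; apply: (@cont_cint _ _ _ (fun w x => q x * cos (dotv w (x - y) + c))).
  apply: contM; first exact: (cont_comp (@cont_snd _ _) cq).
  apply: cont_cos_dotv; first exact: cont_fst.
  apply: (@cont_comp _ _ _ _ (fun x : 'rV[R]_n => x - y) (@cont_snd _ _)).
  exact: cont_subv.
rewrite /cboxint -!/(cint _ _ _); congr Complex.
  transitivity (cint (- h) h (fun w =>
      cint a b (fun x => complex.Re (g x) * cos (dotv w (x - y) + 0)) -
      sg * cint a b (fun x => complex.Im (g x) * cos (dotv w (x - y) + - (pi / 2))))).
    congr (cint _ _ _); apply/funext => w.
    rewrite Re_mul Re_box_fourier // Im_box_fourier //.
    rewrite ![complex.Re (expi _)]/= ![complex.Im (expi _)]/= cos_sg // sin_sg //.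
    rewrite -!cintZ; do ?[exact: cont_q_cos1|exact: cc].
    rewrite -cintB; [|exact: cont_q_cos1|by apply: contZ; exact: cont_q_cos1].
    rewrite -cintD; [|exact: cont_q_cos1|by apply: contZ; exact: cont_q_cos1].
    have c1 : continuous (fun x => complex.Re (g x) * cos (dotv w x + 0) -
        sg * (complex.Im (g x) * cos (dotv w x + - (pi / 2)))).
      by apply: contB; [|apply: contZ]; exact: cont_q_cos1.
    have c2 : continuous (fun x => complex.Im (g x) * cos (dotv w x + 0) +
        sg * (complex.Re (g x) * cos (dotv w x + - (pi / 2)))).
      by apply: contD; [|apply: contZ]; exact: cont_q_cos1.
    rewrite -!cintZr // -[LHS]cintB; [|by apply: contM => //; exact: cont_cst..].
    rewrite -[RHS]cintB; [|exact: cc|by apply: contZ; exact: cc].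
    congr (cint _ _ _); apply/funext => x.
    rewrite !addr0 !cosBpihalf dotvBr cosB sinB.
    by case: hs => ->; ring.
  rewrite cintB; [|exact: cci|by apply: contZ; exact: cci].
  rewrite cintZ; last exact: cci.
  by rewrite !cint_cint_cos // cosN cos_pihalf cos0 !mulr0 mulr1 subr0.
transitivity (cint (- h) h (fun w =>
    cint a b (fun x => complex.Im (g x) * cos (dotv w (x - y) + 0)) +
    sg * cint a b (fun x => complex.Re (g x) * cos (dotv w (x - y) + - (pi / 2))))).
  congr (cint _ _ _); apply/funext => w.
  rewrite Im_mul Re_box_fourier // Im_box_fourier //.
  rewrite ![complex.Re (expi _)]/= ![complex.Im (expi _)]/= cos_sg // sin_sg //.
  rewrite -!cintZ; do ?[exact: cont_q_cos1|exact: cc].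
  rewrite -cintB; [|exact: cont_q_cos1|by apply: contZ; exact: cont_q_cos1].
  rewrite -cintD; [|exact: cont_q_cos1|by apply: contZ; exact: cont_q_cos1].
  have c1 : continuous (fun x => complex.Re (g x) * cos (dotv w x + 0) -
      sg * (complex.Im (g x) * cos (dotv w x + - (pi / 2)))).
    by apply: contB; [|apply: contZ]; exact: cont_q_cos1.
  have c2 : continuous (fun x => complex.Im (g x) * cos (dotv w x + 0) +
      sg * (complex.Re (g x) * cos (dotv w x + - (pi / 2)))).
    by apply: contD; [|apply: contZ]; exact: cont_q_cos1.
  rewrite -!cintZr // -[LHS]cintD; [|by apply: contM => //; exact: cont_cst..].
  rewrite -[RHS]cintD; [|exact: cc|by apply: contZ; exact: cc].
  congr (cint _ _ _); apply/funext => x.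
  rewrite !addr0 !cosBpihalf dotvBr cosB sinB.
  by case: hs => ->; ring.
rewrite cintD; [|exact: cci|by apply: contZ; exact: cci].
rewrite cintZ; last exact: cci.
by rewrite !cint_cint_cos // cosN cos_pihalf cos0 !mulr0 mulr1 addr0.
Qed.

End ComplexFourier.

(** * Nets and generalized numbers *)

Section Moderateness.
Context {R : realType} (rho : gauge R).
Implicit Types u v : R -> R.

Lemma near_unit_itv : \forall e \near (0 : R)^'+, 0 < e <= 1.
Proof.
near=> e; apply/andP; split => //.
by apply: ltW; near: e; exact: nbhs_right_lt.
Unshelve. all: by end_near. Qed.

Lemma moderate_le u v : moderate rho v ->
  (\forall e \near 0^'+, `|u e| <= `|v e|) -> moderate rho u.
Proof.
by move=> [N hN] uv; exists N; apply: filterS2 uv hN => e; exact: le_trans.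
Qed.

Lemma moderate_bounded u (M : R) : (forall e, `|u e| <= M) -> moderate rho u.
Proof.
move=> uM; apply: (moderate_le (moderate_cst rho M)).
by apply: nearW => e; apply: le_trans (uM e) (ler_norm _).
Qed.

Lemma moderate_eq u v : moderate rho v -> (\forall e \near 0^'+, u e = v e) ->
  moderate rho u.
Proof. by move=> mv uv; apply: (moderate_le mv); apply: filterS uv => e ->. Qed.

Lemma moderate_big_sum (I : Type) (l : seq I) (F : I -> R -> R) :
  (forall i, List.In i l -> moderate rho (F i)) ->
  moderate rho (fun e => \sum_(i <- l) F i e).
Proof.
elim: l => [|i l IH] H.
  apply: (moderate_eq (moderate_cst rho 0)).
  by apply: nearW => e; rewrite big_nil.
apply: (moderate_eq (v := F i + (fun e => \sum_(j <- l) F j e))).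
  by apply: moderateD; [apply: H; left|apply: IH => j jl; apply: H; right].
by apply: nearW => e; rewrite big_cons.
Qed.

Lemma moderate_big_prod (I : Type) (l : seq I) (F : I -> R -> R) :
  (forall i, moderate rho (F i)) -> moderate rho (fun e => \prod_(i <- l) F i e).
Proof.
move=> H; elim: l => [|i l IH].
  apply: (moderate_eq (moderate_cst rho 1)).
  by apply: nearW => e; rewrite big_nil.
apply: (moderate_eq (v := F i * (fun e => \prod_(j <- l) F j e))).
  exact: moderateM.
by apply: nearW => e; rewrite big_cons.
Qed.

Lemma negligible_le u v : rho_negligible rho v ->
  (\forall e \near 0^'+, `|u e| <= `|v e|) -> rho_negligible rho u.
Proof. by move=> hv uv m; apply: filterS2 uv (hv m) => e; exact: le_trans. Qed.

Lemma normc_le (z : R[i]) : normc z <= `|complex.Re z| + `|complex.Im z|.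
Proof.
case: z => a b /=; rewrite -(@ler_pXn2r _ 2) ?nnegrE ?sqrtr_ge0 ?addr_ge0 //.
rewrite sqr_sqrtr ?addr_ge0 ?sqr_ge0 // sqrrD !real_normK ?num_real //.
by rewrite -addrA lerD2l lerDr mulrn_wge0 // mulr_ge0.
Qed.

Lemma Re_le_normc (z : R[i]) : `|complex.Re z| <= normc z.
Proof.
case: z => a b /=; rewrite -sqrtr_sqr ler_sqrt ?addr_ge0 ?sqr_ge0 //.
by rewrite lerDl sqr_ge0.
Qed.

Lemma Im_le_normc (z : R[i]) : `|complex.Im z| <= normc z.
Proof.
case: z => a b /=; rewrite -sqrtr_sqr ler_sqrt ?addr_ge0 ?sqr_ge0 //.
by rewrite lerDr sqr_ge0.
Qed.

Lemma normc_ge0 (z : R[i]) : 0 <= normc z.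
Proof. by case: z => a b; exact: sqrtr_ge0. Qed.

Lemma cmoderateP (z : R -> R[i]) : cmoderate rho z <->
  moderate rho (fun e => complex.Re (z e)) /\ moderate rho (fun e => complex.Im (z e)).
Proof.
split=> [mz|[m1 m2]].
  split; apply: (moderate_le mz); apply: nearW => e.
    by rewrite (ger0_norm (normc_ge0 _)) Re_le_normc.
  by rewrite (ger0_norm (normc_ge0 _)) Im_le_normc.
have norm_mod v : moderate rho v -> moderate rho (fun e => `|v e|).
  by move=> mv; apply: (moderate_le mv); apply: nearW => e; rewrite normr_id.
apply: (moderate_le (moderateD (norm_mod _ m1) (norm_mod _ m2))).
apply: nearW => e; rewrite (ger0_norm (normc_ge0 _)).
by apply: le_trans (normc_le _) (ler_norm _).
Qed.

Lemma gcclsM (z w : R -> R[i]) : cmoderate rho z -> cmoderate rho w ->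
  gccls (fun e => z e * w e) = gccls z * gccls w :> gC rho.
Proof.
move=> /cmoderateP[zR zI] /cmoderateP[wR wI].
rewrite /gccls [RHS]/GRing.mul /=; congr Complex.
  rewrite -!gclsM // -gclsB; [|exact: moderateM..].
  by congr gcls; apply/funext => e; rewrite Re_mul.
rewrite -!gclsM // -gclsD; [|exact: moderateM..].
by congr gcls; apply/funext => e; rewrite Im_mul.
Qed.

Lemma cos_lip (a b : R) : `|cos a - cos b| <= `|a - b|.
Proof.
wlog ba : a b / b <= a.
  by move=> H; have [/H//|/ltW/H] := leP b a; rewrite distrC (distrC b).
have [] := @MVT_segment R (@cos R) (fun x => - sin x) b a ba (fun x _ => is_derive_cos x).
  by apply: continuous_subspaceT; exact: continuous_cos.
move=> c _ ->; rewrite normrM ler_piMl // normrN ler_norml.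
by rewrite sin_geN1 sin_le1.
Qed.

Lemma represents_moderate (x : gR rho) u : represents x u -> moderate rho u.
Proof. by case. Qed.

Lemma representsP (x : gR rho) u v : represents x u -> represents x v ->
  rho_negligible rho (u - v).
Proof. by move=> [mu eu] [mv ev]; apply/(gcls_eqP mu mv); rewrite eu ev. Qed.

Lemma representsM (x y : gR rho) u v : represents x u -> represents y v ->
  represents (x * y) (fun e => u e * v e).
Proof. by move=> [mu <-] [mv <-]; split; [exact: moderateM|exact: gclsM]. Qed.

Lemma representsD (x y : gR rho) u v : represents x u -> represents y v ->
  represents (x + y) (fun e => u e + v e).
Proof. by move=> [mu <-] [mv <-]; split; [exact: moderateD|exact: gclsD]. Qed.

Lemma representsN (x : gR rho) u : represents x u -> represents (- x) (fun e => - u e).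
Proof. by move=> [mu <-]; split; [exact: moderateN|exact: gclsN]. Qed.

Lemma represents_gcst (c : R) : represents (gcst c : gR rho) (fun=> c).
Proof. by split => //; exact: moderate_cst. Qed.

Lemma represents_eq (x : gR rho) u v : (forall e, u e = v e) ->
  represents x u -> represents x v.
Proof. by move=> /funext ->. Qed.

Lemma represents_gdot n (x w : gRn rho n) (u v : R -> 'rV[R]_n) :
  represents_vec x u -> represents_vec w v ->
  represents (gdot x w) (fun e => dotv (u e) (v e)).
Proof.
move=> xu wv; have H (l : seq 'I_n) : represents (\sum_(i <- l) x 0 i * w 0 i)
    (fun e => \sum_(i <- l) u e 0 i * v e 0 i).
  elim: l => [|i l IH].
    rewrite big_nil; apply: (represents_eq (u := fun=> 0)); first by move=> e; rewrite big_nil.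
    by split; [exact: moderate_cst|exact: gcls0].
  rewrite big_cons; apply: (represents_eq (u := fun e => u e 0 i * v e 0 i +
      \sum_(i <- l) u e 0 i * v e 0 i)); first by move=> e; rewrite big_cons.
  by apply: representsD => //; apply: representsM; [exact: xu|exact: wv].
exact: H.
Qed.

(** Cosine is [1]-Lipschitz, so a negligible change of argument changes it negligibly; sine is
    cosine with phase [- pi / 2]. *)
Lemma gexpi_represents (t : gR rho) u : represents t u ->
  gexpi t = gccls (fun e => expi (u e)).
Proof.
move=> tu; have neg := representsP (represents_grepr t) tu.
have cosm (v : R -> R) : moderate rho (fun e => cos (v e)).
  by apply: (@moderate_bounded _ 1) => e; rewrite ler_norml cos_geN1 cos_le1.
have cosn (c : R) : gcls (fun e => cos (grepr t e + c)) =
    gcls (fun e => cos (u e + c)) :> gR rho.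
  apply/gcls_eqP; [exact: cosm|exact: cosm|apply: (negligible_le neg)].
  apply: nearW => e; rewrite !fctE; apply: le_trans (cos_lip _ _) _.
  by rewrite opprD addrACA subrr addr0.
rewrite /gexpi /gccls; congr Complex.
  by have := cosn 0; under eq_fun do rewrite addr0; under [in RHS]eq_fun do rewrite addr0.
have := cosn (- (pi / 2)); under eq_fun do rewrite cosBpihalf.
by under [in RHS]eq_fun do rewrite cosBpihalf.
Qed.

End Moderateness.

(** * Nets of smooth functions and moderateness of their derivatives *)

Section SmoothNets.
Context {R : realType} (rho : gauge R) (n : nat).
Implicit Types (X : set (gRn rho n)) (F G : R -> 'rV[R]_n -> R).
Local Notation gRn := (gRn rho n).

(** Subsequences of these lists, for all [N], encode the multi-indices in the order in which
    [mpartial] differentiates. Unlike multi-indices, they can be split element by element, as the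
    Leibniz formula does. *)
Definition sorted_indices N : seq 'I_n := flatten [seq nseq N i | i <- enum 'I_n].

Lemma foldr_iter_partial (alpha : 'I_n -> nat) (l : seq 'I_n) (g : 'rV[R]_n -> R) :
  foldr (fun i => iter (alpha i) (partial i)) g l =
  foldr partial g (flatten [seq nseq (alpha i) i | i <- l]).
Proof.
elim: l => [//|i l IH] /=; rewrite foldr_cat -IH.
by elim: (alpha i) => [//|k /= ->].
Qed.

Lemma subseq_cat_split (T : eqType) (t s1 s2 : seq T) : subseq t (s1 ++ s2) ->
  exists t1 t2, [/\ t = t1 ++ t2, subseq t1 s1 & subseq t2 s2].
Proof.
move=> /subseqP[m ms ->].
exists (mask (take (size s1) m) s1), (mask (drop (size s1) m) s2); split.
- rewrite -mask_cat ?cat_take_drop // size_take ms size_cat.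
  by case: ltnP => // h; apply/eqP; rewrite eqn_leq h leq_addr.
- exact: mask_subseq.
- exact: mask_subseq.
Qed.

Lemma subseq_flatten_nseq N (l t : seq 'I_n) : uniq l ->
  subseq t (flatten [seq nseq N i | i <- l]) ->
  exists alpha : 'I_n -> nat, t = flatten [seq nseq (alpha i) i | i <- l].
Proof.
elim: l t => [|i l IH] t; first by move=> _; rewrite subseq0 => /eqP ->; exists (fun=> 0%N).
move=> /= /andP[il ul] /subseq_cat_split[t1 [t2 [-> s1 s2]]].
have [alpha ->] := IH _ ul s2.
exists (fun j => if j == i then size t1 else alpha j); rewrite eqxx; congr (_ ++ flatten _).
  apply/all_pred1P/allP => j /(mem_subseq s1).
  by rewrite mem_nseq => /andP[_].
by apply/eq_in_map => j jl; case: eqP => // ji; move: il; rewrite -ji jl.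
Qed.

Lemma mpartial_sorted (alpha : 'I_n -> nat) : exists N t,
  subseq t (sorted_indices N) /\ forall g : 'rV[R]_n -> R, mpartial alpha g = foldr partial g t.
Proof.
exists (\max_i alpha i), (flatten [seq nseq (alpha i) i | i <- enum 'I_n]); split; last first.
  by move=> g; exact: foldr_iter_partial.
rewrite /sorted_indices; elim: (enum 'I_n) => //= i l IH; apply: cat_subseq => //.
rewrite -(subnKC (leq_bigmax i)) nseqD; exact: prefix_subseq.
Qed.

Lemma sorted_mpartial N t : subseq t (sorted_indices N) ->
  exists alpha, forall g : 'rV[R]_n -> R, foldr partial g t = mpartial alpha g.
Proof.
move=> /(subseq_flatten_nseq (enum_uniq 'I_n))[alpha ->]; exists alpha => g.
by rewrite /mpartial foldr_iter_partial.
Qed.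

(** What [gsf_net] says of the real or of the imaginary part alone, without the value of the
    function, so that the two parts can be treated separately. *)
Definition smooth_net X F :=
  (forall e, 0 < e <= 1 -> smooth (F e)) /\
  forall (x : gRn) (u : R -> 'rV[R]_n), X x -> represents_vec x u ->
  forall N t, subseq t (sorted_indices N) ->
  moderate rho (fun e => foldr partial (F e) t (u e)).

Lemma gsf_netP X (f : gRn -> gC rho) (fe : R -> 'rV[R]_n -> R[i]) : gsf_net X f fe <->
  [/\ smooth_net X (fun e x => complex.Re (fe e x)),
      smooth_net X (fun e x => complex.Im (fe e x)) &
      forall x u, X x -> represents_vec x u -> f x = gccls (fun e => fe e (u e))].
Proof.
split=> [[sm val]|[[sR mR] [sI mI] val]].
  split; last by move=> x u Xx xu; have [] := val x u Xx xu.
    split=> [e /sm[]//|x u Xx xu N t /sorted_mpartial[alpha ta]].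
    have [_ /(_ alpha) /cmoderateP[m1 _]] := val x u Xx xu.
    by under eq_fun do rewrite ta.
  split=> [e /sm[]//|x u Xx xu N t /sorted_mpartial[alpha ta]].
  have [_ /(_ alpha) /cmoderateP[_ m1]] := val x u Xx xu.
  by under eq_fun do rewrite ta.
split=> [e he|x u Xx xu]; first by split; [exact: sR|exact: sI].
split=> [|alpha]; first exact: val.
have [N [t [ts ta]]] := mpartial_sorted alpha.
apply/cmoderateP; rewrite /cmpartial /=.
under eq_fun do rewrite ta; under [X in _ /\ moderate _ X]eq_fun do rewrite ta.
by split; [exact: mR xu _ _ ts|exact: mI xu _ _ ts].
Qed.

Lemma smooth_netB X F G : smooth_net X F -> smooth_net X G ->
  smooth_net X (fun e x => F e x - G e x).
Proof.
move=> [sF mF] [sG mG]; split=> [e he|x u Xx xu N t ts].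
  by apply: smoothB; [exact: sF|exact: sG].
apply: (moderate_eq (moderateD (mF _ _ Xx xu _ _ ts) (moderateN (mG _ _ Xx xu _ _ ts)))).
apply: filterS near_unit_itv => e he.
by rewrite foldr_partialB; [|exact: sF|exact: sG].
Qed.

Lemma smooth_netM X F G : smooth_net X F -> smooth_net X G ->
  smooth_net X (fun e x => F e x * G e x).
Proof.
move=> [sF mF] [sG mG]; split=> [e he|x u Xx xu N t ts].
  by apply: smoothM; [exact: sF|exact: sG].
apply: (moderate_eq (v := fun e => \sum_(p <- splits t)
    foldr partial (F e) p.1 (u e) * foldr partial (G e) p.2 (u e))); last first.
  apply: filterS near_unit_itv => e he.
  by rewrite foldr_partialM; [|exact: sF|exact: sG].
apply: (@moderate_big_sum _ _ _ (splits t)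
  (fun p e => foldr partial (F e) p.1 (u e) * foldr partial (G e) p.2 (u e))) => p pt.
have /splits_subseq[p1 p2] : p \in splits t.
  elim: (splits t) pt => //= q l IH [->|/IH h]; first by rewrite mem_head.
  by rewrite inE h orbT.
apply: moderateM.
  by apply: mF xu _ _ _ => //; exact: subseq_trans p1 ts.
by apply: mG xu _ _ _ => //; exact: subseq_trans p2 ts.
Qed.

Lemma smooth_net_cst X (c : R) : smooth_net X (fun _ _ => c).
Proof.
split=> [e _|x u _ _ N t _]; first exact: smooth_cst.
by under eq_fun do rewrite foldr_partial_cst; exact: moderate_cst.
Qed.

Lemma smooth_netD X F G : smooth_net X F -> smooth_net X G ->
  smooth_net X (fun e x => F e x + G e x).
Proof.
move=> sF sG; have := smooth_netB sF (smooth_netB (smooth_net_cst X 0) sG).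
by under eq_fun do under eq_fun do rewrite sub0r opprK.
Qed.

Lemma smooth_net_eq X F G : (forall e x, F e x = G e x) -> smooth_net X F -> smooth_net X G.
Proof. by move=> FG; have -> : G = F by apply/funext => e; apply/funext => x. Qed.

Lemma smooth_net_cos X (v : R -> 'rV[R]_n) (c : R) :
  (forall i, moderate rho (fun e => v e 0 i)) ->
  smooth_net X (fun e x => cos (dotv x (v e) + c)).
Proof.
move=> mv; split=> [e _|x u _ _ N t _]; first exact: smooth_cos.
under eq_fun do rewrite foldr_partial_cos.
apply: moderateM; first by apply: moderate_big_prod => i; exact: mv.
by apply: (@moderate_bounded _ _ _ 1) => e; rewrite ler_norml cos_geN1 cos_le1.
Qed.

Lemma gsf_netM X (f g : gRn -> gC rho) fe ge : gsf_net X f fe -> gsf_net X g ge ->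
  gsf_net X (fun x => f x * g x) (fun e x => fe e x * ge e x).
Proof.
move=> nf ng; have /gsf_netP[fR fI fv] := nf; have /gsf_netP[gR' gI gv] := ng.
apply/gsf_netP; split.
- apply: (smooth_net_eq (F := fun e x => complex.Re (fe e x) * complex.Re (ge e x) -
    complex.Im (fe e x) * complex.Im (ge e x))).
    by move=> e x; rewrite Re_mul.
  by apply: smooth_netB; exact: smooth_netM.
- apply: (smooth_net_eq (F := fun e x => complex.Re (fe e x) * complex.Im (ge e x) +
    complex.Im (fe e x) * complex.Re (ge e x))).
    by move=> e x; rewrite Im_mul.
  by apply: smooth_netD; exact: smooth_netM.
- move=> x u Xx xu; rewrite (fv x u) // (gv x u) // gcclsM //.
    apply/cmoderateP; split; [exact: (fR.2 x u Xx xu 0%N [::] (sub0seq _))|].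
    exact: (fI.2 x u Xx xu 0%N [::] (sub0seq _)).
  apply/cmoderateP; split; [exact: (gR'.2 x u Xx xu 0%N [::] (sub0seq _))|].
  exact: (gI.2 x u Xx xu 0%N [::] (sub0seq _)).
Qed.

Lemma gsf_net_cst X (c : R) :
  gsf_net X (fun=> gC_of_gR (gcst c)) (fun _ _ => (c +i* 0)%C).
Proof.
apply/gsf_netP; split; [exact: smooth_net_cst|exact: smooth_net_cst|].
by move=> x u _ _; rewrite /gC_of_gR /gccls /= -[X in (_ +i* X)%C]gcls0.
Qed.

Lemma gsf_net_expi X (sg : R) (w : gRn) (v : R -> 'rV[R]_n) : represents_vec w v ->
  gsf_net X (fun x => gexpi (gcst sg * gdot x w)) (fun e x => expi (sg * dotv x (v e))).
Proof.
move=> wv; have mv i : moderate rho (fun e => (sg *: v e) 0 i).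
  apply: (moderate_eq (moderateM (moderate_cst rho sg) (represents_moderate (wv i)))).
  by apply: nearW => e; rewrite mxE.
have dotZ e x : dotv x (sg *: v e) = sg * dotv x (v e).
  by rewrite /dotv mulr_sumr; apply: eq_bigr => i _; rewrite mxE mulrCA.
apply/gsf_netP; split.
- apply: (smooth_net_eq _ (smooth_net_cos X 0 mv)) => e x.
  by rewrite addr0 dotZ.
- apply: (smooth_net_eq _ (smooth_net_cos X (- (pi / 2)) mv)) => e x.
  by rewrite cosBpihalf dotZ.
- move=> x u _ xu; apply: gexpi_represents; apply: representsM.
    exact: represents_gcst.
  exact: represents_gdot.
Qed.

End SmoothNets.

(** * Integrals of generalized smooth functions *)

Section CubeIntegrals.
Context {R : realType} (rho : gauge R).
Implicit Types u v : R -> R.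

Lemma represents_near_eq (x : gR rho) u v : represents x u ->
  (\forall e \near 0^'+, v e = u e) -> represents x v.
Proof.
move=> [mu eu] uv; have mv : moderate rho v by exact: moderate_eq mu uv.
split=> //; rewrite -eu; apply/gcls_eqP => // m; near=> e.
rewrite !fctE (near uv e) // subrr normr0.
have /andP[r0 _] : 0 < rho e <= 1 by near: e; exact: near_gauge.
by rewrite exprn_ge0 // ltW.
Unshelve. all: by end_near. Qed.

(** [w - u] is dominated by the negligible net [u - v]. This applies to the minimum and the maximum
    of two representatives, from which enclosing cubes are made. *)
Lemma represents_between (x : gR rho) u v w : represents x u -> represents x v ->
  (forall e, `|w e - u e| <= `|u e - v e|) -> represents x w.
Proof.
move=> xu xv wu; have neg := representsP xu xv; have [mu eu] := xu.
have nw : rho_negligible rho (w - u).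
  by apply: (negligible_le neg); apply: nearW => e; exact: wu.
have mw : moderate rho w.
  have -> : w = u + (w - u) by rewrite addrC subrK.
  by apply: moderateD => //; exact: negligible_moderate.
by split => //; rewrite -eu; apply/gcls_eqP.
Qed.

Lemma represents_min (x : gR rho) u v : represents x u -> represents x v ->
  represents x (fun e => Num.min (u e) (v e)).
Proof.
move=> xu xv; apply: (represents_between xu xv) => e.
by have [_|_] := leP (u e) (v e); rewrite ?subrr ?normr0 // distrC.
Qed.

Lemma represents_max (x : gR rho) u v : represents x u -> represents x v ->
  represents x (fun e => Num.max (u e) (v e)).
Proof.
move=> xu xv; apply: (represents_between xu xv) => e.
by have [_|_] := leP (u e) (v e); rewrite ?subrr ?normr0 // distrC.
Qed.

Lemma represents_gt0 (k : gR rho) u : glt 0 k -> represents k u ->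
  \forall e \near 0^'+, 0 < u e.
Proof.
move=> k0 [mu eu]; move: k0; rewrite -gcls0 -eu => /gltP[||m hm] //.
  exact: moderate_cst.
near=> e; have /andP[r0 _] : 0 < rho e <= 1 by near: e; exact: near_gauge.
have : rho e ^+ m <= u e - 0 by near: e.
by rewrite subr0; apply: lt_le_trans; rewrite exprn_gt0.
Unshelve. all: by end_near. Qed.

(* Unlike [grepr k], nonnegative for every [e] and not only for small [e], so that
   nets of integrals over [-k, k] are smooth for all [e] in (0, 1]. *)
Definition abs_repr (k : gR rho) : R -> R := fun e => `|grepr k e|.

Lemma represents_abs (k : gR rho) : glt 0 k -> represents k (abs_repr k).
Proof.
move=> k0; apply: (represents_near_eq (represents_grepr k)).
by apply: filterS (represents_gt0 k0 (represents_grepr k)) => e; exact: gtr0_norm.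
Qed.

Lemma moderateX u m : moderate rho u -> moderate rho (fun e => u e ^+ m).
Proof.
move=> mu; elim: m => [|m IH]; first by under eq_fun do rewrite expr0; exact: moderate_cst.
by under eq_fun do rewrite exprS; exact: moderateM.
Qed.

Lemma moderate_norm u : moderate rho u -> moderate rho (fun e => `|u e|).
Proof. by move=> mu; apply: (moderate_le mu); apply: nearW => e; rewrite normr_id. Qed.

Lemma negligible_norm u : rho_negligible rho u -> rho_negligible rho (fun e => `|u e|).
Proof. by move=> mu; apply: (negligible_le mu); apply: nearW => e; rewrite normr_id. Qed.

Context {n : nat}.
Implicit Types (F G : R -> 'rV[R]_n -> R) (k : gR rho).

(** The bounds [lo] and [hi] make the net moderate and, paired with it, are the ordered
    representatives that [gle] asks for. *)
Lemma cube_represents k lo hi (u : R -> 'rV[R]_n) :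
  represents (- k) lo -> represents k hi ->
  (forall e, 0 < e <= 1 -> cube (lo e) (hi e) (u e)) ->
  exists x : gRn rho n, gcube k x /\ represents_vec x u.
Proof.
move=> rlo rhi hu.
have mu i : moderate rho (fun e => u e 0 i).
  have := moderateD (moderate_norm (represents_moderate rlo))
    (moderate_norm (represents_moderate rhi)).
  move=> mlh; apply: (moderate_le mlh); apply: filterS near_unit_itv => e he.
  rewrite fctE [leRHS]ger0_norm ?addr_ge0 //.
  have /andP[h1 h2] := hu e he i.
  have := ler_norm (hi e); have := ler_norm (- lo e); rewrite normrN ler_norml => ? ?.
  by have := normr_ge0 (lo e); have := normr_ge0 (hi e); move=> ? ?; apply/andP; split; lra.
have ru i : represents (gcls (fun e => u e 0 i) : gR rho) (fun e => u e 0 i).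
  by split; first exact: mu.
exists (\row_i gcls (fun e => u e 0 i)); split => i; last by rewrite mxE; exact: ru.
split; rewrite !mxE.
  exists lo, (fun e => u e 0 i); split => //.
  by move=> e he; have /andP[] := hu e he i.
exists (fun e => u e 0 i), hi; split => //.
by move=> e he; have /andP[] := hu e he i.
Qed.

Lemma argmax_net k lo hi F : represents (- k) lo -> represents k hi ->
  (forall e, lo e <= hi e) -> (forall e, 0 < e <= 1 -> continuous (F e)) ->
  exists (u : R -> 'rV[R]_n) (x : gRn rho n), [/\ gcube k x, represents_vec x u &
    forall e z, 0 < e <= 1 -> cube (lo e) (hi e) z -> `|F e z| <= `|F e (u e)|].
Proof.
move=> rlo rhi lohi cF.
have ex e : exists c : 'rV[R]_n, 0 < e <= 1 -> cube (lo e) (hi e) c /\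
    forall z, cube (lo e) (hi e) z -> `|F e z| <= `|F e c|.
  (* Outside [(0, 1]] the function [F e] may fail to be continuous; [0] is a default there. *)
  have [he|nhe] := pselect (0 < e <= 1); last by exists 0.
  have c0 : @cube R n (lo e) (hi e) !=set0.
    by exists (const_mx (lo e)) => i; rewrite mxE lexx lohi.
  have [|c cc hc] := compact_EVT_max (f := fun z => `|F e z|) c0 (@compact_cube R n (lo e) (hi e)).
    apply: continuous_subspaceT.
    by apply: (@cont_comp _ _ _ (F e) Num.norm (cF e he)) => x; exact: norm_continuous.
  exists c => _; split; first by rewrite inE in cc.
  by move=> z hz; apply: hc; rewrite inE.
have [u hu] := choice ex; exists u.
have [x [kx xu]] := cube_represents rlo rhi (fun e he => (hu e he).1).
by exists x; split => // e z he; exact: (hu e he).2.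
Qed.

Lemma cint_moderate k a b F : glt 0 k -> represents (- k) a -> represents k b ->
  (forall e, 0 < e <= 1 -> continuous (F e)) ->
  (forall (x : gRn rho n) (u : R -> 'rV[R]_n), gcube k x ->
    represents_vec x u -> moderate rho (fun e => F e (u e))) ->
  moderate rho (fun e => cint (a e) (b e) (F e)).
Proof.
move=> k0 ra rb cF mF.
have rk := represents_abs k0.
(* [a] and [b] are ordered only for small [e]; adjoining the symmetric interval of [abs_repr k]
   makes [lo <= hi] hold for every [e], as [argmax_net] requires. *)
pose lo e := Num.min (a e) (- abs_repr k e); pose hi e := Num.max (b e) (abs_repr k e).
have rlo : represents (- k) lo by apply: represents_min => //; exact: representsN.
have rhi : represents k hi by exact: represents_max.
have lohi e : lo e <= hi e.
  rewrite /lo /hi ge_min; apply/orP; right; rewrite le_max; apply/orP; right.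
  by rewrite -subr_ge0 opprK addr_ge0 // normr_ge0.
have [u [x [kx xu hu]]] := argmax_net rlo rhi lohi cF.
have mba : moderate rho (fun e => b e - a e).
  by apply: moderateD; [exact: represents_moderate rb|exact: moderateN (represents_moderate ra)].
apply: (moderate_le (moderateM (moderateX n mba) (mF x u kx xu))).
near=> e.
have he : 0 < e <= 1 by near: e; exact: near_unit_itv.
have b0 : 0 < b e by near: e; exact: represents_gt0 k0 rb.
have a0 : 0 < - a e.
  near: e; apply: (represents_gt0 k0).
  by have := representsN ra; rewrite opprK.
rewrite fctE normrM [`|_ ^+ n|]ger0_norm ?exprn_ge0 //; last by lra.
apply: cint_bound; [lra|exact: cF|move=> z hz; apply: hu => // i].
by have /andP[z1 z2] := hz i; rewrite /lo /hi ge_min z1 le_max z2.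
Unshelve. all: by end_near. Qed.

(** The endpoints are changed at fixed integrand, at the cost [v1]: their negligible displacement
    times the moderate maximum of [F]. Then the integrand is changed on a fixed cube, at the cost
    [v2], governed by the value of [F - G] at a maximum point, which is negligible. *)
Lemma cint_negligible k a b a' b' F G : glt 0 k ->
  represents (- k) a -> represents k b -> represents (- k) a' -> represents k b' ->
  (forall e, 0 < e <= 1 -> continuous (F e)) ->
  (forall e, 0 < e <= 1 -> continuous (G e)) ->
  (forall (x : gRn rho n) (u : R -> 'rV[R]_n), gcube k x ->
    represents_vec x u -> moderate rho (fun e => F e (u e))) ->
  (forall (x : gRn rho n) (u : R -> 'rV[R]_n), gcube k x -> represents_vec x u ->
    rho_negligible rho (fun e => F e (u e) - G e (u e))) ->
  rho_negligible rho (fun e => cint (a e) (b e) (F e) - cint (a' e) (b' e) (G e)).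
Proof.
move=> k0 ra rb ra' rb' cF cG mF nFG.
have rk := represents_abs k0.
pose lo e := Num.min (Num.min (a e) (a' e)) (- abs_repr k e).
pose hi e := Num.max (Num.max (b e) (b' e)) (abs_repr k e).
have rlo : represents (- k) lo.
  by apply: represents_min; [exact: represents_min|exact: representsN].
have rhi : represents k hi by do 2 apply: represents_max => //.
have lohi e : lo e <= hi e.
  rewrite /lo /hi ge_min; apply/orP; right; rewrite le_max; apply/orP; right.
  by rewrite -subr_ge0 opprK addr_ge0 // normr_ge0.
have [u [x [kx xu hu]]] := argmax_net rlo rhi lohi cF.
have cFG e : 0 < e <= 1 -> continuous (fun z => F e z - G e z).
  by move=> he; apply: contB; [exact: cF|exact: cG].
have [u' [x' [kx' xu' hu']]] := argmax_net rlo rhi lohi cFG.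
have mlh : moderate rho (fun e => 1 + (hi e - lo e)).
  apply: moderateD; first exact: moderate_cst.
  exact: moderateD (represents_moderate rhi) (moderateN (represents_moderate rlo)).
pose d e := `|a e - a' e| + `|b e - b' e|.
have nd : rho_negligible rho d.
  by apply: rho_negligibleD; apply: negligible_norm;
    [exact: (representsP ra ra')|exact: (representsP rb rb')].
pose v1 e := n%:R * 2 * ((1 + (hi e - lo e)) ^+ n * `|F e (u e)|) * d e.
have nv1 : rho_negligible rho v1.
  apply: rho_negligibleM => //; apply: moderateM; first exact: moderate_cst.
  by apply: moderateM; [exact: moderateX|apply: moderate_norm; exact: (mF _ _ kx xu)].
pose v2 e := (1 + (hi e - lo e)) ^+ n * `|F e (u' e) - G e (u' e)|.
have nv2 : rho_negligible rho v2.
  apply: rho_negligibleM; first exact: moderateX.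
  by apply: negligible_norm; exact: (nFG _ _ kx' xu').
apply: (negligible_le (rho_negligibleD nv1 nv2)); near=> e.
have he : 0 < e <= 1 by near: e; exact: near_unit_itv.
have b0 : 0 < b e by near: e; exact: represents_gt0 k0 rb.
have b0' : 0 < b' e by near: e; exact: represents_gt0 k0 rb'.
have a0 : 0 < - a e.
  by near: e; apply: (represents_gt0 k0); have := representsN ra; rewrite opprK.
have a0' : 0 < - a' e.
  by near: e; apply: (represents_gt0 k0); have := representsN ra'; rewrite opprK.
have la : lo e <= a e by rewrite /lo !ge_min lexx.
have la' : lo e <= a' e by rewrite /lo !ge_min lexx orbT.
have hb : b e <= hi e by rewrite /hi !le_max lexx.
have hb' : b' e <= hi e by rewrite /hi !le_max lexx orbT.
have L0 : 0 <= 1 + (hi e - lo e) by rewrite addr_ge0 // subr_ge0.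
have v10 : 0 <= v1 e by rewrite /v1 !mulr_ge0 // ?exprn_ge0 // addr_ge0.
have v20 : 0 <= v2 e by rewrite /v2 !mulr_ge0 // exprn_ge0.
rewrite fctE [leRHS]ger0_norm ?addr_ge0 //.
have ab : a e <= b e by lra.
have ab' : a' e <= b' e by lra.
have e1 := cint_box_change (d := d e) la ab hb la' ab' hb' _ _ (normr_ge0 (F e (u e))) (cF e he)
  (fun z => hu e z he).
have e2 : `|cint (a' e) (b' e) (F e) - cint (a' e) (b' e) (G e)| <= v2 e.
  rewrite -cintB; [|exact: cF|exact: cG].
  apply: le_trans (cint_bound ab' (cFG e he) (M := `|F e (u' e) - G e (u' e)|) _) _.
    move=> z hz; apply: (hu' e) => // i; have /andP[z1 z2] := hz i.
    by rewrite (le_trans la' z1) (le_trans z2 hb').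
  apply: ler_wpM2r => //; apply: lerXn2r; rewrite ?nnegrE ?subr_ge0 //; lra.
have -> : cint (a e) (b e) (F e) - cint (a' e) (b' e) (G e) =
  (cint (a e) (b e) (F e) - cint (a' e) (b' e) (F e)) +
  (cint (a' e) (b' e) (F e) - cint (a' e) (b' e) (G e)) by ring.
apply: le_trans (ler_normD _ _) _; apply: lerD e2.
apply: le_trans (e1 _ _) _.
- by rewrite /d lerDl.
- by rewrite /d lerDr.
- by rewrite /v1 le_eqVlt; apply/orP; left; apply/eqP; ring.
Unshelve. all: by end_near. Qed.

Lemma gsf_net_ReIm (X : set (gRn rho n)) f fe : gsf_net X f fe ->
  forall (x : gRn rho n) (u : R -> 'rV[R]_n), X x -> represents_vec x u ->
  moderate rho (fun e => complex.Re (fe e (u e))) /\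
  moderate rho (fun e => complex.Im (fe e (u e))).
Proof.
move=> /gsf_netP[fR fI _] x u Xx xu.
split; first exact: (fR.2 x u Xx xu 0%N [::] (sub0seq _)).
exact: (fI.2 x u Xx xu 0%N [::] (sub0seq _)).
Qed.

Lemma gsf_net_cont (X : set (gRn rho n)) f fe : gsf_net X f fe ->
  forall e, 0 < e <= 1 -> continuous_c (fe e).
Proof.
move=> [sf _] e /sf[sR sI].
by split; [exact: (@smooth_cont _ _ _ [::] sR)|exact: (@smooth_cont _ _ _ [::] sI)].
Qed.

Lemma gint_net k f fe a b : glt 0 k -> gsf_net (gcube k) f fe ->
  represents (- k) a -> represents k b ->
  gint (const_mx (- k) : gRn rho n) (const_mx k) f =
    gccls (fun e => cboxint (const_mx (a e)) (const_mx (b e)) (fe e)) /\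
  cmoderate rho (fun e => cboxint (const_mx (a e)) (const_mx (b e)) (fe e)).
Proof.
move=> k0 nf ra rb; rewrite /gint.
set ge := xget _ _.
(* Since [fe] is a net for [f], the choice made by [xget] satisfies the same property and is not the
   default. *)
have ng : gsf_net (gcube k) f ge by rewrite /ge; apply: xgetPex; exists fe.
have gv c e : grepr_vec (const_mx c : gRn rho n) e = const_mx (grepr c e).
  by apply/rowP => i; rewrite !mxE.
under eq_fun do rewrite !gv.
have cf := gsf_net_cont nf; have cg := gsf_net_cont ng.
have mf := gsf_net_ReIm nf; have mg := gsf_net_ReIm ng.
have rk := represents_grepr k; have rk' := represents_grepr (- k).
have val (x : gRn rho n) (u : R -> 'rV[R]_n) : gcube k x -> represents_vec x u ->
    rho_negligible rho (fun e => complex.Re (ge e (u e)) - complex.Re (fe e (u e))) /\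
    rho_negligible rho (fun e => complex.Im (ge e (u e)) - complex.Im (fe e (u e))).
  move=> kx xu; have [mfR mfI] := mf x u kx xu; have [mgR mgI] := mg x u kx xu.
  have := ((gsf_netP _ _ _).1 nf) => -[_ _ vf].
  have := ((gsf_netP _ _ _).1 ng) => -[_ _ vg].
  have := vg x u kx xu; rewrite (vf x u kx xu) => -[e1 e2].
  by split; apply/gcls_eqP.
have mR : moderate rho (fun e => cint (a e) (b e) (fun x => complex.Re (fe e x))).
  apply: (cint_moderate k0 ra rb) => [e he|x w kx xw]; first exact: (cf e he).1.
  exact: (mf x w kx xw).1.
have mI : moderate rho (fun e => cint (a e) (b e) (fun x => complex.Im (fe e x))).
  apply: (cint_moderate k0 ra rb) => [e he|x w kx xw]; first exact: (cf e he).2.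
  exact: (mf x w kx xw).2.
split; last exact/cmoderateP.
have nR := cint_negligible (F := fun e x => complex.Re (ge e x))
  (G := fun e x => complex.Re (fe e x)) k0 rk' rk ra rb (fun e he => (cg e he).1)
  (fun e he => (cf e he).1) (fun x w kx xw => (mg x w kx xw).1)
  (fun x w kx xw => (val x w kx xw).1).
have nI := cint_negligible (F := fun e x => complex.Im (ge e x))
  (G := fun e x => complex.Im (fe e x)) k0 rk' rk ra rb (fun e he => (cg e he).2)
  (fun e he => (cf e he).2) (fun x w kx xw => (mg x w kx xw).2)
  (fun x w kx xw => (val x w kx xw).2).
rewrite /gccls /=; congr Complex; apply/gcls_eqP => //.
  apply: (cint_moderate k0 rk' rk) => [e he|x w kx xw]; first exact: (cg e he).1.
  exact: (mg x w kx xw).1.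
apply: (cint_moderate k0 rk' rk) => [e he|x w kx xw]; first exact: (cg e he).2.
exact: (mg x w kx xw).2.
Qed.

(** A derivative in [w] only multiplies [q] by coordinates of the integration variable and shifts
    the phase. As cosines are at most [1], the resulting bound does not involve [w], so [X] is
    arbitrary. *)
Lemma smooth_net_cos_cint (X : set (gRn rho n)) k (q : R -> 'rV[R]_n -> R) (c : R) :
  glt 0 k -> smooth_net (gcube k) q ->
  smooth_net X (fun e w =>
    cint (- abs_repr k e) (abs_repr k e) (fun x => q e x * cos (dotv w x + c))).
Proof.
move=> k0 [sq mq]; have rk := represents_abs k0; have rk' := representsN rk.
have kk e : - abs_repr k e <= abs_repr k e.
  by rewrite -subr_ge0 opprK addr_ge0 // normr_ge0.
have cq e : 0 < e <= 1 -> continuous (q e).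
  by move=> /sq sqe; exact: (@smooth_cont _ _ _ [::] sqe).
split=> [e he|x w Xx xw N t _]; first by apply: smooth_cos_cint; [exact: kk|exact: cq].
pose F e (z : 'rV[R]_n) := q e z * \prod_(i <- rev t) z 0 i.
have cF e : 0 < e <= 1 -> continuous (F e).
  move=> he; apply: contM; first exact: cq.
  by apply: cont_prod => i; exact: cont_coord.
have [u [z [kz zu hu]]] := argmax_net rk' rk kk cF.
have mF : moderate rho (fun e => F e (u e)).
  apply: moderateM; first exact: (mq z u kz zu 0%N [::] (sub0seq _)).
  by apply: moderate_big_prod => i; exact: represents_moderate (zu i).
have m2k : moderate rho (fun e => abs_repr k e - - abs_repr k e).
  by apply: moderateD; [exact: represents_moderate rk|exact: moderateN (represents_moderate rk')].
apply: (moderate_le (moderateM (moderateX n m2k) mF)); apply: filterS near_unit_itv => e he.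
rewrite foldr_partial_cos_cint //; last exact: cq.
rewrite fctE normrM [`|_ ^+ n|]ger0_norm ?exprn_ge0 ?subr_ge0 //.
apply: cint_bound => //.
  apply: contM; first exact: cF.
  by apply: cont_cos_dotv; [exact: cst_continuous|exact: cont_id].
move=> y hy; apply: le_trans (hu e y he hy).
by rewrite normrM ler_piMr // ler_norml cos_geN1 cos_le1.
Qed.

Lemma smooth_net_eq_itv (X : set (gRn rho n)) F G :
  (forall e, 0 < e <= 1 -> F e = G e) -> smooth_net X F -> smooth_net X G.
Proof.
move=> FG [sF mF]; split=> [e he|x w Xx xw N t ts]; first by rewrite -FG //; exact: sF.
apply: (moderate_eq (mF x w Xx xw N t ts)); apply: filterS near_unit_itv => e he.
by rewrite FG.
Qed.

(** Gives the inner transform an explicit net, in particular on the cube of the outer integral,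
    which [gint_net] then evaluates. *)
Lemma gsf_net_fourier (X : set (gRn rho n)) k f fe (sg : R) : glt 0 k ->
  sg = 1 \/ sg = -1 -> gsf_net (gcube k) f fe ->
  gsf_net X (fun w => gint (const_mx (- k) : gRn rho n) (const_mx k)
      (fun x => f x * gexpi (gcst sg * gdot x w)))
    (fun e w => box_fourier sg (- abs_repr k e) (abs_repr k e) (fe e) w).
Proof.
move=> k0 hs nf; have [fR fI fv] := (gsf_netP _ _ _).1 nf.
have rk := represents_abs k0; have rk' := representsN rk.
have cf := gsf_net_cont nf.
apply/gsf_netP; split.
- apply: (smooth_net_eq_itv _ (smooth_netB (smooth_net_cos_cint X 0 k0 fR)
    (smooth_netM (smooth_net_cst X sg) (smooth_net_cos_cint X (- (pi / 2)) k0 fI)))).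
  by move=> e he; apply/funext => w; rewrite Re_box_fourier //; exact: cf.
- apply: (smooth_net_eq_itv _ (smooth_netD (smooth_net_cos_cint X 0 k0 fI)
    (smooth_netM (smooth_net_cst X sg) (smooth_net_cos_cint X (- (pi / 2)) k0 fR)))).
  by move=> e he; apply/funext => w; rewrite Im_box_fourier //; exact: cf.
- move=> w w' _ wv.
  exact: (gint_net k0 (gsf_netM nf (gsf_net_expi (gcube k) sg wv)) rk' rk).1.
Qed.

End CubeIntegrals.

(** * The inversion theorem *)

Section Inversion.
Context {R : realType} (rho : gauge R) (n : nat).
Implicit Types (k h : gR rho) (y : gRn rho n).

Lemma represents_vec_grepr y : represents_vec y (grepr_vec y).
Proof. by move=> i; rewrite grepr_vecE; exact: represents_grepr. Qed.

Lemma interior_gball (A : set (gRn rho n)) y : interior A y ->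
  exists c r, gball c r y /\ gball c r `<=` A.
Proof.
rewrite /interior nbhsE => -[B [oB By] BA].
(* By the construction of the topology from its base, openness of [B] unfolds to being a union of
   balls. *)
have [D' _ DB] : exists2 D' : set (gRn rho n * gR rho),
  D' `<=` gball_dom & \bigcup_(p in D') gball p.1 p.2 = B := oB.
move: By; rewrite -DB => -[p Dp yp]; exists p.1, p.2; split => // z zp.
by apply: BA; rewrite -DB; exists p.
Qed.

(* A small ball around [y] contains the two translates of [y] by
   [+- drho ^+ m.+1] in all coordinates at once. *)
Lemma interior_margin k y : glt 0 k -> interior (gcube k) y ->
  exists m, \forall e \near 0^'+, forall i,
    - abs_repr k e + rho e ^+ m <= grepr_vec y e 0 i /\
    grepr_vec y e 0 i + rho e ^+ m <= abs_repr k e.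
Proof.
move=> k0 /interior_gball[c [r [/gballP[m hm] sub]]].
have rk := represents_abs k0; have rk' := representsN rk.
have [z rz] : exists z : R -> gRn rho n, forall sg j,
    represents (z sg 0 j) (fun e => grepr (y 0 j) e + sg * rho e ^+ m.+1).
  exists (fun sg => \row_j gcls (fun e => grepr (y 0 j) e + sg * rho e ^+ m.+1)) => sg j.
  rewrite mxE; split => //; apply: moderateD; first exact: grepr_moderate.
  by apply: moderateM; [exact: moderate_cst|exact: moderate_rho].
have z_near sg : `|sg| <= 1 -> \forall e \near 0^'+, forall j,
    `|grepr_vec (z sg) e 0 j - grepr_vec y e 0 j| <= 2 * rho e ^+ m.+1.
  move=> sg1; apply: filter_forall => j.
  have neg := representsP (represents_grepr (z sg 0 j)) (rz sg j).
  apply: filterS2 (neg m.+1) (near_gauge rho) => e he /andP[r0 _].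
  rewrite !mxE; rewrite !fctE in he.
  have p0 : 0 <= rho e ^+ m.+1 by rewrite exprn_ge0 // ltW.
  have s1 : `|sg * rho e ^+ m.+1| <= rho e ^+ m.+1.
    by rewrite normrM [X in _ * X]ger0_norm // ler_piMl.
  have -> : grepr (z sg 0 j) e - grepr (y 0 j) e =
    (grepr (z sg 0 j) e - (grepr (y 0 j) e + sg * rho e ^+ m.+1)) + sg * rho e ^+ m.+1.
    by ring.
  by apply: le_trans (ler_normD _ _) _; rewrite mulr_natl mulr2n lerD.
have z_cube sg : `|sg| <= 1 -> gcube k (z sg).
  move=> sg1; apply: sub; apply/gballP; exists m.+1; near=> e.
  have /andP[r0 r1] : 0 < rho e <= 1 by near: e; exact: near_gauge.
  have n4 : 0 < 4 * n%:R + 4 :> R by rewrite ltr_wpDl // mulr_ge0.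
  (* With this, [rho e ^+ m] is at least [(4 n + 4)] times [rho e ^+ m.+1], which covers the bound
     [2 n] times [rho e ^+ m.+1] on the distance of the translate from [y] and leaves the margin
     [rho e ^+ m.+1]. *)
  have rlt : rho e < (4 * n%:R + 4)^-1.
    by near: e; apply: near_gauge_lt; rewrite invr_gt0.
  have hme : rho e ^+ m <= grepr r e - enorm (grepr_vec y e - grepr_vec c e).
    by near: e.
  have hz : forall j, `|grepr_vec (z sg) e 0 j - grepr_vec y e 0 j| <= 2 * rho e ^+ m.+1.
    by near: e; exact: z_near.
  have tri := enorm_triangle (grepr_vec (z sg) e - grepr_vec y e) (grepr_vec y e - grepr_vec c e).
  rewrite addrA subrK in tri.
  have zy : enorm (grepr_vec (z sg) e - grepr_vec y e) <= n%:R * (2 * rho e ^+ m.+1).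
    apply: le_trans (enorm_le_sum _) _.
    apply: (@le_trans _ _ (\sum_(j < n) 2 * rho e ^+ m.+1)).
      by apply: ler_sum => j _; have := hz j; rewrite !mxE.
    by rewrite sumr_const card_ord (mulr_natl _ n).
  have m0 : 0 < rho e ^+ m by rewrite exprn_gt0.
  have h4 : (4 * n%:R + 4) * rho e <= 1.
    by rewrite mulrC -ler_pdivlMr // mul1r ltW.
  have h5 : (4 * n%:R + 4) * rho e * rho e ^+ m <= rho e ^+ m by rewrite ler_piMl // ltW.
  rewrite exprS in zy *; have n0 : 0 <= n%:R :> R by [].
  have h6 : 0 <= n%:R * (rho e * rho e ^+ m) by rewrite !mulr_ge0 // ltW.
  have h7 : 0 <= rho e * rho e ^+ m by rewrite !mulr_ge0 // ltW.
  by move: tri zy h5 hme h6 h7; lra.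
(* The two inequalities in [gle] hold up to [rho e ^+ m.+2], at most half the shift [rho e ^+ m.+1]
   for small [e]; the other half still covers the margin [rho e ^+ m.+2]. *)
exists m.+2; apply: filter_forall => i.
have n1 : `|(1 : R)| <= 1 by rewrite normr1.
have nN1 : `|(- 1 : R)| <= 1 by rewrite normrN1.
have [kz _] := z_cube _ nN1 i; have [_ zk] := z_cube _ n1 i.
rewrite !mxE in kz zk.
have [mz1 ez1] := rz (- 1) i; have [mz2 ez2] := rz 1 i.
have [mk ek] := rk; have [mk' ek'] := rk'.
rewrite -ez1 -ek' in kz; rewrite -ez2 -ek in zk.
have g1 := gle_near mk' mz1 kz m.+2; have g2 := gle_near mz2 mk zk m.+2.
near=> e; rewrite !mxE.
have /andP[r0 r1] : 0 < rho e <= 1 by near: e; exact: near_gauge.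
have rlt : rho e < 2^-1 by near: e; apply: near_gauge_lt; rewrite invr_gt0.
have m0 : 0 < rho e ^+ m.+1 by rewrite exprn_gt0.
have h1 : - abs_repr k e <= grepr (y 0 i) e + - 1 * rho e ^+ m.+1 + rho e ^+ m.+2 by near: e.
have h2 : grepr (y 0 i) e + 1 * rho e ^+ m.+1 <= abs_repr k e + rho e ^+ m.+2 by near: e.
have h3 : rho e ^+ m.+2 <= 2^-1 * rho e ^+ m.+1 by rewrite exprS ler_pM2r // ltW.
by split; lra.
Unshelve. all: by end_near. Qed.

Lemma le_sum_mem (I : eqType) (l : seq I) (F : I -> R) i :
  (forall j, 0 <= F j) -> i \in l -> F i <= \sum_(j <- l) F j.
Proof.
move=> F0; elim: l => // j l IH; rewrite inE big_cons => /orP[/eqP ->|/IH il].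
  by rewrite lerDl; apply: sumr_ge0.
by apply: le_trans il _; rewrite lerDr.
Qed.

(** Only finitely many derivatives are involved, one for each mask of [enum 'I_n]. The sum of their
    maxima over the cube is moderate and yields one exponent for all of them. *)
Lemma deriv_bound k (F : R -> 'rV[R]_n -> R) : glt 0 k -> smooth_net (gcube k) F ->
  exists N : nat, \forall e \near 0^'+, forall s x, subseq s (enum 'I_n) ->
    cube (- abs_repr k e) (abs_repr k e) x -> `|foldr partial (F e) s x| <= rho e ^- N.
Proof.
move=> k0 [sF mF]; have rk := represents_abs k0; have rk' := representsN rk.
have kk e : - abs_repr k e <= abs_repr k e.
  by rewrite -subr_ge0 opprK addr_ge0 // normr_ge0.
(* Derivatives of order at most one in each variable are the case [N = 1] of sorted lists. *)
have enum1 : sorted_indices n 1 = enum 'I_n.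
  by rewrite /sorted_indices; elim: (enum 'I_n) => //= i l ->.
have ex s : exists v : R -> R, [/\ subseq s (enum 'I_n) -> moderate rho v,
    forall e, 0 <= v e & forall e x, 0 < e <= 1 -> subseq s (enum 'I_n) ->
    cube (- abs_repr k e) (abs_repr k e) x -> `|foldr partial (F e) s x| <= v e].
  have cF e : 0 < e <= 1 -> continuous (foldr partial (F e) s).
    by move=> /sF; exact: smooth_cont.
  have [u [x [kx xu hu]]] := argmax_net rk' rk kk cF.
  exists (fun e => `|foldr partial (F e) s (u e)|); split => //.
    by move=> ss; apply: moderate_norm; apply: (mF x u kx xu 1%N); rewrite enum1.
  by move=> e z he _; exact: hu.
have [V hV] := choice ex.
pose L := [seq mask (val t) (enum 'I_n) | t : (size (enum 'I_n)).-tuple bool].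
have [N hN] : moderate rho (fun e => \sum_(s <- L) V s e).
  apply: moderate_big_sum => s sL; have [+ _ _] := hV s; apply.
  have : s \in L.
    elim: L sL => //= q l IH [->|/IH h]; first by rewrite mem_head.
    by rewrite inE h orbT.
  by move=> /mapP[t _ ->]; exact: mask_subseq.
exists N; near=> e => s x ss hx.
have [_ _ /(_ e x _ ss hx)] := hV s.
move=> H; apply: le_trans (H _) _; first by near: e; exact: near_unit_itv.
have V0 q : 0 <= V q e by have [_ + _] := hV q.
apply: (@le_trans _ _ (\sum_(q <- L) V q e)).
  apply: (@le_sum_mem _ L (V ^~ e)) => //.
  have /subseqP[t st ->] := ss; apply/mapP.
  have tp : size t == size (enum 'I_n) by exact/eqP.
  by exists (Tuple tp); rewrite ?mem_enum.
apply: le_trans (ler_norm _) _; near: e; exact: hN.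
Unshelve. all: by end_near. Qed.

End Inversion.

(** * Size of the error and passage to the sharp limit *)

Section Estimate.
Context {R : realType} (rho : gauge R) (n : nat).
Implicit Types (k h : gR rho) (y : gRn rho n).

(** Makes the error of [box_inversion] linear in its small parameter. *)
Lemma expr1D_sub1_le (x : R) m : 0 <= x <= 1 -> (1 + x) ^+ m - 1 <= 2 ^+ m * x.
Proof.
move=> /andP[x0 x1]; elim: m => [|m IH]; first by rewrite !expr0 subrr mul1r.
have : (1 + x) ^+ m <= 2 ^+ m by apply: lerXn2r; rewrite ?nnegrE; lra.
by rewrite !exprS; nra.
Qed.

(* The radius [tau = r ^ Q] of the neighbourhood of [y] balances the two parts
   of the error of [box_inversion] when the cut-off [h] is at least [r ^- P]. *)
Lemma error_le (r h Lam : R) (m q N A : nat) :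
  let Q := (N + q.+1 + m)%N in let P := (2 * Q + A + m)%N in
  0 < r -> r <= 1 -> r <= (2 ^+ n * 10)^-1 ->
  0 <= Lam -> Lam <= 2 * r ^- A -> r ^- P <= h ->
  ((1 + 2 * ((h * r ^+ m)^-1 + (2 * r ^+ Q + Lam / (h * r ^+ Q)))) ^+ n - 1) * r ^- N
    <= r ^+ q.
Proof.
move=> Q P r0 r1 rn L0 LA hP.
have rX j : 0 < r ^+ j by rewrite exprn_gt0.
have mono i j : (i <= j)%N -> r ^+ j <= r ^+ i.
  by move=> ij; apply: ler_wiXn2l => //; exact: ltW.
have h0 : 0 < h by apply: lt_le_trans hP; rewrite invr_gt0.
have hV : h^-1 <= r ^+ P by rewrite -[leRHS]invrK lef_pV2 ?posrE // invr_gt0.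
have e1 : (h * r ^+ m)^-1 <= r ^+ Q.
  rewrite invfM; apply: le_trans (ler_wpM2r _ hV) _; first by rewrite invr_ge0 ltW.
  rewrite /P exprD mulfK ?gt_eqF //; apply: mono.
  by rewrite mulSn mul1n -addnA leq_addr.
have e2 : Lam / (h * r ^+ Q) <= 2 * r ^+ Q.
  have : Lam / (h * r ^+ Q) <= 2 * r ^- A * (r ^+ P / r ^+ Q).
    apply: ler_pM => //; first by rewrite invr_ge0 mulr_ge0 // ltW.
    by rewrite invfM; apply: ler_wpM2r => //; rewrite invr_ge0 ltW.
  move/le_trans; apply; rewrite -mulrA ler_pM2l //.
  have -> : r ^+ P = r ^+ A * (r ^+ Q * r ^+ (Q + m)).
    by rewrite -!exprD; congr (_ ^+ _); rewrite /P mulSn mul1n; ring.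
  rewrite -(mulrA (r ^+ A)) mulKf ?gt_eqF // mulrAC divff ?gt_eqF // mul1r.
  by apply: mono; exact: leq_addr.
have Q1 : r ^+ Q <= r.
  by rewrite -[leRHS]expr1; apply: mono; rewrite /Q addnS addSn.
have n10 : 0 < 2 ^+ n * 10 :> R by rewrite mulr_gt0 // exprn_gt0.
have n1 : 1 <= 2 ^+ n :> R by rewrite exprn_ege1 // ler1n.
have rn' : r * (2 ^+ n * 10) <= 1 by rewrite -ler_pdivlMr // mul1r.
set eta := 2 * _.
have eta0 : 0 <= eta.
  by rewrite mulr_ge0 // !addr_ge0 // ?invr_ge0 ?divr_ge0 ?mulr_ge0 // ltW.
(* The three terms are at most [r ^+ Q], [2 * r ^+ Q] and [2 * r ^+ Q], and the factor in front is
   [2]. *)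
have etaQ : eta <= 10 * r ^+ Q by rewrite /eta; lra.
have eta1 : eta <= 1 by nra.
have := expr1D_sub1_le n (introT andP (conj eta0 eta1)) => e3.
apply: le_trans (ler_wpM2r _ e3) _; first by rewrite invr_ge0 ltW.
(* In [Q], the summand [N] cancels the size of the derivatives, and the [1] in [q.+1] leaves a
   factor [r] to absorb the constant [2 ^+ n * 10]. *)
have E : r ^+ Q * r ^- N = r ^+ q.+1 * r ^+ m.
  by rewrite /Q -addnA exprD mulrAC divff ?gt_eqF // mul1r exprD.
have e4 : eta * r ^- N <= 10 * (r ^+ q.+1 * r ^+ m).
  by rewrite -E mulrA; apply: ler_wpM2r => //; rewrite invr_ge0 ltW.
rewrite -mulrA; apply: le_trans (ler_wpM2l _ e4) _; first by rewrite exprn_ge0.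
have m1 : r ^+ m <= 1 by rewrite exprn_ile1 // ltW.
have q0 := rX q; rewrite exprS.
have e5 : r * r ^+ q * r ^+ m <= r * r ^+ q.
  by rewrite ler_piMr // mulr_ge0 // ltW.
have : 2 ^+ n * (10 * (r * r ^+ q * r ^+ m)) <= (2 ^+ n * 10) * (r * r ^+ q).
  by rewrite mulrA ler_pM2l.
move/le_trans; apply; rewrite mulrA (mulrC _ r).
by rewrite ler_piMl // ltW.
Qed.

Lemma inversion_estimate k (F : R -> 'rV[R]_n -> R) y q : glt 0 k ->
  smooth_net (gcube k) F -> interior (gcube k) y ->
  exists P, forall hh : R -> R, (\forall e \near 0^'+, rho e ^- P <= hh e) ->
  \forall e \near 0^'+,
    `|cint (- abs_repr k e) (abs_repr k e) (fun x => F e x * Dk_box (hh e) (grepr_vec y e) x) -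
      F e (grepr_vec y e)| <= rho e ^+ q.
Proof.
move=> k0 sF yk; have [m hm] := interior_margin k0 yk.
have [N hN] := deriv_bound k0 sF.
have [A hA] := represents_moderate (represents_abs k0).
pose Q := (N + q.+1 + m)%N; exists (2 * Q + A + m)%N => hh hP; near=> e.
have he : 0 < e <= 1 by near: e; exact: near_unit_itv.
have /andP[r0 r1] : 0 < rho e <= 1 by near: e; exact: near_gauge.
have rn : rho e <= (2 ^+ n * 10)^-1.
  apply: ltW; near: e; apply: near_gauge_lt.
  by rewrite invr_gt0 mulr_gt0 // exprn_gt0.
have hPe : rho e ^- (2 * Q + A + m) <= hh e by near: e.
have kA : `|abs_repr k e| <= rho e ^- A by near: e.
have hme : forall i, - abs_repr k e + rho e ^+ m <= grepr_vec y e 0 i /\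
    grepr_vec y e 0 i + rho e ^+ m <= abs_repr k e by near: e.
have hNe : forall s x, subseq s (enum 'I_n) ->
    cube (- abs_repr k e) (abs_repr k e) x -> `|foldr partial (F e) s x| <= rho e ^- N.
  by near: e.
have sFe := sF.1 e he.
have kk0 : 0 <= abs_repr k e by exact: normr_ge0.
have L0 : 0 <= abs_repr k e - - abs_repr k e by rewrite opprK addr_ge0.
have LA : abs_repr k e - - abs_repr k e <= 2 * rho e ^- A.
  by move: kA; rewrite ger0_norm // => kA; lra.
have hh0 : 0 < hh e by apply: lt_le_trans hPe; rewrite invr_gt0 exprn_gt0.
apply: le_trans (error_le (m := m) (N := N) (q := q) r0 r1 rn L0 LA hPe).
apply: box_inversion => //.
- by rewrite exprn_gt0.
- by apply: ler_wiXn2l; [exact: ltW|exact: r1|exact: leq_addl].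
- exact: (@smooth_cont _ _ _ [::] sFe).
- exact: mixed_lip_deriv.
Unshelve. all: by end_near. Qed.

Lemma drhoXE q : (drho : gR rho) ^+ q = gcls (fun e => rho e ^+ q).
Proof.
elim: q => [|q IH].
  by rewrite expr0 -gcls1; congr gcls; apply/funext => e; rewrite expr0.
rewrite exprS IH -gclsM; [|exact: (@moderate_rho _ rho 1)|exact: moderate_rho].
by congr gcls; apply/funext => e; rewrite exprS.
Qed.

(** One power of [rho] is lost to a factor [4]: besides the real and imaginary parts of [Z], the
    representatives chosen by [gcabs] bring two negligible differences, also bounded by
    [rho e ^+ q.+1]. *)
Lemma gcabs_le (Z : R -> R[i]) q : cmoderate rho Z ->
  (\forall e \near 0^'+,
    `|complex.Re (Z e)| <= rho e ^+ q.+1 /\ `|complex.Im (Z e)| <= rho e ^+ q.+1) ->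
  gle (gcabs (gccls Z : gC rho)) (drho ^+ q).
Proof.
move=> /cmoderateP[mR mI] hZ; rewrite drhoXE /gcabs.
have nR := (gcls_eqP (grepr_moderate _) mR).1 (greprK (gcls (fun e => complex.Re (Z e)))) q.+1.
have nI := (gcls_eqP (grepr_moderate _) mI).1 (greprK (gcls (fun e => complex.Im (Z e)))) q.+1.
apply: gle_of_near; last first.
- near=> e; apply: le_trans (normc_le _) _.
  have /andP[r0 r1] : 0 < rho e <= 1 by near: e; exact: near_gauge.
  have rlt : rho e < 4^-1 by near: e; apply: near_gauge_lt; rewrite invr_gt0.
  have [h1 h2] : `|complex.Re (Z e)| <= rho e ^+ q.+1 /\ `|complex.Im (Z e)| <= rho e ^+ q.+1.
    by near: e.
  have h3 : `|(grepr (gcls (fun e => complex.Re (Z e)) : gR rho) - (fun e => complex.Re (Z e))) e|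
    <= rho e ^+ q.+1 by near: e.
  have h4 : `|(grepr (gcls (fun e => complex.Im (Z e)) : gR rho) - (fun e => complex.Im (Z e))) e|
    <= rho e ^+ q.+1 by near: e.
  rewrite !fctE in h3 h4; rewrite /gcrepr /gccls /=.
  have q0 : 0 < rho e ^+ q by rewrite exprn_gt0.
  have h5 : rho e ^+ q.+1 <= 4^-1 * rho e ^+ q by rewrite exprS ler_pM2r // ltW.
  have := lerD h3 h1; have := lerD h4 h2.
  have := ler_normD (grepr (gcls (fun e => complex.Re (Z e)) : gR rho) e - complex.Re (Z e))
    (complex.Re (Z e)).
  have := ler_normD (grepr (gcls (fun e => complex.Im (Z e)) : gR rho) e - complex.Im (Z e))
    (complex.Im (Z e)).
  by rewrite !subrK; lra.
- exact: moderate_rho.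
- by apply/cmoderateP; split; rewrite /=; exact: grepr_moderate.
Unshelve. all: by end_near. Qed.

Lemma Re_sub (z w : R[i]) : complex.Re (z - w) = complex.Re z - complex.Re w.
Proof. by case: z w => [? ?] [? ?]. Qed.

Lemma Im_sub (z w : R[i]) : complex.Im (z - w) = complex.Im z - complex.Im w.
Proof. by case: z w => [? ?] [? ?]. Qed.

(** The common end of both limits: it remains for each of them to exhibit a net of the double
    transform that is, for each [e], the integral of [f] against the product kernel. *)
Lemma sharp_lim_of_net k (f : gRn rho n -> gC rho) fe y (a : gR rho -> gC rho) :
  glt 0 k -> gsf_net (gcube k) f fe -> interior (gcube k) y ->
  (forall h, glt 0 h -> exists Z, [/\ a h = gccls Z, cmoderate rho Z &
    forall e, 0 < e <= 1 -> Z e =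
    (cint (- abs_repr k e) (abs_repr k e)
        (fun x => complex.Re (fe e x) * Dk_box (abs_repr h e) (grepr_vec y e) x) +i*
     cint (- abs_repr k e) (abs_repr k e)
        (fun x => complex.Im (fe e x) * Dk_box (abs_repr h e) (grepr_vec y e) x))%C]) ->
  sharp_lim_pinfty positive_infinite a (f y).
Proof.
move=> k0 nf yk ha q; have [sR sI fv] := (gsf_netP _ _ _).1 nf.
have yK : gcube k y by exact: interior_subset yk.
have yr := represents_vec_grepr y.
have [P1 hP1] := inversion_estimate q.+1 k0 sR yk.
have [P2 hP2] := inversion_estimate q.+1 k0 sI yk.
pose P := (P1 + P2)%N.
have mP : moderate rho (fun e => rho e ^- P.+1).
  exists P.+1; near=> e.
  have /andP[r0 r1] : 0 < rho e <= 1 by near: e; exact: near_gauge.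
  by rewrite ger0_norm // invr_ge0 exprn_ge0 // ltW.
(* One power more than the estimate asks for: [gle] is used up to the error [rho e ^+ 0 = 1], which
   the spare factor absorbs once [rho e < 1 / 2]. *)
exists (gcls (fun e => rho e ^- P.+1)) => h [h0 _] hle.
have [Z [-> mZ hZ]] := ha h h0.
have [mh eh] := represents_abs h0.
rewrite -eh in hle; have g := gle_near mP mh hle 0.
have hP : \forall e \near 0^'+, rho e ^- P <= abs_repr h e.
  near=> e.
  have /andP[r0 r1] : 0 < rho e <= 1 by near: e; exact: near_gauge.
  have rlt : rho e < 2^-1 by near: e; apply: near_gauge_lt; rewrite invr_gt0.
  have : rho e ^- P.+1 <= abs_repr h e + rho e ^+ 0 by near: e.
  rewrite expr0 exprS invfM => hlt.
  have p1 : 1 <= rho e ^- P by rewrite -[leLHS]invr1 lef_pV2 ?posrE ?exprn_gt0 // exprn_ile1 // ltW.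
  have r2 : 2 <= (rho e)^-1 by rewrite -[leLHS]invrK lef_pV2 ?posrE ?invr_gt0 // ltW.
  by nra.
have hPj j : (j <= P)%N -> \forall e \near 0^'+, rho e ^- j <= abs_repr h e.
  move=> jP; near=> e; apply: (@le_trans _ _ (rho e ^- P)); last by near: e.
  by apply: gaugeV_le => //; near: e; exact: near_gauge.
have e1 := hP1 _ (hPj _ (leq_addr _ _)); have e2 := hP2 _ (hPj _ (leq_addl _ _)).
have [m1 m2] := gsf_net_ReIm nf yK yr.
have [mZR mZI] := (cmoderateP _ _).1 mZ.
have E : gccls Z - f y = gccls (fun e => Z e - fe e (grepr_vec y e)) :> gC rho.
  rewrite (fv y _ yK yr) /gccls [LHS]/GRing.add /=; congr Complex.
    by rewrite -gclsB //; congr gcls; apply/funext => e; rewrite Re_sub.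
  by rewrite -gclsB //; congr gcls; apply/funext => e; rewrite Im_sub.
rewrite E; apply: gcabs_le.
  apply/cmoderateP; split.
    apply: (moderate_eq (moderateD mZR (moderateN m1))); apply: nearW => e.
    by rewrite Re_sub.
  apply: (moderate_eq (moderateD mZI (moderateN m2))); apply: nearW => e.
  by rewrite Im_sub.
near=> e.
have he : 0 < e <= 1 by near: e; exact: near_unit_itv.
rewrite hZ //.
have h1 : `|cint (- abs_repr k e) (abs_repr k e) (fun x => complex.Re (fe e x) *
  Dk_box (abs_repr h e) (grepr_vec y e) x) - complex.Re (fe e (grepr_vec y e))| <= rho e ^+ q.+1.
  by near: e.
have h2 : `|cint (- abs_repr k e) (abs_repr k e) (fun x => complex.Im (fe e x) *
  Dk_box (abs_repr h e) (grepr_vec y e) x) - complex.Im (fe e (grepr_vec y e))| <= rho e ^+ q.+1.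
  by near: e.
by rewrite Re_sub Im_sub.
Unshelve. all: by end_near. Qed.

Lemma cmoderateM (z w : R -> R[i]) : cmoderate rho z -> cmoderate rho w ->
  cmoderate rho (fun e => z e * w e).
Proof.
move=> /cmoderateP[zR zI] /cmoderateP[wR wI]; apply/cmoderateP; split.
  apply: (moderate_eq (moderateD (moderateM zR wR) (moderateN (moderateM zI wI)))).
  by apply: nearW => e; rewrite Re_mul.
apply: (moderate_eq (moderateD (moderateM zR wI) (moderateM zI wR))).
by apply: nearW => e; rewrite Im_mul.
Qed.

(** When the inverse transform is the inner one, its factor [(2 * pi) ^- n] stands under the outer
    integral and has to be taken out. *)
Lemma cboxintZ (c a b : R) (g : 'rV[R]_n -> R[i]) : continuous_c g ->
  cboxint (const_mx a) (const_mx b) (fun x => (c +i* 0)%C * g x) =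
  (c +i* 0)%C * cboxint (const_mx a) (const_mx b) g.
Proof.
move=> [cR cI]; rewrite /cboxint -!/(cint _ _ _) [RHS]/GRing.mul /=.
rewrite !mul0r subr0 addr0; congr Complex; rewrite -cintZ //; congr (cint _ _ _).
  by apply/funext => x; rewrite Re_mul /= mul0r subr0.
by apply/funext => x; rewrite Im_mul /= mul0r addr0.
Qed.

Lemma cmul_inv_2pi (u v : R) :
  (((2 * pi) ^- n : R) +i* 0)%C * (((2 * pi) ^+ n * u) +i* ((2 * pi) ^+ n * v))%C =
  (u +i* v)%C.
Proof.
have p0 : (2 * pi : R) ^+ n != 0 by rewrite expf_neq0 // mulf_neq0 // pi_neq0.
by rewrite [LHS]/GRing.mul /= !mul0r subr0 addr0 !mulKf.
Qed.

Lemma gcst1 : gcst 1 = 1 :> gR rho.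
Proof. exact: gcls1. Qed.

Lemma gcstN1 : gcst (- 1) = - 1 :> gR rho.
Proof. by rewrite -gcst1 -gclsN //; exact: moderate_cst. Qed.

Lemma gdotC (x w : gRn rho n) : gdot x w = gdot w x.
Proof. by apply: eq_bigr => i _; rewrite mulrC. Qed.

(** The sign becomes a factor [gcst (- 1)], the form that [gsf_net_fourier] shares between both
    transforms. *)
Lemma fourierE k (f : gRn rho n -> gC rho) w : fourier k f w =
  gint (const_mx (- k) : gRn rho n) (const_mx k)
    (fun x => f x * gexpi (gcst (- 1) * gdot x w)).
Proof.
by rewrite /fourier; congr gint; apply/funext => x; rewrite gcstN1 mulN1r.
Qed.

Lemma fourier_invE k (f : gRn rho n -> gC rho) w : fourier_inv k f w =
  gC_of_gR (gcst ((2 * pi) ^- n)) * gint (const_mx (- k) : gRn rho n) (const_mx k)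
    (fun x => f x * gexpi (gcst 1 * gdot x w)).
Proof.
rewrite /fourier_inv; congr (_ * gint _ _ _); apply/funext => x.
by rewrite gcst1 mul1r gdotC.
Qed.

End Estimate.

Theorem theorem61 (R : realType) (rho : gauge R) (n : nat) (k : gR rho)
    (hk : glt 0 k) (hkinf : ginfinite k)
    (X : set (gRn rho n)) (hKX : gcube k `<=` X)
    (f : gRn rho n -> gC rho) (hf : gsf X f)
    (y : gRn rho n) (hy : interior (gcube k) y) :
  sharp_lim_pinfty positive_infinite
    (fun h => fourier_inv h (fourier k f) y) (f y) /\
  sharp_lim_pinfty positive_infinite
    (fun h => fourier h (fourier_inv k f) y) (f y).
Proof.
have [fe [sm val]] := hf.
have nf : gsf_net (gcube k) f fe by split=> // x u /hKX; exact: val.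
have yr := represents_vec_grepr y.
have cf := gsf_net_cont nf.
pose c : R := (2 * pi) ^- n.
split; apply: (sharp_lim_of_net hk nf hy) => h h0.
  (* The inner transform has sign [- 1] and the outer exponential sign [1]; the factor
     [(2 * pi) ^- n] stays outside the outer integral. *)
  have net : gsf_net (gcube h) _ _ :=
    gsf_netM (gsf_net_fourier (gcube h) hk (or_intror erefl) nf)
      (gsf_net_expi (gcube h) 1 yr).
  have rh := represents_abs h0.
  have [I1 I2] := gint_net h0 net (representsN rh) rh.
  have cc : cmoderate rho (fun=> (c +i* 0)%C).
    by apply/cmoderateP; split; exact: moderate_cst.
  exists (fun e => (c +i* 0)%C * cboxint (const_mx (- abs_repr h e)) (const_mx (abs_repr h e))
    (fun w => box_fourier (- 1) (- abs_repr k e) (abs_repr k e) (fe e) w *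
       expi (1 * dotv w (grepr_vec y e)))); split.
  - have E : gccls (fun=> (c +i* 0)%C) = gC_of_gR (gcst c) :> gC rho.
      by rewrite /gC_of_gR /gccls /= -[X in _ = (_ +i* X)%C]gcls0.
    rewrite fourier_invE gcclsM // E -I1.
    under eq_fun do rewrite fourierE.
    by [].
  - exact: cmoderateM.
  - move=> e he; have := box_fourier_inversion (- abs_repr k e) (abs_repr k e) (abs_repr h e)
      (grepr_vec y e) (or_intror erefl) (cf e he).
    by rewrite opprK => ->; exact: cmul_inv_2pi.
(* The signs are exchanged, and the constant [c] of the inner transform now belongs to the
   integrated net. *)
have net1 := gsf_netM (gsf_net_fourier (gcube h) hk (or_introl erefl) nf)
    (gsf_net_expi (gcube h) (- 1) yr).
have net := gsf_netM (gsf_net_cst (gcube h) c) net1.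
have rh := represents_abs h0.
have [I1 I2] := gint_net h0 net (representsN rh) rh.
exists (fun e => cboxint (const_mx (- abs_repr h e)) (const_mx (abs_repr h e))
  (fun w => (c +i* 0)%C * (box_fourier 1 (- abs_repr k e) (abs_repr k e) (fe e) w *
       expi (- 1 * dotv w (grepr_vec y e))))); split => //.
- rewrite fourierE -I1; congr gint; apply/funext => w.
  by rewrite fourier_invE mulrA.
- move=> e he; rewrite cboxintZ; last exact: (gsf_net_cont net1).
  rewrite (box_fourier_inversion (- abs_repr k e) (abs_repr k e) (abs_repr h e)
      (grepr_vec y e) (or_introl erefl) (cf e he)).
  exact: cmul_inv_2pi.
Qed.
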